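(* Let $\Omega\subset\mathbb{R}^2$ be a bounded convex domain with $\partial\Omega\in C^3$, let $m>2$ be an integer and let $0<\epsilon\ll1$. The unique solution $u(\vec x,\vec w)$ to $$\epsilon\,\vec w\cdot\nabla_x u+u-\bar u=f(\vec x,\vec w)\ \text{ in }\Omega\times\mathbb{S}^1,\qquad u(\vec x_0,\vec w)=h(\vec x_0,\vec w)\ \text{ for }\vec w\cdot\vec\nu<0,\ \vec x_0\in\partial\Omega$$ satisfies $$\Vert u\Vert_{L^\infty(\Omega\times\mathbb{S}^1)}\le C\Big(\frac{1}{\epsilon^{1+\frac1m}}\Vert f\Vert_{L^2(\Omega\times\mathbb{S}^1)}+\frac{1}{\epsilon^{2+\frac1m}}\Vert f\Vert_{L^{\frac{2m}{2m-1}}(\Omega\times\mathbb{S}^1)}+\Vert f\Vert_{L^\infty(\Omega\times\mathbb{S}^1)}$$ $$\qquad+\frac{1}{\epsilon^{\frac12+\frac1m}}\Vert h\Vert_{L^2(\Gamma^-)}+\frac{1}{\epsilon^{\frac1m}}\Vert h\Vert_{L^m(\Gamma^-)}+\Vert h\Vert_{L^\infty(\Gamma^-)}\Big),$$ where $C>0$ is independent of $\epsilon$, $f$, $h$ (it depends only on $\Omega$ and $m$).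
   Context: $\bar u(\vec x)=\frac1{2\pi}\int_{\mathbb{S}^1}u(\vec x,\vec w)\,d\vec w$; $\vec\nu$ is the outward unit normal; $\Gamma^{\pm}=\{(\vec x,\vec w):\vec x\in\partial\Omega,\ \vec w\in\mathbb{S}^1,\ \pm\vec w\cdot\vec\nu>0\}$. Norms on $\Omega\times\mathbb{S}^1$ are the usual Lebesgue norms. On the boundary, for $1\le p<\infty$, $\Vert h\Vert_{L^p(\Gamma^\pm)}=\big(\iint_{\Gamma^\pm}|h|^p\,|\vec w\cdot\vec\nu|\,d\vec w\,d\vec x\big)^{1/p}$, and $\Vert h\Vert_{L^\infty(\Gamma^\pm)}=\sup_{\Gamma^\pm}|h|$. The data $f,h$ are such that the norms on the right-hand side are finite. ''$0<\epsilon\ll1$'' means that $\epsilon$ is sufficiently small. *)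

(* Defs.v *)
From HB Require Import structures.
From mathcomp Require Import all_boot all_order all_algebra.
From mathcomp Require Import all_classical all_reals all_analysis.

Set Implicit Arguments.
Unset Strict Implicit.
Unset Printing Implicit Defensive.

Import Order.TTheory GRing.Theory Num.Theory.
Import numFieldTopology.Exports numFieldNormedType.Exports.

Local Open Scope classical_set_scope.
Local Open Scope ring_scope.

(* The canonical norm on [R * R] is the max norm: it has the right topology and
   the right bounded sets, but lengths and angles are taken from [dot]. *)
Definition dot (R : realType) (x y : R * R) : R := x.1 * y.1 + x.2 * y.2.

Definition enorm (R : realType) (x : R * R) : R := Num.sqrt (dot x x).

Definition S1 (R : realType) : set (R * R) := [set w | enorm w = 1].

Definition rot90 (R : realType) (e : R * R) : R * R := (- e.2, e.1).

Definition boundary (T : topologicalType) (A : set T) : set T :=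
  closure A `\` A°.

Definition C3 (R : realType) (g : R -> R) : Prop :=
  (forall k x, (k < 3)%N -> derivable (derive1n k g) x 1) /\ continuous (derive1n 3 g).

(* Near each boundary point, in a suitable orthonormal frame [e, rot90 e]
   centred there, Omega is the strict epigraph of a C^3 function. *)
Definition C3_boundary (R : realType) (Omega : set (R * R)) : Prop :=
  forall x0, boundary Omega x0 ->
    exists (e : R * R) (r : R) (g : R -> R),
      [/\ S1 e, 0 < r, C3 g &
        forall y, enorm (y - x0) < r ->
          (Omega y <-> g (dot (y - x0) e) < dot (y - x0) (rot90 e))].

Definition outward_unit_normal (R : realType) (Omega : set (R * R))
    (x n : R * R) : Prop :=
  [/\ S1 n,
      forall v, dot v n < 0 -> \forall t \near 0^'+, Omega (x + t *: v) &
      forall v, 0 < dot v n -> \forall t \near 0^'+, ~ closure Omega (x + t *: v)].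

(* When the boundary is C^1 there is exactly one outward unit normal at each
   boundary point; the default value 0 is never used there. *)
Definition nu (R : realType) (Omega : set (R * R)) (x : R * R) : R * R :=
  xget 0 (outward_unit_normal Omega x).

Definition Gamma_minus (R : realType) (Omega : set (R * R)) :
    set ((R * R) * (R * R)) :=
  [set z | [/\ boundary Omega z.1, S1 z.2 & dot z.2 (nu Omega z.1) < 0]].

Section arc_length_on_the_circle.
Context (R : realType).

Definition circle_param (t : R) : R * R := (cos t, sin t).

Lemma measurable_circle_param :
  measurable_fun [set: measurableTypeR R] circle_param.
Proof.
apply/measurable_fun_pairP; split; apply: measurable_realfun.continuous_measurable_fun => /=.
  exact: continuous_cos.
exact: continuous_sin.
Qed.

Definition angle_measure : set (measurableTypeR R) -> \bar R :=
  mrestr lebesgue_measure (measurable_itv `[0, 2 * pi[).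

HB.instance Definition _ := Measure.on angle_measure.

(* Arc length on the unit circle, as a measure on the plane carried by [S1]. *)
Definition circle_measure : set (R * R) -> \bar R :=
  pushforward angle_measure circle_param.

HB.instance Definition _ := Measure.copy circle_measure
  (measure_function_pushforward__canonical__measure_function_Measure
     angle_measure measurable_circle_param).

Lemma circle_measure_fin : fin_num_fun circle_measure.
Proof.
move=> U mU; rewrite /circle_measure /pushforward /angle_measure /mrestr.
have mV : measurable (circle_param @^-1` U).
  by rewrite -[X in measurable X]setTI; exact: measurable_circle_param.
rewrite ge0_fin_numE ?measure_ge0//.
apply: (@le_lt_trans _ _ (lebesgue_measure `[0, 2 * pi : R[)).
  by apply: le_measure; rewrite ?inE//; exact: measurableI.
by rewrite lebesgue_measure_itv/=; case: ifP; rewrite ?ltry.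
Qed.

HB.instance Definition _ :=
  Measure_isFinite.Build _ _ _ circle_measure circle_measure_fin.

End arc_length_on_the_circle.

Section arc_length_on_the_boundary.
Context (R : realType).
Local Open Scope ereal_scope.

Definition ediam (A : set (R * R)) : \bar R :=
  maxe 0 (ereal_sup [set (enorm (p.1 - p.2))%:E | p in A `*` A]).

Definition small_ediam (delta : R) (A : set (R * R)) : \bar R :=
  if ediam A <= delta%:E then ediam A else +oo.

(* One-dimensional Hausdorff outer measure: [mu_ext (small_ediam delta) A] is the
   infimum of the sums of diameters over countable covers of A by sets of
   diameter at most delta (Borel sets, which does not change the infimum). The
   normalization is such that a segment has its length as measure. *)
Definition hausdorff1 (A : set (R * R)) : \bar R :=
  ereal_sup [set mu_ext (small_ediam delta) A | delta in [set d : R | (0 < d)%R]].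

Lemma small_ediam_ge0 delta A : 0 <= small_ediam delta A.
Proof.
by rewrite /small_ediam; case: ifP => _; rewrite ?leey// /ediam le_max lexx.
Qed.

Lemma small_ediam0 delta : (0 < delta)%R -> small_ediam delta set0 = 0.
Proof.
move=> d0; suff ediam0 : ediam set0 = 0 by rewrite /small_ediam ediam0 lee_fin ltW.
by rewrite /ediam set0X image_set0 ereal_sup0; apply/max_idPl; rewrite leNye.
Qed.

Lemma hausdorff1_set0 : hausdorff1 set0 = 0.
Proof.
apply/eqP; rewrite eq_le; apply/andP; split.
  apply: ge_ereal_sup => _ [d /= d0 <-].
  by rewrite mu_ext0//; [exact: small_ediam0 | exact: small_ediam_ge0].
apply: ereal_sup_ubound; exists 1%R => //=.
by rewrite mu_ext0//; [exact: small_ediam0 | exact: small_ediam_ge0].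
Qed.

Lemma hausdorff1_ge0 A : 0 <= hausdorff1 A.
Proof.
apply: (@le_trans _ _ (mu_ext (small_ediam 1) A)).
  exact/mu_ext_ge0/small_ediam_ge0.
by apply: ereal_sup_ubound; exists 1%R => /=.
Qed.

Lemma le_hausdorff1 : {homo hausdorff1 : A B / A `<=` B >-> A <= B}.
Proof.
move=> A B AB; apply: ge_ereal_sup => _ [d /= d0 <-].
apply: (@le_trans _ _ (mu_ext (small_ediam d) B)); first exact: le_mu_ext.
by apply: ereal_sup_ubound; exists d.
Qed.

Lemma hausdorff1_sigma_subadditive : sigma_subadditive hausdorff1.
Proof.
move=> F; apply: ge_ereal_sup => _ [d /= d0 <-].
apply: (le_trans (mu_ext_sigma_subadditive (small_ediam_ge0 d) F)).
apply: lee_nneseries => [n _ _|n _]; first exact/mu_ext_ge0/small_ediam_ge0.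
by apply: ereal_sup_ubound; exists d.
Qed.

HB.instance Definition _ := isOuterMeasure.Build R (R * R)%type hausdorff1
  hausdorff1_set0 hausdorff1_ge0 le_hausdorff1 hausdorff1_sigma_subadditive.

(* Arc length on a C^1 curve is the restriction of this measure to the curve.
   Its sigma-algebra, that of the Caratheodory measurable sets, contains the
   Borel sets. *)
Definition arc_length : set (caratheodory_type hausdorff1) -> \bar R :=
  hausdorff1.

HB.instance Definition _ := Measure.copy arc_length
  (OuterMeasure.sort hausdorff1 : set (caratheodory_type hausdorff1) -> \bar R).

End arc_length_on_the_boundary.

Section transport.
Context (R : realType).
Local Open Scope ereal_scope.

Definition phase_measure :
    set ((measurableTypeR R * measurableTypeR R) * (R * R)) -> \bar R :=
  (@lebesgue_measure R \x @lebesgue_measure R) \x @circle_measure R.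

HB.instance Definition _ := Measure.on phase_measure.

Definition phase_norm (Omega : set (R * R)) (p : \bar R)
    (u : (R * R) * (R * R) -> R) : \bar R :=
  'N[phase_measure]_p[(EFin \o u) \_ (Omega `*` @S1 R)].

Definition inflow_norm (Omega : set (R * R)) (p : R)
    (h : (R * R) * (R * R) -> R) : \bar R :=
  (\int[@arc_length R]_(x in boundary Omega)
     \int[@circle_measure R]_(w in [set w | Gamma_minus Omega (x, w)])
       (`|h (x, w)| `^ p * `|dot w (nu Omega x)|)%:E) `^ p^-1.

Definition inflow_sup_norm (Omega : set (R * R))
    (h : (R * R) * (R * R) -> R) : \bar R :=
  ereal_sup [set (`|h z|)%:E | z in Gamma_minus Omega].

Local Close Scope ereal_scope.

Definition velocity_average (u : (R * R) * (R * R) -> R) (x : R * R) : R :=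
  (2 * pi)^-1 * \int[@circle_measure R]_(w in @S1 R) u (x, w).

Definition absolutely_continuous_on (a b : R) (g : R -> R) : Prop :=
  forall e, 0 < e -> exists2 d, 0 < d &
    forall (n : nat) (l r : 'I_n -> R),
      (forall i, a <= l i /\ l i <= r i /\ r i <= b) ->
      (forall i j, i != j -> r i <= l j \/ r j <= l i) ->
      \sum_(i < n) (r i - l i) < d ->
      \sum_(i < n) `|g (r i) - g (l i)| < e.

(* Solutions of  eps w . grad_x u + u - ubar = f,  u = h on Gamma_minus,  in
   L^2(Omega x S^1). As f is merely measurable, u need not be differentiable in
   x: w . grad_x u is the derivative of u in the direction w, and u is
   absolutely continuous along almost every characteristic line. The boundary
   value of u is its limit along the characteristic, from inside Omega. *)
Definition transport_solution (Omega : set (R * R)) (eps : R)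
    (f h u : (R * R) * (R * R) -> R) : Prop :=
  [/\ measurable_fun (Omega `*` @S1 R) u,
      (phase_norm Omega 2%:E u < +oo)%E,
      {ae phase_measure, forall z, (Omega `*` @S1 R) z ->
        let: (x, w) := z in
        forall a b, (forall t, a <= t <= b -> Omega (x + t *: w)) ->
          absolutely_continuous_on a b (fun t => u (x + t *: w, w))},
      {ae phase_measure, forall z, (Omega `*` @S1 R) z ->
        let: (x, w) := z in
        derivable (fun y => u (y, w)) x w /\
        eps * 'D_w (fun y => u (y, w)) x + u (x, w) - velocity_average u x
          = f (x, w)} &
      {ae phase_measure, forall z, (Omega `*` @S1 R) z ->
        let: (x, w) := z in
        forall t, Gamma_minus Omega (x + t *: w, w) ->
          u (x + s *: w, w) @[s --> t^'+] --> h (x + t *: w, w)}].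

End transport.

(* Main.v *)
From HB Require Import structures.
Require Import Defs.
From mathcomp Require Import all_boot all_order all_algebra.
From mathcomp Require Import all_classical all_reals all_analysis.
From mathcomp Require Import measurable_realfun ess_sup_inf hoelder ring lra.

(* Along a characteristic the equation integrates to [u = B + T (f + v)], where [v] is
   the velocity average of [u], [B] the attenuated inflow and [T] the average over an
   exponentially distributed backward flight. Hence [v] solves a scalar equation
   [v = Bbar + S f + K v] on [Omega]; [K] is strictly sub-Markov, since a flight longer
   than the diameter leaves [Omega], and monotone iteration yields [v].

   For the bound, split the data into positive and negative parts. For data >= 0,
   [alpha = (v - sup h)^+] satisfies [alpha <= S f + K alpha]. Two successive flights in
   directions [w], [w'], weighted by [det(w, w')^2], which averages to 1/2 and absorbs
   the Jacobian of the two flights, give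
     [K^2 alpha x <= sup alpha / 2 + C eps^-2 int (eta x alpha)],
   where [eta x y = eps^2 / (eps^2 + |x - y|^2)]. An explicit supersolution of the adjoint
   of [K], namely [A - (|y - x|^2 + delta^2)^a + s] with [a = 1/(2m)] and a source [s]
   dominating [eps^(1/m) eta x] up to a constant, bounds that integral by
   [C eps^(-1/m) |f|_1], and [|f|_1] is bounded by Hoelder's inequality. Of the boundary
   norms only the supremum is needed.

   The difference [d] of two solutions satisfies [|d| <= T (average of |d|)] by a mean value
   inequality for absolutely continuous functions; integrating over [Omega x S^1] gives
   [int |d| <= (1 - k) int |d|] with [k > 0], so [d = 0]. *)

Set Implicit Arguments.
Unset Strict Implicit.
Unset Printing Implicit Defensive.

Import Order.TTheory GRing.Theory Num.Theory.
Import numFieldTopology.Exports numFieldNormedType.Exports.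

Local Open Scope classical_set_scope.
Local Open Scope ring_scope.

(** * Integration on the phase space *)

Section product_sigma_finite.
Context d1 d2 (T1 : measurableType d1) (T2 : measurableType d2) (R : realType).
Variables (m1 : {sigma_finite_measure set T1 -> \bar R})
  (m2 : {sigma_finite_measure set T2 -> \bar R}).

(** The contraction factor of [K] is only 1 - exp(-L/eps), so iteration alone yields a bound
    exponential in 1/eps. A polynomial bound has to use the diffusive scaling: a flight has mean
    square displacement 2 eps^2, so [K] - 1 acts like eps^2/2 times the Laplacian. In the plane the
    Laplacian of |z|^(2a) is 4 a^2 |z|^(2a-2), whence the barrier; staying clear of the borderline
    case, the logarithm, costs the factor eps^(2a) = eps^(1/m). The kernel exp(-|x-y|/eps) / (2 pi
    eps |x-y|) of [K] is unbounded, and that of [K^2] still has a logarithmic singularity, so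
    neither maps integrable functions to bounded ones. The weight det^2 suppresses the nearly
    parallel pairs of flights that cause this; what it leaves is half of the supremum, absorbed on
    the left. Functions are extended by zero and all operators act on the whole plane: by convexity
    a flight that has left [Omega] never returns, so extension by zero amounts to stopping at the
    boundary. With nonnegative data every exchange of integrals is Tonelli's theorem. *)

Lemma sigma_finite_product : sigma_finite setT (m1 \x m2)%E.
Proof.
have /sigma_finiteP[F [TF ndF Foo]] := sigma_finiteT m1.
have /sigma_finiteP[G [TG ndG Goo]] := sigma_finiteT m2.
exists (fun n => F n `*` G n).
  apply/esym; rewrite -subTset => -[x y] _.
  have [n _ Fx] : (\bigcup_k F k) x by rewrite -TF.
  have [k _ Gy] : (\bigcup_k G k) y by rewrite -TG.
  exists (n + k)%N => //; split => /=.
  - by move/subsetPset : (ndF _ _ (leq_addr k n)); exact.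
  - by move/subsetPset : (ndG _ _ (leq_addl n k)); exact.
move=> n; have [mF Fy] := Foo n; have [mG Gy] := Goo n.
split; first exact: measurableX.
by rewrite product_measure1E// lte_mul_pinfty// ge0_fin_numE.
Qed.

End product_sigma_finite.

Ltac msolve := repeat first
  [ done | exact: measurable_id | exact: measurable_fst | exact: measurable_snd
  | exact: measurable_cst
  | apply: measurable_fun_pair | apply: measurable_funD | apply: measurable_funB
  | apply: measurable_funM | apply: measurable_funN
  | apply: (measurableT_comp measurable_fst)
  | apply: (measurableT_comp measurable_snd) ].

Section measures.
Variable R : realType.
Local Open Scope ereal_scope.

(** Named so that sigma-finiteness, which Tonelli's theorem asks for, can be declared for it. *)
Definition lam2 : set (measurableTypeR R * measurableTypeR R) -> \bar R :=
  (@lebesgue_measure R \x @lebesgue_measure R).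
HB.instance Definition _ := Measure.on lam2.
HB.instance Definition _ := Measure_isSigmaFinite.Build _ _ _ lam2
  (sigma_finite_product lebesgue_measure lebesgue_measure).
HB.instance Definition _ := Measure_isSigmaFinite.Build _ _ _ (@phase_measure R)
  (sigma_finite_product lam2 (@circle_measure R)).

Lemma lam2E (a : R * R -> \bar R) :
  measurable_fun [set: R * R] a -> (forall x, 0 <= a x) ->
  \int[lam2]_x a x = \int[lebesgue_measure]_y \int[lebesgue_measure]_z a (y, z).
Proof. by move=> ma a0; rewrite -(fubini_tonelli1 (m1:=@lebesgue_measure R) (m2:=@lebesgue_measure R) a). Qed.

Implicit Types F : (R * R) * (R * R) -> \bar R.

Lemma phaseE F : measurable_fun [set: (R * R) * (R * R)] F -> (forall z, 0 <= F z) ->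
  \int[@phase_measure R]_z F z = \int[lam2]_x \int[@circle_measure R]_w F (x, w).
Proof. by move=> mF F0; rewrite -(fubini_tonelli1 (m1:=lam2) (m2:=@circle_measure R) F). Qed.

Lemma phaseE2 F : measurable_fun [set: (R * R) * (R * R)] F -> (forall z, 0 <= F z) ->
  \int[@phase_measure R]_z F z = \int[@circle_measure R]_w \int[lam2]_x F (x, w).
Proof. by move=> mF F0; rewrite -(fubini_tonelli2 (m1:=lam2) (m2:=@circle_measure R) F). Qed.

Lemma measurable_affine (a b : R) :
  measurable_fun [set: measurableTypeR R]
    ((fun s => a * s + b)%R : measurableTypeR R -> measurableTypeR R).
Proof.
apply: (@measurable_realfun.continuous_measurable_fun R) => x.
by apply: cvgD; [apply: cvgMr; exact: cvg_id|exact: cvg_cst].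
Qed.

(** The scaled image measure agrees with Lebesgue measure on the intervals []x, y]], which determine
    it. For [a < 0] the preimage is closed on the left instead of on the right, with the same
    length. *)
Lemma affine_measure (a b : R) (A : set R) : a != 0%R -> measurable A ->
  lebesgue_measure A =
  `|a|%:E * lebesgue_measure ((fun s : R => a * s + b)%R @^-1` A).
Proof.
move=> a0 mA.
have na : (0 <= `|a|)%R by [].
pose mu : {measure set (measurableTypeR R) -> \bar R} :=
  mscale (NngNum na)
   (measure_function_pushforward__canonical__measure_function_Measure
     (@lebesgue_measure R) (measurable_affine a b)).
apply: (@lebesgue_measure_unique _ mu) => // _ [[x y] /= _ <-].
rewrite /mu/= /mscale/= /pushforward/= lebesgue_measure_itv/= lte_fin.
have na0 : (0 < `|a|)%R by rewrite normr_gt0.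
have [a_gt0|a_lt0|/eqP] := ltgtP 0%R a; last by rewrite eq_sym (negbTE a0).
- have -> : (fun s : R => a * s + b)%R @^-1` [set` `]x, y]%R] =
      [set` `](x - b) / a, (y - b) / a]%R].
    by apply/seteqP; split => s /=; rewrite !in_itv/= ltr_pdivrMr//
      ler_pdivlMr// [(s * a)%R]mulrC ltrBlDr lerBrDr.
  rewrite lebesgue_measure_itv/= lte_fin ltr_pM2r ?invr_gt0// ltrD2r.
  case: ifPn => _; last by rewrite mule0.
  by rewrite -!EFinD -EFinM; congr EFin; rewrite gtr0_norm//; field; rewrite gt_eqF.
- have -> : (fun s : R => a * s + b)%R @^-1` [set` `]x, y]%R] =
      [set` `[(y - b) / a, (x - b) / a[%R].
    apply/seteqP; split => s /=; by rewrite !in_itv/= ltr_ndivlMr//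
      ler_ndivrMr// [(s * a)%R]mulrC ltrBlDr lerBrDr andbC.
  rewrite lebesgue_measure_itv/= lte_fin ltr_nM2r ?invr_lt0// ltrD2r.
  case: ifPn => _; last by rewrite mule0.
  by rewrite -!EFinD -EFinM; congr EFin; rewrite ltr0_norm//; field; rewrite lt_eqF.
Qed.

Lemma integral_affine (a b : R) (f : R -> \bar R) : a != 0%R ->
  measurable_fun [set: R] f -> (forall s, 0 <= f s) ->
  `|a|%:E * \int[lebesgue_measure]_s f (a * s + b)%R =
  \int[lebesgue_measure]_s f s.
Proof.
move=> a0 mf f0.
have na : (0 <= `|a|)%R by [].
pose pf : {measure set (measurableTypeR R) -> \bar R} :=
   (measure_function_pushforward__canonical__measure_function_Measure
     (@lebesgue_measure R) (measurable_affine a b)).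
transitivity (\int[mscale (NngNum na) pf]_s f s).
  rewrite ge0_integral_mscale//=; congr (_ * _).
  by rewrite /pf/= ge0_integral_pushforward//=; exact: measurable_affine.
by apply: eq_measure_integral => /= A mA _; rewrite /mscale/= (affine_measure b a0 mA).
Qed.

Lemma integral_shift (b : R) (f : R -> \bar R) :
  measurable_fun [set: R] f -> (forall s, 0 <= f s) ->
  \int[lebesgue_measure]_s f (s + b)%R = \int[lebesgue_measure]_s f s.
Proof.
move=> mf f0; rewrite -[RHS](@integral_affine 1 b)// normr1 mul1e.
by apply: eq_integral => s _; rewrite mul1r.
Qed.

Lemma integral_reflect (b : R) (f : R -> \bar R) :
  measurable_fun [set: R] f -> (forall s, 0 <= f s) ->
  \int[lebesgue_measure]_s f (b - s)%R = \int[lebesgue_measure]_s f s.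
Proof.
move=> mf f0; rewrite -[RHS](@integral_affine (-1) b)// normrN1 mul1e.
by apply: eq_integral => s _; rewrite mulN1r addrC.
Qed.

Lemma lam2_shift (v : R * R) (a : R * R -> \bar R) :
  measurable_fun [set: R * R] a -> (forall x, 0 <= a x) ->
  \int[lam2]_x a (x + v)%R = \int[lam2]_x a x.
Proof.
move=> ma a0.
have ms : measurable_fun [set: R * R] (fun x : R * R => (x + v)%R).
  by apply/measurable_fun_pairP; split;
    apply: measurable_funD.
rewrite !lam2E//; last exact: (measurableT_comp ma ms).
rewrite -[RHS](@integral_shift v.1)/=; last 2 first.
- exact: (measurable_fun_fubini_tonelli_F (m2 := @lebesgue_measure R) a).
- by move=> s; exact: integral_ge0.
apply: eq_integral => y _; rewrite -[RHS](@integral_shift v.2)//=.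
by apply: measurableT_comp ma _; exact: pair1_measurable.
Qed.

(** Liouville's theorem for free transport: at a fixed velocity the flow is a translation of the
    plane. Both the duality of flights and the transfer of null sets to lines rest on it. *)
Lemma phase_shift (t : R) F :
  measurable_fun [set: (R * R) * (R * R)] F -> (forall z, 0 <= F z) ->
  \int[@phase_measure R]_z F (z.1 + t *: z.2, z.2)%R = \int[@phase_measure R]_z F z.
Proof.
move=> mF F0.
have ms : measurable_fun [set: (R * R) * (R * R)]
    (fun z : (R * R) * (R * R) => (z.1 + t *: z.2, z.2)%R).
  by msolve.
rewrite !phaseE2//; last exact: (measurableT_comp mF ms).
apply: eq_integral => w _ /=.
rewrite (@lam2_shift (t *: w) (fun x => F (x, w)))//.
by apply: measurableT_comp mF _; exact: pair2_measurable.
Qed.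
End measures.

(** * Circle averages, Borel sets of the plane and a linear change of variables *)

Section m.
Variable R : realType.
Local Open Scope ereal_scope.

Lemma FTC2_derive (f F : R -> R) (a b : R) : (a < b)%R ->
  (forall x : R, is_derive x 1%R F (f x)) -> continuous f ->
  \int[lebesgue_measure]_(x in `[a, b]) (f x)%:E = (F b - F a)%:E.
Proof.
move=> ab dF cf.
have cF : continuous F.
  by move=> x; apply: differentiable_continuous; apply/derivable1_diffP; have [] := dF x.
rewrite (@continuous_FTC2 _ f F)//.
- exact: continuous_subspaceT.
- split.
  + by move=> x _; have [] := dF x.
  + by apply: cvg_at_right_filter; exact: cF.
  + by apply: cvg_at_left_filter; exact: cF.
- by move=> x _; rewrite derive1E; have [] := dF x.
Qed.

Lemma circ_integral (F : R * R -> \bar R) : measurable_fun [set: R * R] F ->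
  (forall w, 0 <= F w) ->
  \int[@circle_measure R]_w F w =
  \int[lebesgue_measure]_(t in `[0%R, (2 * pi)%R]) F (cos t, sin t).
Proof.
move=> mF F0.
transitivity (\int[@angle_measure R]_(t in @circle_param R @^-1` [set: R * R])
    (F \o @circle_param R) t).
  rewrite -(@ge0_integral_pushforward _ _ _ _ _ _ (@measurable_circle_param R)
    (@angle_measure R) [set: R * R] F)//.
have mG : measurable_fun [set: R] (fun t => F (cos t, sin t)).
  by apply: (measurableT_comp mF); exact: measurable_circle_param.
rewrite preimage_setT.
have mI : measurable (`[0%R, (2 * pi)%R[%classic : set R) by [].
(* The angle measure ignores everything off [[0, 2 * pi[]; closing the interval adds a null
   point. *)
rewrite (@ge0_negligible_integral _ (measurableTypeR R) R (@angle_measure R) [set: R]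
   (~` `[0%R, (2 * pi)%R[%classic) (fun t => F (cos t, sin t)))//=.
- rewrite setTD setCK -integral_itv_bndo_bndc; last exact: measurable_funS mG.
  apply: eq_measure_integral => A mA AI; rewrite /angle_measure/= /mrestr.
  by congr (lebesgue_measure _); apply/setIidPl.
- exact: measurableC.
- by rewrite /angle_measure/= /mrestr setICl measure0.
Qed.

Lemma S1_param (t : R) : @S1 R (cos t, sin t).
Proof. by rewrite /S1/= /enorm /dot/= -!expr2 cos2Dsin2 sqrtr1. Qed.

(** [circle_measure] is a measure on the whole plane; through the parametrization a comparison on
    [S1] is enough. Later majorants are controlled only there. *)
Lemma circ_le (F G : R * R -> \bar R) : measurable_fun [set: R * R] F ->
  measurable_fun [set: R * R] G -> (forall w, 0 <= F w) -> (forall w, 0 <= G w) ->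
  (forall w, S1 w -> F w <= G w) ->
  \int[@circle_measure R]_w F w <= \int[@circle_measure R]_w G w.
Proof.
move=> mF mG F0 G0 FG; rewrite !circ_integral//; apply: ge0_le_integral => //.
- by apply: measurable_funTS; apply: (measurableT_comp mF); exact: measurable_circle_param.
- by apply: measurable_funTS; apply: (measurableT_comp mG); exact: measurable_circle_param.
by move=> t _; apply: FG; exact: S1_param.
Qed.

(** The angular averages needed later, of the corrected barrier and of det(w, v)^2, are those of
    quadratic polynomials in the direction: linear and mixed terms drop out, each square contributes
    pi. *)
Lemma circ_moments (F : R * R -> \bar R) (c0 c1 c2 c3 c4 c5 : R) :
  measurable_fun [set: R * R] F -> (forall w, 0 <= F w) ->
  (forall w : R * R, S1 w -> F w = (c0 + c1 * w.1 + c2 * w.2 + c3 * w.1 ^+ 2 +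
    c4 * w.2 ^+ 2 + c5 * (w.1 * w.2))%:E) ->
  \int[@circle_measure R]_w F w = (2 * pi * c0 + pi * c3 + pi * c4)%:E.
Proof.
move=> mF F0 FE; rewrite circ_integral//.
pose f (t : R) := (c0 + c1 * cos t + c2 * sin t + c3 * cos t ^+ 2 +
    c4 * sin t ^+ 2 + c5 * (cos t * sin t))%R.
pose G (t : R) := (c0 * t + c1 * sin t - c2 * cos t + c3 / 2 * (t + sin t * cos t) +
    c4 / 2 * (t - sin t * cos t) + c5 / 2 * (sin t * sin t))%R.
transitivity (\int[lebesgue_measure]_(t in `[0%R, (2 * pi)%R]) (f t)%:E).
  by apply: eq_integral => t _; rewrite FE//; exact: S1_param.
have dG (t : R) : is_derive t 1%R G (f t).
  rewrite /G /f; apply: is_derive_eq.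
  rewrite /GRing.scale/=.
  have := cos2Dsin2 t; set c := cos t; set s := sin t => cs.
  have s2 : (s ^+ 2 = 1 - c ^+ 2)%R by rewrite -cs addrAC subrr add0r.
  have -> : (s * - s = c ^+ 2 - 1)%R by rewrite mulrN -expr2 s2 opprB.
  by rewrite s2; field.
have cf : continuous f.
  move=> t; rewrite /f.
  have cc := @continuous_cos R t; have cs := @continuous_sin R t.
  have cst (k : R) (g : R -> R) : g u @[u --> t] --> g t -> (k * g u)%R @[u --> t] --> (k * g t)%R.
    by move=> ?; apply: cvgM => //; exact: cvg_cst.
  apply: cvgD; last by apply: cst; apply: cvgM.
  apply: cvgD; last by apply: cst; apply: cvgM.
  apply: cvgD; last by apply: cst; apply: cvgM.
  apply: cvgD; last exact: cst.
  by apply: cvgD; [exact: cvg_cst|exact: cst].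
have pi2 : (0 < 2 * pi :> R)%R by rewrite mulr_gt0// pi_gt0.
rewrite (FTC2_derive pi2 dG cf) /G; congr EFin.
have -> : (2 * pi)%R = (pi *+ 2)%R :> R by rewrite mulr_natl.
by rewrite sin2pi cos2pi sin0 cos0; field.
Qed.

(** The measurable sets of the plane are those of the product structure; an open set belongs to it
    as the countable union of the rational boxes that it contains. *)
Lemma measurable_open2 (U : set (R * R)) : open U -> measurable U.
Proof.
move=> oU.
pose box (q : rat * rat * rat) : set (R * R) :=
  ball (ratr q.1.1 : R) (ratr q.2) `*` ball (ratr q.1.2 : R) (ratr q.2).
pose F (n : nat) := if unpickle n is Some q then
  (if `[< box q `<=` U >] then box q else set0) else set0.
have -> : U = \bigcup_n F n.
  apply/seteqP; split => [x Ux|x [n _]]; last first.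
    by rewrite /F; case: unpickle => // q; case: asboolP => // /[apply].
  have /nbhs_ballP[e /= e0 eU] := open_nbhs_nbhs (conj oU Ux).
  have [r] : exists r, (ratr r : R) \in `]0%R, (e / 2)%R[.
    by apply: rat_in_itvoo; rewrite divr_gt0.
  rewrite in_itv/= => /andP[r0 re].
  have [q1] : exists q, (ratr q : R) \in `](x.1 - ratr r)%R, (x.1 + ratr r)%R[.
    by apply: rat_in_itvoo; lra.
  have [q2] : exists q, (ratr q : R) \in `](x.2 - ratr r)%R, (x.2 + ratr r)%R[.
    by apply: rat_in_itvoo; lra.
  rewrite !in_itv/= => /andP[a2 b2] /andP[a1 b1].
  exists (pickle (q1, q2, r)); first exact: I.
  rewrite /F pickleK.
  case: asboolP => [_|]; first by
    split; rewrite /= /ball/= ltr_distlC; apply/andP; split; lra.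
  case; apply: subset_trans eU => y [/=]; rewrite /ball/= => y1 y2; split => /=;
    rewrite /ball/=.
  - move: y1; rewrite !ltr_distlC => /andP[? ?]; apply/andP; split; lra.
  - move: y2; rewrite !ltr_distlC => /andP[? ?]; apply/andP; split; lra.
apply: bigcupT_measurable => n; rewrite /F.
case: unpickle => [q|]; last exact: measurable0.
case: ifPn => _; last exact: measurable0.
by apply: measurableX; apply: measurable_ball.
Qed.

Lemma S1P (w : R * R) : S1 w <-> dot w w = 1%R.
Proof.
rewrite /S1/= /enorm; split => [w1|->]; last by rewrite sqrtr1.
rewrite -[LHS]sqr_sqrtr ?w1 ?expr1n//.
by rewrite /dot -!expr2 addr_ge0// sqr_ge0.
Qed.

Lemma measurable_S1 : measurable (@S1 R).
Proof.
have -> : @S1 R = [set: R * R] `&` (fun w : R * R => dot w w) @^-1` [set 1%R].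
  by apply/seteqP; split => w /=; rewrite S1P; [|case].
have mf : measurable_fun [set: R * R] (fun w : R * R => dot w w).
  by rewrite /dot; msolve.
by apply: mf => //; exact: measurable_set1.
Qed.

(** The change of variables (s, t) -> s w + t v, whose Jacobian is |det(w, v)|, carried out one
    coordinate at a time. It is stated as an inequality to cover parallel vectors, where the left
    side is zero. *)
Lemma det_integral_le (w v : R * R) (a : R * R -> \bar R) :
  measurable_fun [set: R * R] a -> (forall x, 0 <= a x) ->
  `|w.1 * v.2 - w.2 * v.1|%:E *
    \int[lebesgue_measure]_s \int[lebesgue_measure]_t a (s *: w + t *: v)%R
  <= \int[@lam2 R]_x a x.
Proof.
move=> ma a0.
have [->|] := eqVneq (w.1 * v.2 - w.2 * v.1)%R 0%R.
  by rewrite normr0 mul0e; exact: integral_ge0.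
(* The elimination divides by the first coordinate of one of the vectors. If that of [w] vanishes,
   the two are exchanged, which only changes the sign of the determinant. *)
suff H (w' v' : R * R) : w'.1 != 0%R -> (w'.1 * v'.2 - w'.2 * v'.1 != 0)%R ->
    `|w'.1 * v'.2 - w'.2 * v'.1|%:E *
    \int[lebesgue_measure]_t \int[lebesgue_measure]_s a (s *: w' + t *: v')%R
    = \int[@lam2 R]_x a x.
  have mA w' v' : measurable_fun [set: R * R] (fun st => a (st.1 *: w' + st.2 *: v')%R).
    by apply: (measurableT_comp ma) => /=; apply/measurable_fun_pairP; split => /=; msolve.
  move=> det0; have [w10|w10] := eqVneq w.1 0%R.
    have v10 : v.1 != 0%R.
      by apply: contra_neq det0 => ->; rewrite w10 mul0r mulr0 subr0.
    have eqd : (v.1 * w.2 - v.2 * w.1 = - (w.1 * v.2 - w.2 * v.1))%R by ring.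
    have E := H v w v10; rewrite eqd oppr_eq0 normrN in E; rewrite -(E det0).
    rewrite le_eqVlt; apply/orP; left; apply/eqP; congr (_ * _).
    by apply: eq_integral => s _; apply: eq_integral => t _; rewrite addrC.
  have FT := fubini_tonelli (m1:=@lebesgue_measure R) (m2:=@lebesgue_measure R)
    (fun st => a (st.1 *: w + st.2 *: v)%R) (mA w v) (fun _ => a0 _).
  by rewrite -(H w v w10 det0) /= in FT *; rewrite FT.
move=> {w v} w10; set d := (_ - _)%R => d0.
pose w := w'; pose v := v'.
(* Here [y] stands for the first coordinate s w.1 + t v.1, and s has been eliminated from the second
   one; for fixed [y] the latter is affine in t with slope det / w.1. *)
pose g t y : \bar R := a (y, (y - t * v.1) * (w.2 / w.1) + t * v.2)%R.
have mg : measurable_fun [set: R * R] (fun ty => g ty.1 ty.2).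
  by apply: (measurableT_comp ma) => /=; msolve.
have mg1 t : measurable_fun [set: R] (g t).
  by apply: (measurableT_comp mg (pair1_measurable t)).
have step1 t : \int[lebesgue_measure]_s a (s *: w + t *: v)%R =
    `|w.1|^-1%:E * \int[lebesgue_measure]_y g t y.
  rewrite -[in RHS](@integral_affine _ w.1 (t * v.1))//; last by move=> s; exact: a0.
  rewrite muleA -EFinM mulVf ?normr_eq0// mul1e; apply: eq_integral => s _.
  rewrite /g; congr a; rewrite [LHS]surjective_pairing/=; congr (_, _).
    by rewrite mulrC.
  by rewrite addrK mulrA [(w.1 * s)%R]mulrC -!mulrA [(w.1 * _)%R]mulrCA mulfV// mulr1.
have step2 y : \int[lebesgue_measure]_t g t y =
    `|d / w.1|^-1%:E * \int[lebesgue_measure]_z a (y, z).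
  have dw : (d / w.1 != 0)%R by rewrite mulf_neq0 ?invr_eq0.
  rewrite -[in RHS](@integral_affine _ (d / w.1) (y * (w.2 / w.1)) (fun z => a (y, z)))//; last first.
    by apply: (measurableT_comp ma (pair1_measurable y)).
  rewrite muleA -EFinM mulVf ?normr_eq0// mul1e; apply: eq_integral => t _.
  by rewrite /g; congr (a (_, _)); rewrite /d -/w -/v; field.
under eq_integral do rewrite step1.
have mG : measurable_fun [set: R] (fun t => \int[lebesgue_measure]_y g t y).
  exact: (measurable_fun_fubini_tonelli_F (m2 := @lebesgue_measure R) _ mg (fun _ => a0 _)).
rewrite ge0_integralZl//=; last first.
  by move=> t _; apply: integral_ge0 => y _; exact: a0.
have FT := fubini_tonelli (m1:=@lebesgue_measure R) (m2:=@lebesgue_measure R)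
   (fun ty => g ty.1 ty.2) mg (fun _ => a0 _).
rewrite /= in FT; rewrite FT {FT}.
under eq_integral do rewrite step2.
have mA1 : measurable_fun [set: R] (fun y => \int[lebesgue_measure]_z a (y, z)).
  exact: (measurable_fun_fubini_tonelli_F (m2 := @lebesgue_measure R) a).
rewrite ge0_integralZl//=; last first.
  by move=> t _; apply: integral_ge0 => y _; exact: a0.
rewrite lam2E// !muleA -!EFinM normrM normfV -/w.
rewrite [X in X%:E * _](_ : _ = 1%R) ?mul1e//.
by field; rewrite !normr_eq0; apply/andP.
Qed.
End m.

(** * Convex domains and exit times *)

Section geom.
Variable R : realType.

Lemma dotC (x y : R * R) : dot x y = dot y x.
Proof. by rewrite /dot mulrC [x.2 * _]mulrC. Qed.
Lemma dotDl (x y z : R * R) : dot (x + y) z = dot x z + dot y z.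
Proof. by rewrite /dot/=; ring. Qed.
Lemma dotZl (t : R) (x z : R * R) : dot (t *: x) z = t * dot x z.
Proof. by rewrite /dot/= /GRing.scale/=; ring. Qed.
Lemma dotBl (x y z : R * R) : dot (x - y) z = dot x z - dot y z.
Proof. by rewrite /dot/=; ring. Qed.

Lemma pair_eq (x y : R * R) : x.1 = y.1 -> x.2 = y.2 -> x = y.
Proof. by case: x y => [? ?] [? ?] /= -> ->. Qed.

Lemma enormZ (t : R) (x : R * R) : enorm (t *: x) = `|t| * enorm x.
Proof.
rewrite /enorm (_ : dot _ _ = t ^+ 2 * dot x x); last first.
  by rewrite dotZl dotC dotZl mulrA expr2.
by rewrite sqrtrM ?sqr_ge0// sqrtr_sqr.
Qed.

Lemma dot_continuous (a b : R * R) : continuous (fun y : R * R => dot (y - a) b).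
Proof.
move=> x; rewrite /dot/=.
have c1 : (y - a).1 @[y --> x] --> (x - a).1.
  by apply: cvgB; [exact: cvg_fst|exact: cvg_cst].
have c2 : (y - a).2 @[y --> x] --> (x - a).2.
  by apply: cvgB; [exact: cvg_snd|exact: cvg_cst].
by apply: cvgD; (apply: cvgM; last exact: cvg_cst).
Qed.

Lemma enorm_continuous (a : R * R) : continuous (fun y : R * R => enorm (y - a)).
Proof.
move=> x; rewrite /enorm.
have c1 : (y - a).1 @[y --> x] --> (x - a).1.
  by apply: cvgB; [exact: cvg_fst|exact: cvg_cst].
have c2 : (y - a).2 @[y --> x] --> (x - a).2.
  by apply: cvgB; [exact: cvg_snd|exact: cvg_cst].
have cd : dot (y - a) (y - a) @[y --> x] --> dot (x - a) (x - a).
  by rewrite /dot; apply: cvgD; exact: cvgM.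
exact: (cvg_comp _ _ cd (@sqrt_continuous R _)).
Qed.

Lemma line_continuous (x w : R * R) : continuous (fun s : R => x + s *: w).
Proof. by move=> s; apply: cvgD; [exact: cvg_cst|apply: cvgZr_tmp; exact: cvg_id]. Qed.

Section convex.
Variable Omega : set (R * R).
Hypotheses (Omega_open : open Omega) (Omega_convex : convex_set Omega).

Lemma convexP (x y : R * R) (t : R) : 0 <= t <= 1 ->
  Omega x -> Omega y -> Omega (t *: x + (1 - t) *: y).
Proof.
move=> /andP[t0 t1] Ox Oy.
have := Omega_convex (Itv01 t0 t1) (mem_set Ox) (mem_set Oy).
by rewrite inE.
Qed.

Lemma segment_in (x w : R * R) (a b t : R) : a <= t <= b ->
  Omega (x + a *: w) -> Omega (x + b *: w) -> Omega (x + t *: w).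
Proof.
move=> /andP[at_ tb] Oa Ob.
have [ab|ba] := ltP a b; last first.
  by have -> : t = a by apply/eqP; rewrite eq_le at_ (le_trans tb ba).
have -> : x + t *: w = ((b - t) / (b - a)) *: (x + a *: w) +
    (1 - (b - t) / (b - a)) *: (x + b *: w).
  have ba : b - a != 0 by rewrite subr_eq0 gt_eqF.
  by apply: pair_eq; rewrite /= /GRing.scale/=; field.
apply: convexP => //; rewrite divr_ge0 ?subr_ge0 ?(ltW ab)//=.
by rewrite ler_pdivrMr ?subr_gt0// mul1r lerD2l lerN2.
Qed.

Lemma segment_closure (x y : R * R) (t : R) : 0 < t <= 1 ->
  closure Omega x -> Omega y -> closure Omega (x + t *: (y - x)).
Proof.
move=> /andP[t0 t1] cx Oy B nB.
pose f (z : R * R) := z + t *: (y - z).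
have cf : f z @[z --> x] --> f x.
  apply: cvgD; first exact: cvg_id.
  by apply: cvgZl_tmp; apply: cvgB; [exact: cvg_cst|exact: cvg_id].
have [z [Oz /= Bz]] := cx _ (cf _ nB).
exists (f z); split => //.
have -> : f z = t *: y + (1 - t) *: z.
  by apply: pair_eq; rewrite /f /= /GRing.scale/=; ring.
have t01 : 0 <= t <= 1 by rewrite (ltW t0).
exact: (convexP t01 Oy Oz).
Qed.


Hypothesis Omega_bounded : bounded_set Omega.

Lemma Omega_bound : exists2 M : R, 0 < M &
  forall x, Omega x -> `|x.1| <= M /\ `|x.2| <= M.
Proof.
have [M [Mr HM]] := Omega_bounded.
exists (`|M| + 1) => [|x Ox]; first by rewrite ltr_wpDl.
have : `|x| <= `|M| + 1.
  by apply: HM => //; rewrite (le_lt_trans (ler_norm M))// ltrDl.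
by rewrite prod_normE ge_max => /andP.
Qed.

End convex.

(** * The outward normal and the incoming boundary *)

Section normal.
Variable Omega : set (R * R).
Hypotheses (Omega_open : open Omega) (Omega_convex : convex_set Omega).
Hypothesis Omega_C3 : C3_boundary Omega.

Lemma near_line_ball (x v : R * R) (r : R) : 0 < r ->
  \forall t \near 0^'+, enorm (x + t *: v - x) < r.
Proof.
move=> r0; near=> t.
rewrite addrC addKr enormZ gtr0_norm; last by near: t; exact: nbhs_right_gt.
have : t < r / (enorm v + 1).
  by near: t; apply: nbhs_right_lt; rewrite divr_gt0// ltr_wpDl// sqrtr_ge0.
rewrite ltr_pdivlMr ?ltr_wpDl ?sqrtr_ge0//.
apply: le_lt_trans; rewrite ler_wpM2l ?lerDl//.
Unshelve. all: by end_near. Qed.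

Lemma deriv_neg_right (h : R -> R) (d : R) : is_derive (0 : R) 1 h d -> d < 0 ->
  \forall t \near 0^'+, h t < h 0.
Proof.
move=> [hd <-] d0.
have c : t^-1 *: (h (t *: 1 + 0) - h 0) @[t --> 0^'] --> 'D_1 h 0.
  have := hd; rewrite /derivable; set F := (F in cvg (F @ _)).
  by move=> cF; exact: cF.
have : \forall t \near 0^', t^-1 *: (h (t *: 1 + 0) - h 0) < 0.
  by apply: (cvgr_lt _ c).
move=> H.
have H' : \forall t \near (0 : R)^'+, t != 0 -> t^-1 *: (h (t *: 1 + 0) - h 0) < 0.
  by apply: cvg_within; exact: H.
near=> t.
have t0 : 0 < t by near: t; exact: nbhs_right_gt.
have : t^-1 *: (h (t *: 1 + 0) - h 0) < 0.
  by have := gt_eqF t0 => /negbT; near: t; exact: H'.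
by rewrite addr0 [_ *: 1]mulr1 pmulr_rlt0 ?invr_gt0// subr_lt0.
Unshelve. all: by end_near. Qed.

(** The normal is the normalized gradient at [x] of the local defining function [Q], which is
    negative exactly in [Omega]. The derivative of [Q] along v at [x] is [k] times [dot v n], so the
    sign of [dot v n] decides on which side x + t v starts. *)
Lemma exists_outward_normal (x : R * R) : boundary Omega x ->
  exists n, outward_unit_normal Omega x n.
Proof.
move=> bx; have [e [r [g [/S1P e1 r0 [dg _] epi]]]] := Omega_C3 bx.
have {}dg (t : R) : derivable g t 1 by have := dg 0%N t isT.
have cg : continuous g.
  by move=> t; apply: differentiable_continuous; apply/derivable1_diffP.
have rr : dot (rot90 e) (rot90 e) = 1 by rewrite -e1 /dot /rot90/=; ring.
have er : dot e (rot90 e) = 0 by rewrite /dot /rot90/=; ring.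
have dot0 (b : R * R) : dot (x - x) b = 0 by rewrite subrr /dot/= !mul0r addr0.
have nOx : ~ Omega x by case: bx => _ + Ox; apply; exact: open_nbhs_nbhs.
have enx : enorm (x - x) < r by rewrite /enorm dot0 sqrtr0.
pose Q (y : R * R) := g (dot (y - x) e) - dot (y - x) (rot90 e).
have cQ : continuous Q.
  move=> y; apply: cvgB; last exact: dot_continuous.
  exact: (cvg_comp _ _ (@dot_continuous _ _ y) (cg _)).
have nearx (y : R * R) : enorm (y - x) < r -> \forall z \near y, enorm (z - x) < r.
  by move=> yr; apply: (cvgr_lt _ (@enorm_continuous x y)).
have Qx : Q x = g 0 by rewrite /Q !dot0 subr0.
(* [g 0 < 0] would put [x] into the open set [Omega]; [g 0 > 0] would make [Q] positive around [x],
   and [x] would not be in the closure. *)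
have g0 : g 0 = 0.
  apply/eqP; rewrite eq_le; apply/andP; split; last first.
    rewrite leNgt; apply/negP => g0; apply: nOx; apply/(epi _ enx).
    by rewrite !dot0.
  rewrite leNgt; apply/negP => g0.
  have [y [Oy [/= ey gy]]] : Omega `&` [set y | enorm (y - x) < r /\ 0 < Q y] !=set0.
    apply: (bx.1); near=> y; split; first by near: y; exact: nearx.
    by near: y; apply: (cvgr_gt _ (cQ x)); rewrite Qx.
  by move: Oy => /(epi _ ey); apply/negP; rewrite -leNgt ltW// -subr_gt0.
pose c : R := 'D_1 g 0.
pose k : R := Num.sqrt (c ^+ 2 + 1).
have k2 : k ^+ 2 = c ^+ 2 + 1 by rewrite sqr_sqrtr// addr_ge0// sqr_ge0.
have k0 : 0 < k by rewrite sqrtr_gt0 ltr_wpDl// sqr_ge0.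
pose n := k^-1 *: (c *: e - rot90 e).
have vn (v : R * R) : dot v n = k^-1 * (c * dot v e - dot v (rot90 e)).
  by rewrite dotC dotZl dotBl dotZl [dot e v]dotC [dot (rot90 e) v]dotC.
have hd (a b : R) : is_derive (0 : R) 1 (fun t => g (t * a) - t * b) (c * a - b).
  have dg0 : is_derive (0 * a : R) 1 g c.
    by rewrite mul0r; apply: DeriveDef; [exact: dg|].
  have dm (u : R) : is_derive (0 : R) 1 (fun t => t * u) u.
    by apply: is_derive_eq; rewrite [_ *: _]mulr0 add0r [_ *: _]mulr1.
  have := @is_derive1_comp R g (fun t => t * a) 0 c a dg0 (dm a).
  by move=> dga; exact: is_deriveB.
have lineQ (v : R * R) t : Q (x + t *: v) = g (t * dot v e) - t * dot v (rot90 e).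
  by rewrite /Q [x + _]addrC addrK !dotZl.
exists n; split.
- apply/S1P; rewrite vn [dot n e]dotC [dot n (rot90 e)]dotC !vn e1 er [dot _ e]dotC er rr.
  rewrite (_ : _ * _ = k^-1 ^+ 2 * (c ^+ 2 + 1)); last by ring.
  by rewrite -k2 -exprMn mulVf ?gt_eqF// expr1n.
- move=> v; rewrite vn pmulr_rlt0 ?invr_gt0// => /(deriv_neg_right (hd _ _)) H.
  near=> t; apply/epi; first by near: t; exact: near_line_ball.
  have : g (t * dot v e) - t * dot v (rot90 e) <
     g (0 * dot v e) - 0 * dot v (rot90 e) by near: t; exact: H.
  by rewrite -lineQ !mul0r g0 subr0 /Q subr_lt0.
- move=> v; rewrite vn pmulr_rgt0 ?invr_gt0// => dv.
  have nhd : is_derive (0 : R) 1 (fun t => - (g (t * dot v e) - t * dot v (rot90 e)))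
     (- (c * dot v e - dot v (rot90 e))) by exact: is_deriveN.
  have := deriv_neg_right nhd; rewrite oppr_lt0 => /(_ dv) H.
  near=> t => ct.
  have Q0 : 0 < Q (x + t *: v).
    rewrite lineQ; have : - (g (t * dot v e) - t * dot v (rot90 e)) <
     - (g (0 * dot v e) - 0 * dot v (rot90 e)) by near: t; exact: H.
    by rewrite ltrN2 !mul0r g0 subr0.
  have er' : enorm (x + t *: v - x) < r by near: t; exact: near_line_ball.
  have [y [Oy [/= ey gy]]] : Omega `&` [set y | enorm (y - x) < r /\ 0 < Q y] !=set0.
    apply: ct; near=> y; split; first by near: y; exact: nearx.
    by near: y; apply: (cvgr_gt _ (cQ _)).
  by move: Oy => /(epi _ ey); apply/negP; rewrite -leNgt ltW// -subr_gt0.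
Unshelve. all: by end_near. Qed.

Lemma near_in_right_ex (P : R -> Prop) : (\forall t \near 0^'+, P t) ->
  exists t, 0 < t /\ P t.
Proof.
move=> H; near (0 : R)^'+ => t; exists t; split.
  by near: t; exact: nbhs_right_gt.
by near: t; exact: H.
Unshelve. all: by end_near. Qed.

Lemma nuP (x : R * R) : boundary Omega x -> outward_unit_normal Omega x (nu Omega x).
Proof. by move=> /exists_outward_normal[n On]; exact: (xgetI _ On). Qed.

(** This eliminates the normal: for a convex domain a boundary direction is incoming as soon as its
    ray reaches [Omega]. Measurability of the incoming set and the description of exit points both
    go through this form. *)
Lemma Gamma_minusP (x w : R * R) : Gamma_minus Omega (x, w) <->
  [/\ boundary Omega x, S1 w & exists2 s, 0 < s & Omega (x + s *: w)].
Proof.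
split => [[/= bx w1 wn]|[bx w1 [s s0 Os]]].
  split => //; have [_ + _] := nuP bx => /(_ _ wn) H.
  have [s []] := near_in_right_ex H.
  by exists s.
split => //=; have [/S1P n1 _ +] := nuP bx; set n := nu _ _ in n1 *.
rewrite ltNge => H; apply/negP => wn.
(* If [w] were tangent or outgoing, a slight tilt towards [n] would make it strictly outgoing while
   its ray still reaches the open set [Omega] at time [s]; by convexity the segment to that point
   cannot leave the closure. *)
have [d d0 Od] : exists2 d, 0 < d & Omega (x + s *: (w + d *: n)).
  have cl : x + s *: (w + d *: n) @[d --> (0 : R)] --> x + s *: (w + 0 *: n).
    by apply: cvgD; [exact: cvg_cst|apply: cvgZl_tmp; exact: line_continuous].
  have : \forall d \near (0 : R), Omega (x + s *: (w + d *: n)).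
    apply: cl; apply: open_nbhs_nbhs; split => //.
    by rewrite scale0r addr0.
  move=> nO.
  have nO' : \forall d \near (0 : R)^'+, Omega (x + s *: (w + d *: n)).
    by apply: cvg_within; exact: nO.
  by have [d []] := near_in_right_ex nO'; exists d.
have /H nc : 0 < dot (w + d *: n) n.
  by rewrite dotDl dotZl n1 mulr1 ltr_wpDl.
near (0 : R)^'+ => t.
have t0 : 0 < t by near: t; exact: nbhs_right_gt.
have ts : t <= s by near: t; exact: nbhs_right_le.
have : ~ closure Omega (x + t *: (w + d *: n)) by near: t; exact: nc.
apply; have := @segment_closure Omega Omega_convex x _ (t / s) _ bx.1 Od.
have -> : x + (t / s) *: (x + s *: (w + d *: n) - x) = x + t *: (w + d *: n).
  by rewrite addrC [X in (t / s) *: (X - x)]addrC addrK scalerA divfK ?gt_eqF// addrC.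
by apply; rewrite divr_gt0//= ler_pdivrMr// mul1r.
Unshelve. all: by end_near. Qed.

End normal.
End geom.

(** * Backward exit times *)

Section exit_time.
Variable R : realType.
Variable Omega : set (R * R).
Hypotheses (Omega_open : open Omega) (Omega_convex : convex_set Omega).
Hypothesis Omega_bounded : bounded_set Omega.

Lemma chord_bound : exists2 L : R, 0 < L & forall x y w s, Omega x -> Omega y ->
  S1 w -> y = x + s *: w -> `|s| <= L.
Proof.
have [M M0 HM] := Omega_bound Omega_bounded.
(* Each coordinate of the difference is at most 2 M in absolute value, and 4 + 4 <= 9. *)
exists (3 * M) => [|x y w s /HM[x1 x2] /HM[y1 y2] /S1P w1 yE]; first by rewrite mulr_gt0.
have e : s ^+ 2 = (y.1 - x.1) ^+ 2 + (y.2 - x.2) ^+ 2.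
  rewrite -[LHS]mulr1 -w1 yE /dot/= /GRing.scale/=; ring.
have bd (a b : R) : `|a| <= M -> `|b| <= M -> (b - a) ^+ 2 <= 4 * M ^+ 2.
  move=> aM bM; rewrite -[leLHS]real_normK ?num_real//.
  have : `|b - a| <= 2 * M by rewrite (le_trans (ler_normB _ _))// mulrDl mul1r lerD.
  move=> h; have : `|b - a| ^+ 2 <= (2 * M) ^+ 2.
    by apply: lerXn2r => //; rewrite nnegrE// ltW// mulr_gt0.
  by move=> /le_trans; apply; rewrite exprMn -natrX.
have M3 : 0 <= 3 * M by rewrite mulr_ge0// ltW.
rewrite -(@ler_pXn2r _ 2) ?nnegrE// real_normK ?num_real//.
rewrite e (le_trans (lerD (bd _ _ x1 y1) (bd _ _ x2 y2)))//.
have := sqr_ge0 M; nra.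
Qed.

(** By convexity the set is an interval for [x] in [Omega], so the supremum is the first time at
    which the backward ray leaves. The value is meaningful only on [Omega] times [S1]. *)
Definition exit_time (x w : R * R) : R :=
  sup [set s | 0 <= s /\ Omega (x - s *: w)].

Section at_point.
Variables (x w : R * R).
Hypotheses (Ox : Omega x) (w1 : S1 w).

Lemma exit_has_sup : has_sup [set s | 0 <= s /\ Omega (x - s *: w)].
Proof.
split; first by exists 0; rewrite /= scale0r subr0.
have [L L0 HL] := chord_bound.
exists L => s [s0 Os].
have := HL x _ w (- s) Ox Os w1; rewrite scaleNr => /(_ erefl).
by rewrite normrN ger0_norm.
Qed.

(** Openness prevents the supremum from being attained, hence the strict inequality; convexity fills
    in all earlier times. *)
Lemma exit_timeP (s : R) : 0 <= s -> Omega (x - s *: w) <-> s < exit_time x w.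
Proof.
move=> s0; split=> [Os|].
  have : \forall t \near s, Omega (x + (- t) *: w).
    have cl : x + (- t) *: w @[t --> s] --> x + (- s) *: w.
      by apply: cvgD; [exact: cvg_cst|apply: cvgZr_tmp; apply: cvgN; exact: cvg_id].
    by apply: cl; apply: open_nbhs_nbhs; split => //; rewrite scaleNr.
  move=> nO; near s^'+ => t.
  have st : s < t by near: t; exact: nbhs_right_gt.
  have Ot : Omega (x + (- t) *: w) by near: t; apply: cvg_within; exact: nO.
  apply: (lt_le_trans st); apply: ub_le_sup; first exact: (exit_has_sup).2.
  by split; [rewrite ltW// (le_lt_trans s0)|rewrite -scaleNr].
move=> /(sup_gt (exit_has_sup.1))[t [t0 Ot] st].
rewrite -scaleNr; apply: (@segment_in _ _ Omega_convex x w (- t) 0).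
- by rewrite lerN2 (ltW st) oppr_le0.
- by rewrite scaleNr.
- by rewrite scale0r addr0.
Unshelve. all: by end_near. Qed.

Lemma exit_time_gt0 : 0 < exit_time x w.
Proof. by apply/(exit_timeP (lexx 0)); rewrite scale0r subr0. Qed.

Lemma exit_boundary : boundary Omega (x - exit_time x w *: w).
Proof.
have t0 := exit_time_gt0; split; last first.
  move=> /interior_subset /(exit_timeP (ltW t0)); by rewrite ltxx.
move=> B nB.
have cl : x + (- t) *: w @[t --> exit_time x w] --> x + (- exit_time x w) *: w.
  by apply: cvgD; [exact: cvg_cst|apply: cvgZr_tmp; apply: cvgN; exact: cvg_id].
have nB' : \forall t \near exit_time x w, B (x + (- t) *: w).
  by apply: cl; rewrite scaleNr.
near (exit_time x w)^'- => t.
have tt : t < exit_time x w by near: t; exact: nbhs_left_lt.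
have t0' : 0 <= t by near: t; exact: nbhs_left_ge.
have Bt : B (x + (- t) *: w) by near: t; apply: cvg_within; exact: nB'.
by exists (x + (- t) *: w); split => //; rewrite scaleNr; apply/(exit_timeP t0').
Unshelve. all: by end_near. Qed.

End at_point.

Lemma exit_timeD (x w : R * R) (t : R) : Omega x -> S1 w -> Omega (x + t *: w) ->
  exit_time (x + t *: w) w = t + exit_time x w.
Proof.
move=> Ox w1 Ot.
have key (y : R * R) r : Omega y -> Omega (y + r *: w) ->
    exit_time (y + r *: w) w <= r + exit_time y w.
  move=> Oy Or; rewrite leNgt; apply/negP => lt_.
  have e0 : 0 < exit_time y w by exact: exit_time_gt0.
  have [rn|rp] := ltP (r + exit_time y w) 0.
    have := @segment_in _ _ Omega_convex y w r 0 (- exit_time y w).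
    rewrite scale0r addr0 => H.
    have : Omega (y - exit_time y w *: w).
      by rewrite -scaleNr; apply: H => //; rewrite oppr_le0 (ltW e0) andbT; lra.
    by move/(exit_timeP Oy w1 (ltW e0)); rewrite ltxx.
  have /(exit_timeP Or w1 rp) := lt_.
  rewrite scalerDl opprD addrA addrK => /(exit_timeP Oy w1 (ltW e0)).
  by rewrite ltxx.
apply/eqP; rewrite eq_le key//=.
have := key (x + t *: w) (- t) Ot; rewrite scaleNr addrK => /(_ Ox).
by rewrite addrC lerBrDr addrC.
Qed.

Hypothesis Omega_C3 : C3_boundary Omega.

Lemma exit_Gamma_minus (x w : R * R) : Omega x -> S1 w ->
  Gamma_minus Omega (x - exit_time x w *: w, w).
Proof.
move=> Ox w1; apply/(Gamma_minusP Omega_open Omega_convex Omega_C3); split => //.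
  exact: exit_boundary.
by exists (exit_time x w); [exact: exit_time_gt0|rewrite subrK].
Qed.

(** The line through an interior point meets the incoming boundary once. The inflow condition of
    [transport_solution], quantified over all times, therefore concerns a single time on each
    line. *)
Lemma Gamma_minus_exit (x w : R * R) (t : R) : Omega x ->
  Gamma_minus Omega (x + t *: w, w) -> t = - exit_time x w.
Proof.
move=> Ox G.
have [bt w1 _] := (Gamma_minusP Omega_open Omega_convex Omega_C3 _ _).1 G.
have nOt : ~ Omega (x + t *: w).
  by case: bt => _ + Ot; apply; exact: open_nbhs_nbhs.
have [_ + _] := nuP Omega_open Omega_C3 bt.
move: G => [/= _ _ wn] /(_ _ wn) nr.
have t0 : t < 0.
  rewrite ltNge; apply/negP => t0; have [s [s0 Os]] := near_in_right_ex nr.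
  apply: nOt; apply: (@segment_in _ _ Omega_convex x w 0 (t + s)).
  - by rewrite t0 lerDl ltW.
  - by rewrite scale0r addr0.
  - by rewrite scalerDl addrA.
apply/eqP; rewrite eq_le; apply/andP; split.
  rewrite lerNr leNgt; apply/negP => h; apply: nOt.
  by rewrite -[t]opprK scaleNr; apply/(exit_timeP Ox w1) => //; rewrite oppr_ge0 ltW.
rewrite leNgt; apply/negP => h.
near (0 : R)^'+ => s.
have s0 : 0 < s by near: s; exact: nbhs_right_gt.
have sh : s < - exit_time x w - t.
  by near: s; apply: nbhs_right_lt; rewrite subr_gt0.
have Os : Omega (x + t *: w + s *: w) by near: s; exact: nr.
have ts : 0 <= - (t + s).
  by have := exit_time_gt0 Ox w1; lra.
have : Omega (x - (- (t + s)) *: w) by rewrite scaleNr opprK scalerDl addrA.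
by move/(exit_timeP Ox w1 ts); lra.
Unshelve. all: by end_near. Qed.

Lemma measurable_Omega : measurable Omega.
Proof. exact: measurable_open2. Qed.

Lemma measurable_phase : measurable (Omega `*` @S1 R).
Proof. by apply: measurableX; [exact: measurable_Omega|exact: measurable_S1]. Qed.

(** [nu] is a choice, so the sign of [dot] is not visibly measurable. An incoming ray lies in
    [Omega] at all small times, so the countably many times 1/(n+1) detect it. *)
Lemma measurable_Gamma_minus : measurable (Gamma_minus Omega).
Proof.
have -> : Gamma_minus Omega = (boundary Omega `*` @S1 R) `&`
    \bigcup_n [set z : (R * R) * (R * R) | Omega (z.1 + n.+1%:R^-1 *: z.2)].
  apply/seteqP; split=> [[x w] G|[x w] [/= [bx w1] [n _ /= On]]]; last first.
    apply/(Gamma_minusP Omega_open Omega_convex Omega_C3); split => //.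
    by exists n.+1%:R^-1 => //; rewrite invr_gt0.
  have [bx w1 _] := (Gamma_minusP Omega_open Omega_convex Omega_C3 _ _).1 G.
  split => //; case: G => _ _ /= wn.
  have [_ + _] := nuP Omega_open Omega_C3 bx => /(_ _ wn) nr.
  have nr' : \forall t \near (0 : R), 0 < t -> Omega (x + t *: w) by exact: nr.
  have [e /= e0 He] := (nbhs_ballP _ _).1 nr'.
  have [n ne] : exists n, n.+1%:R^-1 < e.
    by exists (Num.truncn e^-1); rewrite invf_plt ?posrE// truncnS_gt.
  by exists n => //=; apply: He; rewrite ?invr_gt0//= /ball/= sub0r normrN gtr0_norm ?invr_gt0.
apply: measurableI.
  apply: measurableX; last exact: measurable_S1.
  apply: measurableD; last by apply: measurable_open2; exact: open_interior.
  rewrite -[X in measurable X]setCK; apply: measurableC; apply: measurable_open2.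
  by apply: closed_openC; exact: closed_closure.
apply: bigcupT_measurable => n; rewrite -[X in measurable X]setTI.
apply: (_ : measurable_fun [set: (R * R) * (R * R)]
   (fun z => (z.1 + n.+1%:R^-1 *: z.2) : R * R)) => //; last exact: measurable_Omega.
by apply/measurable_fun_pairP; split => /=; msolve.
Qed.

(** By [exit_timeP] a superlevel set at [c >= 0] is the preimage of [Omega] under the continuous map
    x - c w. *)
Lemma measurable_exit_time :
  measurable_fun (Omega `*` @S1 R) (fun z => exit_time z.1 z.2).
Proof.
move=> mD; apply: (measurability _ (RGenOInfty.measurableE R)) => // _ [_ [c ->] <-].
have [c0|c0] := leP 0 c; last first.
  rewrite (_ : _ `&` _ = Omega `*` @S1 R); first exact: mD.
  apply/seteqP; split=> [z []//|[x w] [/= Ox w1]]; split => //=.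
  by rewrite in_itv/= andbT (lt_trans c0)// exit_time_gt0.
rewrite (_ : _ `&` _ = (Omega `*` @S1 R) `&`
    (fun z : (R * R) * (R * R) => z.1 - c *: z.2) @^-1` Omega); last first.
  apply/seteqP; split=> [[x w] [[/= Ox w1]]|[x w] [[/= Ox w1]]];
   rewrite /= in_itv/= ?andbT => H; split => //=; rewrite ?in_itv/= ?andbT; exact/exit_timeP.
have mf : measurable_fun (Omega `*` @S1 R) (fun z : (R * R) * (R * R) => z.1 - c *: z.2).
  apply: measurable_funTS.
  by apply/measurable_fun_pairP; split => /=; msolve.
by apply: mf => //; exact: measurable_Omega.
Qed.

End exit_time.

(** * Free flights and scattering *)

Section avg.
Variable R : realType.
Local Open Scope ereal_scope.
Implicit Types F G : R * R -> \bar R.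

Definition avg F : \bar R :=
  ((2 * pi)^-1)%:E * \int[@circle_measure R]_w F w.

Lemma avg_coef_ge0 : 0 <= ((2 * pi)^-1 : R)%:E.
Proof. by rewrite lee_fin invr_ge0 mulr_ge0// pi_ge0. Qed.

Lemma avg_ge0 F : (forall w, 0 <= F w) -> 0 <= avg F.
Proof. by move=> F0; rewrite mule_ge0 ?avg_coef_ge0//; exact: integral_ge0. Qed.

Lemma avg_le F G : measurable_fun [set: R * R] F -> measurable_fun [set: R * R] G ->
  (forall w, 0 <= F w) -> (forall w, 0 <= G w) ->
  (forall w, S1 w -> F w <= G w) -> avg F <= avg G.
Proof. by move=> *; rewrite lee_wpmul2l ?avg_coef_ge0//; exact: circ_le. Qed.

Lemma avg_moments F (c0 c1 c2 c3 c4 c5 : R) :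
  measurable_fun [set: R * R] F -> (forall w, 0 <= F w) ->
  (forall w : R * R, S1 w -> F w = (c0 + c1 * w.1 + c2 * w.2 + c3 * w.1 ^+ 2 +
    c4 * w.2 ^+ 2 + c5 * (w.1 * w.2))%:E) ->
  avg F = (c0 + c3 / 2 + c4 / 2)%:E.
Proof.
move=> mF F0 FE; rewrite /avg (circ_moments mF F0 FE) -EFinM; congr EFin.
by move: (pi_gt0 R); move: (@pi R) => p p0; field; exact: lt0r_neq0.
Qed.

Lemma avg_cst (c : R) : (0 <= c)%R -> avg (fun _ => c%:E) = c%:E.
Proof.
move=> c0; rewrite (@avg_moments _ c 0 0 0 0 0)//; first by rewrite !mul0r !addr0.
by move=> w _; rewrite !mul0r !addr0.
Qed.

Lemma avgD F G : measurable_fun [set: R * R] F -> measurable_fun [set: R * R] G ->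
  (forall w, 0 <= F w) -> (forall w, 0 <= G w) ->
  avg (fun w => F w + G w) = avg F + avg G.
Proof.
by move=> mF mG F0 G0; rewrite /avg ge0_integralD// ge0_muleDr//; exact: integral_ge0.
Qed.

Lemma avgZ (c : R) F : measurable_fun [set: R * R] F -> (forall w, 0 <= F w) ->
  (0 <= c)%R -> avg (fun w => c%:E * F w) = c%:E * avg F.
Proof. by move=> mF F0 c0; rewrite /avg ge0_integralZl_EFin// muleCA. Qed.

Lemma eq_avg F G : F =1 G -> avg F = avg G.
Proof. by move=> FG; rewrite /avg (eq_integral G)// => w _; exact: FG. Qed.

Lemma measurable_avg (F : (R * R) * (R * R) -> \bar R) :
  measurable_fun [set: (R * R) * (R * R)] F -> (forall z, 0 <= F z) ->
  measurable_fun [set: R * R] (fun x => avg (fun w => F (x, w))).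
Proof.
move=> mF F0; apply: measurable_funeM.
exact: (measurable_fun_fubini_tonelli_F (m2 := @circle_measure R) _ mF F0).
Qed.

End avg.

Section operators.
Variables (R : realType) (eps : R).
Hypothesis eps0 : (0 < eps)%R.
Local Open Scope ereal_scope.
Implicit Types F G : (R * R) * (R * R) -> \bar R.
Implicit Types (a b : R * R -> \bar R) (sg : R).

(** The density of the flight length, exponential with mean [eps]. It vanishes for [s < 0], so
    flights can be integrated over the whole line. *)
Definition free_path (s : R) : R := exponential_pdf eps^-1 s.

Lemma free_path_ge0 s : (0 <= free_path s)%R.
Proof. by rewrite exponential_pdf_ge0// invr_ge0 ltW. Qed.

Lemma measurable_free_path : measurable_fun [set: R] free_path.
Proof. exact: measurable_exponential_pdf. Qed.

Lemma integral_free_path : \int[lebesgue_measure]_s (free_path s)%:E = 1.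
Proof. by rewrite integral_exponential_pdf// invr_gt0. Qed.

(** With [sg = -1] the flight looks backward and is the operator [T]; [sg = 1] gives its adjoint.
    There is no cutoff at the boundary: that is left to the support of the argument. *)
Definition flight sg F (z : (R * R) * (R * R)) : \bar R :=
  \int[lebesgue_measure]_s ((free_path s)%:E * F (z.1 + (sg * s) *: z.2, z.2)%R).

(** The operator [K] when [sg = -1], its adjoint when [sg = 1]. *)
Definition scatter sg a (x : R * R) : \bar R :=
  avg (fun w => flight sg (a \o fst) (x, w)).

Lemma measurable_flow sg : measurable_fun [set: ((R * R) * (R * R)) * R]
  (fun p => (p.1.1 + (sg * p.2) *: p.1.2, p.1.2)%R : (R * R) * (R * R)).
Proof. by msolve. Qed.

Section fixed.
Variables (sg : R) (F : (R * R) * (R * R) -> \bar R).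
Hypotheses (mF : measurable_fun [set: (R * R) * (R * R)] F) (F0 : forall z, 0 <= F z).

Lemma measurable_flight_integrand : measurable_fun [set: ((R * R) * (R * R)) * R]
  (fun p => (free_path p.2)%:E * F (p.1.1 + (sg * p.2) *: p.1.2, p.1.2)%R).
Proof.
apply: emeasurable_funM; last exact: (measurableT_comp mF (measurable_flow sg)).
apply/measurable_EFinP; exact: (measurableT_comp measurable_free_path measurable_snd).
Qed.

Lemma flight_integrand_ge0 (p : ((R * R) * (R * R)) * R) :
  0 <= (free_path p.2)%:E * F (p.1.1 + (sg * p.2) *: p.1.2, p.1.2)%R.
Proof. by rewrite mule_ge0// lee_fin free_path_ge0. Qed.

Lemma measurable_flight_line (z : (R * R) * (R * R)) : measurable_fun [set: R]
  (fun s => (free_path s)%:E * F (z.1 + (sg * s) *: z.2, z.2)%R).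
Proof. exact: (measurableT_comp measurable_flight_integrand (pair1_measurable z)). Qed.

Lemma flight_line_ge0 (z : (R * R) * (R * R)) (s : R) :
  0 <= (free_path s)%:E * F (z.1 + (sg * s) *: z.2, z.2)%R.
Proof. exact: (flight_integrand_ge0 (z, s)). Qed.

Lemma flight_ge0 z : 0 <= flight sg F z.
Proof. by apply: integral_ge0 => s _; exact: flight_line_ge0. Qed.

Lemma measurable_flight : measurable_fun [set: (R * R) * (R * R)] (flight sg F).
Proof.
exact: (measurable_fun_fubini_tonelli_F (m2 := @lebesgue_measure R) _
  measurable_flight_integrand flight_integrand_ge0).
Qed.

End fixed.

Lemma flight_le sg F G z :
  measurable_fun [set: (R * R) * (R * R)] F -> measurable_fun [set: (R * R) * (R * R)] G ->
  (forall z, 0 <= F z) -> (forall z, 0 <= G z) ->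
  (forall s, (0 <= s)%R -> F (z.1 + (sg * s) *: z.2, z.2)%R <= G (z.1 + (sg * s) *: z.2, z.2)%R) ->
  flight sg F z <= flight sg G z.
Proof.
move=> mF mG F0 G0 FG; apply: ge0_le_integral => //.
- by move=> s _; exact: flight_line_ge0.
- exact: measurable_flight_line.
- exact: measurable_flight_line.
move=> s _; have [s0|s0] := leP 0%R s.
  by rewrite lee_wpmul2l ?FG// lee_fin free_path_ge0.
by rewrite /free_path lt0_exponential_pdf// !mul0e.
Qed.

Lemma flightD sg F G z :
  measurable_fun [set: (R * R) * (R * R)] F -> measurable_fun [set: (R * R) * (R * R)] G ->
  (forall z, 0 <= F z) -> (forall z, 0 <= G z) ->
  flight sg (fun z => F z + G z) z = flight sg F z + flight sg G z.
Proof.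
move=> mF mG F0 G0; rewrite /flight -ge0_integralD//.
- by apply: eq_integral => s _; rewrite ge0_muleDr.
- by move=> s _; exact: flight_line_ge0.
- exact: measurable_flight_line.
- by move=> s _; exact: flight_line_ge0.
- exact: measurable_flight_line.
Qed.

Lemma flightZ sg (c : R) F z :
  measurable_fun [set: (R * R) * (R * R)] F -> (forall z, 0 <= F z) -> (0 <= c)%R ->
  flight sg (fun z => c%:E * F z) z = c%:E * flight sg F z.
Proof.
move=> mF F0 c0; rewrite /flight -ge0_integralZl_EFin//.
- by apply: eq_integral => s _; rewrite muleCA.
- by move=> s _; exact: flight_line_ge0.
- exact: measurable_flight_line.
Qed.

Lemma flight_cst sg (c : R) z : (0 <= c)%R -> flight sg (fun _ => c%:E) z = c%:E.
Proof.
move=> c0; rewrite /flight.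
transitivity (c%:E * \int[lebesgue_measure]_s (free_path s)%:E).
  rewrite -ge0_integralZl_EFin//; last 2 first.
  - by move=> s _; rewrite lee_fin free_path_ge0.
  - by apply/measurable_EFinP; exact: measurable_free_path.
  by apply: eq_integral => s _; rewrite muleC.
by rewrite integral_free_path mule1.
Qed.

(** For each fixed flight length the shift by [sg * s] along the velocity preserves the phase
    measure, so it can be moved to the other factor with the opposite sign. *)
Lemma flight_duality sg F G :
  measurable_fun [set: (R * R) * (R * R)] F -> measurable_fun [set: (R * R) * (R * R)] G ->
  (forall z, 0 <= F z) -> (forall z, 0 <= G z) ->
  \int[@phase_measure R]_z (G z * flight sg F z) =
  \int[@phase_measure R]_z (flight (- sg) G z * F z).
Proof.
move=> mF mG F0 G0.
pose H sg' (F1 G1 : (R * R) * (R * R) -> \bar R) (p : ((R * R) * (R * R)) * R) :=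
  G1 p.1 * ((free_path p.2)%:E * F1 (p.1.1 + (sg' * p.2) *: p.1.2, p.1.2)%R).
have mH sg' F1 G1 : measurable_fun [set: (R * R) * (R * R)] F1 ->
    measurable_fun [set: (R * R) * (R * R)] G1 ->
    measurable_fun [set: ((R * R) * (R * R)) * R] (H sg' F1 G1).
  move=> mF1 mG1; apply: emeasurable_funM; last exact: measurable_flight_integrand.
  exact: (measurableT_comp mG1 measurable_fst).
have H0 sg' F1 G1 p : (forall z, 0 <= F1 z) -> (forall z, 0 <= G1 z) -> 0 <= H sg' F1 G1 p.
  by move=> F10 G10; rewrite mule_ge0//; exact: flight_integrand_ge0.
have step sg' F1 G1 : measurable_fun [set: (R * R) * (R * R)] F1 ->
    measurable_fun [set: (R * R) * (R * R)] G1 ->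
    (forall z, 0 <= F1 z) -> (forall z, 0 <= G1 z) ->
    \int[@phase_measure R]_z (G1 z * flight sg' F1 z) =
    \int[lebesgue_measure]_s \int[@phase_measure R]_z H sg' F1 G1 (z, s).
  move=> mF1 mG1 F10 G10.
  have FT := fubini_tonelli (m1 := @phase_measure R) (m2 := @lebesgue_measure R)
    (H sg' F1 G1) (mH _ _ _ mF1 mG1) (fun p => H0 _ _ _ p F10 G10).
  rewrite -FT; apply: eq_integral => z _; rewrite /flight /H/= ge0_integralZl//.
  - exact: measurable_flight_line.
  - by move=> s _; exact: flight_line_ge0.
rewrite step//; transitivity (\int[@phase_measure R]_z (F z * flight (- sg) G z)); last first.
  by apply: eq_integral => z _; rewrite muleC.
rewrite [RHS](step _ _ _ mG mF G0 F0); apply: eq_integral => s _.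
rewrite -[RHS](@phase_shift _ (sg * s)%R (fun z => H (- sg)%R G F (z, s))).
- apply: eq_integral => z _; rewrite /H/= mulNr scaleNr addrK -surjective_pairing.
  by rewrite muleCA [RHS]muleCA [G z * _]muleC.
- exact: (measurableT_comp (mH _ _ _ mG mF) (pair2_measurable s)).
- by move=> z; exact: H0.
Qed.

End operators.

Section scatter.
Variables (R : realType) (eps : R).
Hypothesis eps0 : (0 < eps)%R.
Local Open Scope ereal_scope.
Implicit Types (a b : R * R -> \bar R) (sg : R).

Lemma measurable_fst_comp a : measurable_fun [set: R * R] a ->
  measurable_fun [set: (R * R) * (R * R)] (a \o fst).
Proof. by move=> ma; exact: (measurableT_comp ma measurable_fst). Qed.

Lemma measurable_flight_at F sg x :
  measurable_fun [set: (R * R) * (R * R)] F -> (forall z, 0 <= F z) ->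
  measurable_fun [set: R * R] (fun w => flight eps sg F (x, w)).
Proof.
by move=> mF F0; exact: (measurableT_comp (measurable_flight eps0 sg mF F0)
  (pair1_measurable x)).
Qed.

Lemma measurable_scatter sg a : measurable_fun [set: R * R] a ->
  (forall x, 0 <= a x) -> measurable_fun [set: R * R] (scatter eps sg a).
Proof.
move=> ma a0; apply: measurable_avg => [|z]; last by apply: flight_ge0 => // ?; exact: a0.
by apply: measurable_flight => // [|?]; [exact: measurable_fst_comp|exact: a0].
Qed.

Lemma scatter_ge0 sg a x : (forall x, 0 <= a x) -> 0 <= scatter eps sg a x.
Proof. by move=> a0; apply: avg_ge0 => w; apply: flight_ge0 => // z; exact: a0. Qed.

Lemma scatter_le sg a b x : measurable_fun [set: R * R] a ->
  measurable_fun [set: R * R] b -> (forall x, 0 <= a x) -> (forall x, 0 <= b x) ->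
  (forall x, a x <= b x) -> scatter eps sg a x <= scatter eps sg b x.
Proof.
move=> ma mb a0 b0 ab; apply: avg_le.
- by apply: measurable_flight_at => [|?]; [exact: measurable_fst_comp|exact: a0].
- by apply: measurable_flight_at => [|?]; [exact: measurable_fst_comp|exact: b0].
- by move=> w; apply: flight_ge0 => // z; exact: a0.
- by move=> w; apply: flight_ge0 => // z; exact: b0.
move=> w _; apply: flight_le => //; try exact: measurable_fst_comp.
- by move=> ?; exact: a0.
- by move=> ?; exact: b0.
- by move=> ? _; exact: ab.
Qed.

Lemma scatterD sg a b x : measurable_fun [set: R * R] a ->
  measurable_fun [set: R * R] b -> (forall x, 0 <= a x) -> (forall x, 0 <= b x) ->
  scatter eps sg (fun x => a x + b x) x = scatter eps sg a x + scatter eps sg b x.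
Proof.
move=> ma mb a0 b0; rewrite /scatter -avgD.
- apply: eq_avg => w; rewrite -flightD//; try exact: measurable_fst_comp.
  + by move=> ?; exact: a0.
  + by move=> ?; exact: b0.
- by apply: measurable_flight_at => [|?]; [exact: measurable_fst_comp|exact: a0].
- by apply: measurable_flight_at => [|?]; [exact: measurable_fst_comp|exact: b0].
- by move=> w; apply: flight_ge0 => // z; exact: a0.
- by move=> w; apply: flight_ge0 => // z; exact: b0.
Qed.

Lemma scatterZ sg (c : R) a x : measurable_fun [set: R * R] a ->
  (forall x, 0 <= a x) -> (0 <= c)%R ->
  scatter eps sg (fun x => c%:E * a x) x = c%:E * scatter eps sg a x.
Proof.
move=> ma a0 c0; rewrite /scatter -avgZ//.
- apply: eq_avg => w; rewrite -flightZ//; first exact: measurable_fst_comp.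
  by move=> ?; exact: a0.
- by apply: measurable_flight_at => [|?]; [exact: measurable_fst_comp|exact: a0].
- by move=> w; apply: flight_ge0 => // z; exact: a0.
Qed.

Lemma scatter_cst sg (c : R) x : (0 <= c)%R -> scatter eps sg (fun=> c%:E) x = c%:E.
Proof.
move=> c0; rewrite /scatter -[RHS](avg_cst c0); apply: eq_avg => w.
exact: flight_cst.
Qed.

Lemma phase_avg (F : (R * R) * (R * R) -> \bar R) b :
  measurable_fun [set: (R * R) * (R * R)] F -> (forall z, 0 <= F z) ->
  measurable_fun [set: R * R] b -> (forall z, 0 <= b z) ->
  \int[@lam2 R]_x (b x * avg (fun w => F (x, w))) =
  ((2 * pi)^-1)%:E * \int[@phase_measure R]_z (b z.1 * F z).
Proof.
move=> mF F0 mb b0; rewrite phaseE; last 2 first.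
- by apply: emeasurable_funM => //; exact: measurable_fst_comp.
- by move=> z; rewrite mule_ge0.
rewrite -ge0_integralZl_EFin//=; last 3 first.
- by move=> x _; apply: integral_ge0 => w _; rewrite mule_ge0.
- apply: (measurable_fun_fubini_tonelli_F (m2 := @circle_measure R)
    (fun z => b z.1 * F z)) => [|z].
  + by apply: emeasurable_funM => //; exact: measurable_fst_comp.
  + by rewrite mule_ge0.
- by rewrite invr_ge0 mulr_ge0// pi_ge0.
apply: eq_integral => x _; rewrite /avg muleCA ge0_integralZl//.
exact: (measurableT_comp mF (pair1_measurable x)).
Qed.

Lemma scatter_duality sg a b : measurable_fun [set: R * R] a ->
  measurable_fun [set: R * R] b -> (forall x, 0 <= a x) -> (forall x, 0 <= b x) ->
  \int[@lam2 R]_x (b x * scatter eps sg a x) = \int[@lam2 R]_x (a x * scatter eps (- sg) b x).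
Proof.
move=> ma mb a0 b0.
have mfa := measurable_fst_comp ma; have mfb := measurable_fst_comp mb.
have fa0 (z : (R * R) * (R * R)) : 0 <= (a \o fst) z := a0 _.
have fb0 (z : (R * R) * (R * R)) : 0 <= (b \o fst) z := b0 _.
have Ea := phase_avg (measurable_flight eps0 sg mfa fa0) (fun z => flight_ge0 eps0 sg fa0 z) mb b0.
have Eb := phase_avg (measurable_flight eps0 (- sg)%R mfb fb0)
  (fun z => flight_ge0 eps0 (- sg)%R fb0 z) ma a0.
rewrite [LHS]Ea [RHS]Eb.
congr (_ * _); rewrite [LHS](flight_duality eps0 sg mfa mfb fa0 fb0).
by apply: eq_integral => z _; rewrite muleC.
Qed.

(** * Strict contraction on the domain and the fixed point *)

Section domain.
Variable Omega : set (R * R).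
Hypothesis mOmega : measurable Omega.
Variable L : R.
Hypotheses (L0 : (0 < L)%R) (HL : forall x y w s, Omega x -> Omega y ->
  S1 w -> y = (x + s *: w)%R -> (`|s| <= L)%R).

(** The probability that a flight is longer than [L]. No chord of [Omega] is, so every flight
    started in [Omega] leaves it with at least this probability, forward or backward. *)
Definition escape : R := expR (- eps^-1 * L).

Lemma escape_gt0 : (0 < escape)%R. Proof. exact: expR_gt0. Qed.

Lemma measurable_indic_Omega : measurable_fun [set: R * R] (fun x => (\1_Omega x : R)%:E).
Proof. by apply/measurable_EFinP; exact: measurable_indic. Qed.

Lemma flight_indic_le sg x w (l : R) : (0 < l)%R ->
  (forall s, (0 <= s)%R -> Omega (x + (sg * s) *: w)%R -> (s <= l)%R) ->
  flight eps sg (fun z => (\1_Omega z.1)%:E) (x, w) <= (1 - expR (- eps^-1 * l))%:E.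
Proof.
move=> l0 Hl; rewrite /flight.
apply: (@le_trans _ _ (\int[lebesgue_measure]_s ((free_path eps s)%:E * (\1_`[0%R, l] s)%:E))).
  apply: ge0_le_integral => //.
  - by move=> s _; rewrite mule_ge0// lee_fin ?free_path_ge0.
  - exact: (measurable_flight_line eps sg (measurable_fst_comp measurable_indic_Omega) (x, w)).
  - apply: emeasurable_funM; apply/measurable_EFinP; first exact: measurable_free_path.
    exact: measurable_indic.
  - move=> s _ /=; have [s0|s0] := leP 0%R s; last first.
      by rewrite /free_path lt0_exponential_pdf// !mul0e.
    rewrite lee_wpmul2l ?lee_fin ?free_path_ge0// !indicE.
    have [|//] := boolP (_ \in Omega); rewrite inE => Os.
    by rewrite mem_set//= in_itv/= s0 Hl.
rewrite le_eqVlt; apply/orP; left; apply/eqP.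
transitivity (exponential_prob eps^-1 `[0%R, l]); last by rewrite exponential_prob_itv0c.
rewrite /exponential_prob [RHS]integral_mkcond; apply: eq_integral => s _.
by rewrite patchE indicE; case: ifPn => _; rewrite ?mule1 ?mule0.
Qed.

Lemma flight_indic sg x w : `|sg|%R = 1%R -> Omega x -> S1 w ->
  flight eps sg (fun z => (\1_Omega z.1)%:E) (x, w) <= (1 - escape)%:E.
Proof.
move=> sg1 Ox w1; apply: flight_indic_le => // s s0 Os.
by have := HL Ox Os w1 erefl; rewrite normrM sg1 mul1r ger0_norm.
Qed.

Lemma scatter_contract sg a (M : R) x : `|sg|%R = 1%R ->
  measurable_fun [set: R * R] a -> (forall x, 0 <= a x) -> (0 <= M)%R ->
  (forall x, a x <= (M * \1_Omega x)%:E) -> Omega x ->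
  scatter eps sg a x <= (M * (1 - escape))%:E.
Proof.
move=> sg1 ma a0 M0 aM Ox.
have m1 := measurable_indic_Omega.
have e1 : (0 <= 1 - escape)%R by rewrite subr_ge0 -expR0 ler_expR mulNr oppr_le0 mulr_ge0 ?invr_ge0 ?ltW.
apply: (@le_trans _ _ (scatter eps sg (fun x => M%:E * (\1_Omega x)%:E) x)).
  apply: scatter_le => //; first exact: measurable_funeM.
  by move=> y; rewrite mule_ge0// lee_fin.
rewrite scatterZ// EFinM lee_wpmul2l ?lee_fin//.
rewrite -(avg_cst e1); apply: avg_le => //.
- apply: measurable_flight_at => [|z]; first exact: measurable_fst_comp.
  by rewrite lee_fin.
- by move=> w; apply: flight_ge0 => // z; rewrite lee_fin.
- by move=> w w1; exact: flight_indic.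
Qed.

Section monotone.
Variables (sg : R) (V : nat -> R * R -> \bar R).
Hypotheses (mV : forall n, measurable_fun [set: R * R] (V n))
  (V0 : forall n x, 0 <= V n x) (ndV : forall x, nondecreasing_seq (V ^~ x)).

Let lV x := limn (V ^~ x).

(** Monotone convergence twice, along the flight and then over the directions. *)
Lemma scatter_monotone_cvg x : scatter eps sg (V n) x @[n --> \oo] --> scatter eps sg lV x.
Proof.
have mfV n := measurable_fst_comp (mV n).
have flightV w : flight eps sg (V n \o fst) (x, w) @[n --> \oo] --> flight eps sg (lV \o fst) (x, w).
  rewrite [X in _ --> X](_ : _ = \int[lebesgue_measure]_s
      limn (fun n => (free_path eps s)%:E * (V n \o fst) (x + (sg * s) *: w, w)%R)).
    apply: cvg_monotone_convergence => //.
    + move=> n; exact: (measurable_flight_line eps sg (mfV n) (x, w)).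
    + by move=> n s _; apply: mule_ge0; [rewrite lee_fin; exact: free_path_ge0|exact: V0].
    + move=> s _ m n mn; apply: lee_wpmul2l; last exact: ndV.
      by rewrite lee_fin free_path_ge0.
  apply: eq_integral => s _ /=; rewrite limeMl//.
  exact: ereal_nondecreasing_is_cvgn.
have flight_nd w : nondecreasing_seq (fun n => flight eps sg (V n \o fst) (x, w)).
  move=> m n mn; apply: flight_le => //.
  - by move=> z; exact: V0.
  - by move=> z; exact: V0.
  - by move=> s _; exact: ndV.
apply: cvgeZl => //.
rewrite [X in _ --> X](_ : _ = \int[@circle_measure R]_w
    limn (fun n => flight eps sg (V n \o fst) (x, w))).
  apply: cvg_monotone_convergence => //.
  + by move=> n; apply: measurable_flight_at => // z; exact: V0.
  + by move=> n w _; apply: flight_ge0 => // z; exact: V0.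
by apply: eq_integral => w _; apply/esym/cvg_lim.
Qed.

End monotone.

(** The iterates from zero increase and stay below a fixed multiple of the indicator of [Omega], so
    they converge pointwise, and monotone convergence passes to the limit in the equation. *)
Lemma exists_fixpoint (g : R * R -> R) (C : R) : measurable_fun [set: R * R] g ->
  (forall x, 0 <= g x <= C)%R -> (forall x, ~ Omega x -> g x = 0%R) ->
  exists v : R * R -> R, [/\ measurable_fun [set: R * R] v,
    forall x, (0 <= v x <= C / escape)%R, forall x, ~ Omega x -> v x = 0%R &
    forall x, Omega x -> (v x)%:E = (g x)%:E + scatter eps (-1) (EFin \o v) x].
Proof.
move=> mg gC g0.
have C0 : (0 <= C)%R by have /andP[/le_trans] := gC (0, 0)%R; exact.
have e0 := escape_gt0.
(* The solution of M = C + M (1 - escape), hence a bound that the iteration reproduces. *)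
pose M := (C / escape)%R.
have M0 : (0 <= M)%R by rewrite divr_ge0// ltW.
(* The indicator keeps every iterate supported in [Omega], which [scatter_contract] needs. *)
pose V := fix V n : R * R -> \bar R := if n is n'.+1 then
   (fun x => (g x)%:E + (\1_Omega x)%:E * scatter eps (-1) (V n') x) else cst 0.
have VS n x : V n.+1 x = (g x)%:E + (\1_Omega x)%:E * scatter eps (-1) (V n) x by [].
have V0 n x : 0 <= V n x.
  elim: n x => [|n IH] x; first by [].
  rewrite VS adde_ge0//; first by have /andP[] := gC x.
  by rewrite mule_ge0// ?lee_fin// scatter_ge0.
have mV n : measurable_fun [set: R * R] (V n).
  elim: n => [|n IH]; first exact: measurable_cst.
  apply: emeasurable_funD; first exact/measurable_EFinP.
  by apply: emeasurable_funM; [exact: measurable_indic_Omega|exact: measurable_scatter].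
have VM n x : V n x <= (M * \1_Omega x)%:E.
  elim: n x => [|n IH] x; first by rewrite lee_fin mulr_ge0.
  rewrite VS indicE; have [|nOx] := boolP (x \in Omega); last first.
    by rewrite mul0e adde0 g0 ?mulr0// => Ox; move: nOx; rewrite mem_set.
  rewrite inE => Ox; rewrite mul1e mulr1.
  apply: (@le_trans _ _ (C%:E + (M * (1 - escape))%:E)).
    apply: leeD; first by rewrite lee_fin; have /andP[] := gC x.
    by apply: scatter_contract => //; rewrite normrN1.
  rewrite -EFinD lee_fin mulrBr mulr1 addrCA gerDl.
  by rewrite /M divfK ?subrr// gt_eqF.
have ndV x : nondecreasing_seq (V ^~ x).
  apply/nondecreasing_seqP => n; elim: n x => [|n IH] x; first exact: V0.
  rewrite VS [leRHS]VS leeD2l// lee_wpmul2l ?lee_fin//.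
  exact: scatter_le.
pose lV x := limn (V ^~ x).
have cV x : V n x @[n --> \oo] --> lV x by exact: ereal_nondecreasing_is_cvgn.
have lV0 x : 0 <= lV x by apply: lime_ge; [exact: cV|exact: nearW].
have lVM x : lV x <= (M * \1_Omega x)%:E by apply: lime_le; [exact: cV|exact: nearW].
have lVfin x : lV x \is a fin_num.
  by rewrite ge0_fin_numE// (le_lt_trans (lVM x))// ltry.
exists (fine \o lV); split.
- apply: measurableT_comp => //.
  by apply: (emeasurable_fun_cvg V) => // x _; exact: cV.
- move=> x /=; rewrite fine_ge0//= -lee_fin fineK//.
  by rewrite (le_trans (lVM x))// lee_fin ler_piMr// indicE; case: (_ \in _).
- move=> x nOx /=; have := lVM x; rewrite indicE memNset// mulr0 => lV0'.
  by have -> : lV x = 0 by apply/eqP; rewrite eq_le lV0 lV0'.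
- move=> x Ox; rewrite /= fineK//.
  have -> : EFin \o (fine \o lV) = lV by apply/funext => y /=; rewrite fineK.
  have c1 : V n.+1 x @[n --> \oo] --> (g x)%:E + scatter eps (-1) lV x.
    have -> : (fun n => V n.+1 x) = (fun n => (g x)%:E + scatter eps (-1) (V n) x).
      by apply/funext => n; rewrite VS indicE mem_set// mul1e.
    apply: cvgeD; [|exact: cvg_cst|exact: scatter_monotone_cvg].
    by rewrite fin_num_adde_defr.
  have c2 : V n.+1 x @[n --> \oo] --> lV x by rewrite (cvg_shiftS (V ^~ x)); exact: cV.
  by have := cvg_unique _ c2 c1; apply.
Qed.

End domain.
End scatter.

(** * The barrier *)

Section barrier_line.
Variables (R : realType) (eps a delta r0 b : R).
Hypotheses (eps0 : 0 < eps) (a0 : 0 < a) (a1 : a <= 1) (da : a * delta = 6 * eps).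
Hypotheses (d0 : 0 < delta) (br : b ^+ 2 <= 4 * r0).

(** To be used with [r0] = |x - y|^2 and [b] = 2 (x - y).w: the squared distance of x + s w to y.
    The hypothesis [br] is then the Cauchy-Schwarz inequality and makes the quadratic
    nonnegative. *)
Definition lsq (s : R) := r0 + b * s + s ^+ 2.
Definition lwsq (s : R) := lsq s + delta ^+ 2.
Definition lslope (s : R) := b + 2 * s.
Definition lpow (k s : R) := lwsq s `^ (a - k).

Lemma lslope_lsq s : lslope s ^+ 2 <= 4 * lsq s.
Proof.
rewrite /lslope /lsq -subr_ge0 (_ : _ - _ = 4 * r0 - b ^+ 2) ?subr_ge0//.
by ring.
Qed.

Lemma lsq_ge0 s : 0 <= lsq s.
Proof. by have := lslope_lsq s; have := sqr_ge0 (lslope s); lra. Qed.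

Lemma lwsq_gt0 s : 0 < lwsq s.
Proof. by rewrite ltr_wpDl// ?lsq_ge0// exprn_gt0. Qed.

Lemma lsq_le_lwsq s : lsq s <= lwsq s.
Proof. by rewrite lerDl sqr_ge0. Qed.

(** The arithmetic-geometric mean inequality: with p the slope, delta |p| <= p^2/4 + delta^2, and
    p^2/4 is at most [lsq s]. *)
Lemma lwsq_lslope s : delta * `|lslope s| <= lwsq s.
Proof.
have := lslope_lsq s; rewrite -[lslope s ^+ 2]real_normK ?num_real// => h.
have := sqr_ge0 (`|lslope s| / 2 - delta); rewrite /lwsq.
move: h; move: `|lslope s| => P h h'.
have -> : delta * P = - ((P / 2 - delta) ^+ 2) + P ^+ 2 / 4 + delta ^+ 2 by field.
lra.
Qed.

Lemma lpow_gt0 k s : 0 < lpow k s.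
Proof. by rewrite powR_gt0// lwsq_gt0. Qed.

Lemma lpowS k s : lpow k s = lwsq s * lpow (k + 1) s.
Proof.
rewrite /lpow -{2}[lwsq s]powRr1 ?(ltW (lwsq_gt0 _))// -powRD; last first.
  by apply/implyP => _; rewrite gt_eqF// lwsq_gt0.
by congr (_ `^ _); ring.
Qed.

Lemma is_derive_lpow k (s : R) :
  is_derive s 1 (lpow k) ((a - k) * lpow (k + 1) s * lslope s).
Proof.
have dq : is_derive s 1 lwsq (lslope s).
  rewrite /lwsq /lsq; apply: is_derive_eq; rewrite /lslope /GRing.scale/=; ring.
have dp := is_derive1_powR (a - k) (lwsq_gt0 s).
have := @is_derive1_comp R (fun x => x `^ (a - k)) lwsq s _ _ dp dq.
rewrite (_ : (a - k) * _ * lslope s = (a - k) * lpow (k + 1) s * lslope s); last first.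
  by rewrite /lpow; congr (_ * _ `^ _ * _); ring.
by [].
Qed.

Variable A : R.

(* The first and second order correctors of [A - lpow 0], adjusted so that both
   vanish in the average over directions: with [lsq] the squared distance to a
   point and [lslope] its derivative along the line, [lslope ^+ 2] averages to
   [2 * lsq]. *)
Definition line_barrier (s : R) := A - lpow 0 s - eps * a * (lpow 1 s * lslope s) +
  eps ^+ 2 * a * (1 - a) * (lpow 2 s * (lslope s ^+ 2 - 2 * lsq s)).

Definition line_barrier_deriv (s : R) := - (a * lpow 1 s * lslope s) -
  eps * a * ((a - 1) * lpow 2 s * lslope s ^+ 2 + 2 * lpow 1 s) +
  eps ^+ 2 * a * (1 - a) * ((a - 2) * lpow 3 s * lslope s * (lslope s ^+ 2 - 2 * lsq s)
    + lpow 2 s * (2 * lslope s)).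

Lemma is_derive_line_barrier (s : R) : is_derive s 1 line_barrier (line_barrier_deriv s).
Proof.
have d0' := is_derive_lpow 0 s; have d1 := is_derive_lpow 1 s; have d2 := is_derive_lpow 2 s.
have dp : is_derive s 1 lslope 2.
  rewrite /lslope; apply: is_derive_eq; rewrite /GRing.scale/=; ring.
have dr : is_derive s 1 lsq (lslope s).
  rewrite /lsq; apply: is_derive_eq; rewrite /lslope /GRing.scale/=; ring.
rewrite /line_barrier; apply: is_derive_eq; rewrite /line_barrier_deriv /GRing.scale/= add0r.
have -> : 1 + 1 = 2 :> R by ring.
have -> : 2 + 1 = 3 :> R by ring.
by ring.
Qed.

(** With U the corrected barrier, exp(-s/eps) (U - eps U')/eps is the derivative of -exp(-s/eps) U,
    so a pointwise bound on U - eps U' integrates exactly along a flight. In this expression the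
    terms of order eps cancel, as do those of order eps^2 with the squared slope. What is left of
    order eps^2 is at least 2 a^2 eps^2 [lpow 1 s]: one half is the source on the left, the other
    absorbs the remainder of third order. *)
Lemma line_barrier_ineq s :
  A - lpow 0 s + a ^+ 2 * eps ^+ 2 * lpow 1 s <= line_barrier s - eps * line_barrier_deriv s.
Proof.
have h3 := lpow_gt0 3 s.
rewrite -subr_ge0 /line_barrier /line_barrier_deriv.
have e2 : lpow 2 s = lwsq s * lpow 3 s by rewrite lpowS; congr (_ * lpow _ _); ring.
have e1 : lpow 1 s = lwsq s * (lwsq s * lpow 3 s) by rewrite -e2 lpowS; congr (_ * lpow _ _); ring.
rewrite e1 e2.
(* The third order remainder, up to its prefactor. It is at most 6 |slope| [lwsq s], and the
   relation a delta = 6 eps is tuned so that [eps * E] stays below a times the square of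
   [lwsq s]. *)
set E := lslope s * ((a - 2) * (lslope s ^+ 2 - 2 * lsq s) + 2 * lwsq s).
rewrite [X in 0 <= X](_ : _ = lpow 3 s * eps ^+ 2 * (2 * a * lwsq s ^+ 2 -
  2 * a * (1 - a) * lwsq s * lsq s - a * (1 - a) * (eps * E) - a ^+ 2 * lwsq s ^+ 2)); last first.
  by rewrite /E; ring.
apply: mulr_ge0; first by rewrite mulr_ge0// ?ltW// exprn_gt0.
have q0 := lwsq_gt0 s; have rq := lsq_le_lwsq s; have rs0 := lsq_ge0 s.
have epP : 6 * eps * `|lslope s| <= a * lwsq s.
  by rewrite -da -mulrA ler_pM2l// lwsq_lslope.
have E6 : `|E| <= `|lslope s| * (6 * lwsq s).
  rewrite /E normrM ler_wpM2l// ler_norml.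
  have := lslope_lsq s; have := sqr_ge0 (lslope s); move: (lslope s ^+ 2) => P2 P20 P2r.
  have aq : 0 <= a * lwsq s by rewrite mulr_ge0// ltW.
  have a2 : 0 <= 2 - a by have := a1; lra.
  have m1 : 0 <= (2 - a) * (2 * lwsq s - (P2 - 2 * lsq s)) by apply: mulr_ge0 => //; lra.
  have m2 : 0 <= (2 - a) * (2 * lwsq s + (P2 - 2 * lsq s)) by apply: mulr_ge0 => //; lra.
  by apply/andP; split; lra.
have eE : `|eps * E| <= a * lwsq s ^+ 2.
  rewrite normrM gtr0_norm//.
  have : eps * `|E| <= eps * (`|lslope s| * (6 * lwsq s)) by rewrite ler_pM2l.
  move/le_trans; apply.
  rewrite (_ : eps * _ = (6 * eps * `|lslope s|) * lwsq s); last by ring.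
  by rewrite expr2 mulrA ler_pM2r.
have eE' : eps * E <= a * lwsq s ^+ 2 by rewrite (le_trans (ler_norm _)).
have : a * (1 - a) * (eps * E) <= a * (1 - a) * (a * lwsq s ^+ 2).
  by rewrite ler_wpM2l// mulr_ge0 ?subr_ge0// ltW.
have : a * (1 - a) * lwsq s * lsq s <= a * (1 - a) * lwsq s * lwsq s.
  by rewrite ler_wpM2l// !mulr_ge0 ?subr_ge0// ltW.
have : a * (1 - a) * (a * lwsq s ^+ 2) <= a * 1 * (a * lwsq s ^+ 2).
  apply: ler_wpM2r; first by rewrite mulr_ge0 ?sqr_ge0// ltW.
  by rewrite ler_wpM2l ?(ltW a0)// gerBl ltW.
nra.
Qed.

(** Each of the two correctors lowers the value by at most a sixth of [lpow 0 s], again by the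
    choice of delta; hence nonnegativity once [A] is at least [2 * lpow 0 s]. *)
Lemma line_barrier_ge s : A - 2 * lpow 0 s <= line_barrier s.
Proof.
have h2 := lpow_gt0 2 s; have h1 := lpow_gt0 1 s; have h0 := lpow_gt0 0 s.
have e1 : lpow 1 s = lwsq s * lpow 2 s by rewrite lpowS; congr (_ * lpow _ _); ring.
have e0 : lpow 0 s = lwsq s * lpow 1 s by rewrite lpowS; congr (_ * lpow _ _); ring.
have q0 := lwsq_gt0 s; have rq := lsq_le_lwsq s; have rs0 := lsq_ge0 s.
have epP : 6 * eps * `|lslope s| <= a * lwsq s.
  by rewrite -da -mulrA ler_pM2l// lwsq_lslope.
have t1 : eps * a * (lpow 1 s * lslope s) <= lpow 0 s / 6.
  apply: (@le_trans _ _ (eps * a * (lpow 1 s * `|lslope s|))).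
    by apply: ler_wpM2l; [rewrite mulr_ge0 ?ltW|rewrite ler_pM2l// ler_norm].
  rewrite e0 (_ : eps * a * _ = a * lpow 1 s * (6 * eps * `|lslope s|) / 6); last by field.
  rewrite ler_pM2r ?invr_gt0//.
  apply: (@le_trans _ _ (a * lpow 1 s * (a * lwsq s))).
    by rewrite ler_wpM2l// mulr_ge0 ?ltW.
  have -> : a * lpow 1 s * (a * lwsq s) = a * a * (lwsq s * lpow 1 s) by ring.
  by apply: ler_piMl; [rewrite mulr_ge0 ?ltW|apply: mulr_ile1 => //; exact: ltW].
have t2 : - (eps ^+ 2 * a * (1 - a) * (lpow 2 s * (lslope s ^+ 2 - 2 * lsq s))) <= lpow 0 s / 6.
  have eq36 : 36 * eps ^+ 2 <= a ^+ 2 * lwsq s.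
    rewrite (_ : 36 * _ = (6 * eps) ^+ 2); last by ring.
    by rewrite -da exprMn ler_wpM2l ?sqr_ge0// /lwsq lerDr lsq_ge0.
  apply: (@le_trans _ _ (eps ^+ 2 * a * (1 - a) * (lpow 2 s * (2 * lwsq s)))).
    have c0 : 0 <= eps ^+ 2 * a * (1 - a).
      by rewrite !mulr_ge0 ?subr_ge0 ?sqr_ge0// ltW.
    rewrite -mulrN ler_wpM2l//.
    rewrite -mulrN ler_wpM2l ?(ltW h2)//; have := sqr_ge0 (lslope s); lra.
  rewrite (_ : _ * (2 * lwsq s)  = 2 * lpow 1 s); last by rewrite e1; ring.
  apply: (@le_trans _ _ (eps ^+ 2 * (2 * lpow 1 s))).
    rewrite ler_wpM2r ?mulr_ge0 ?(ltW h1)// -mulrA ler_piMr ?sqr_ge0//.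
    have := a0; have := a1; nra.
  have : 36 * eps ^+ 2 * lpow 1 s <= a ^+ 2 * lwsq s * lpow 1 s by rewrite ler_pM2r.
  have : a ^+ 2 * lwsq s * lpow 1 s <= 1 * (lwsq s * lpow 1 s).
    by rewrite -mulrA ler_pM2r ?mulr_gt0// expr_le1// ltW.
  rewrite e0; lra.
rewrite /line_barrier; lra.
Qed.

End barrier_line.

Section barrier.
Variables (R : realType) (Omega : set (R * R)) (L eps a : R).
Hypotheses (mOmega : measurable Omega) (L0 : 0 < L).
Hypothesis HD : forall x y, Omega x -> Omega y -> dot (x - y) (x - y) <= L ^+ 2.
Hypotheses (eps0 : 0 < eps) (a0 : 0 < a) (a1 : a <= 1).

Definition bwidth : R := 6 * eps / a.
(** The height [A]. A flight of length at most [L] from a point of [Omega] may end outside, up to 2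
    L away from y, hence 4 L^2; q^a <= 1 + q gives the sum, and the leading factor 2 is the one of
    [line_barrier_ge]. *)
Definition bheight : R := 2 * (1 + 4 * L ^+ 2 + bwidth ^+ 2).

Lemma bwidth_gt0 : 0 < bwidth.
Proof. by rewrite divr_gt0// mulr_gt0. Qed.
Lemma bwidthE : a * bwidth = 6 * eps.
Proof. by rewrite /bwidth; field; rewrite gt_eqF. Qed.

Definition bdist (y x : R * R) : R := dot (x - y) (x - y) + bwidth ^+ 2.
(** Half of what (eps^2/2) times the Laplacian yields to leading order on |z|^(2a), namely 2 a^2
    eps^2 |z|^(2a-2), with |z|^2 regularized to [bdist]. *)
Definition bsource y x : R := a ^+ 2 * eps ^+ 2 * bdist y x `^ (a - 1).
Definition barrier y x : R := bheight - bdist y x `^ a + bsource y x.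

Lemma dot_ge0 (x : R * R) : 0 <= dot x x.
Proof. by rewrite /dot -!expr2 addr_ge0// sqr_ge0. Qed.

Lemma bdist_gt0 y x : 0 < bdist y x.
Proof. by rewrite ltr_wpDl ?dot_ge0// exprn_gt0// bwidth_gt0. Qed.

Lemma bsource_gt0 y x : 0 < bsource y x.
Proof. by rewrite !mulr_gt0 ?exprn_gt0// powR_gt0// bdist_gt0. Qed.

Lemma powR_le_1D (q : R) : 0 <= q -> q `^ a <= 1 + q.
Proof.
move=> q0; have [q1|q1] := leP 1 q.
  by rewrite (le_trans (ler_powR q1 a1))// powRr1// lerDr.
have : q `^ a <= 1 `^ a by rewrite ge0_ler_powR ?nnegrE// ?ltW.
by rewrite powR1 => /le_trans; apply; rewrite lerDl.
Qed.

Lemma cauchy_S1 (v w : R * R) : S1 w -> (2 * dot v w) ^+ 2 <= 4 * dot v v.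
Proof.
move=> /S1P w1; rewrite -subr_ge0.
have -> : 4 * dot v v - (2 * dot v w) ^+ 2 =
   4 * (v.1 * w.2 - v.2 * w.1) ^+ 2 + 4 * dot v v * (1 - dot w w).
  by rewrite /dot; ring.
by rewrite w1 subrr mulr0 addr0 mulr_ge0// sqr_ge0.
Qed.

Lemma dot_line (x y w : R * R) s : S1 w ->
  dot (x + s *: w - y) (x + s *: w - y) =
  lsq (dot (x - y) (x - y)) (2 * dot (x - y) w) s.
Proof.
move=> /S1P w1; rewrite /lsq.
have -> : s ^+ 2 = s ^+ 2 * dot w w by rewrite w1 mulr1.
by rewrite /dot/= /GRing.scale/=; ring.
Qed.

Lemma measurable_bdist y : measurable_fun [set: R * R] (bdist y).
Proof. by rewrite /bdist /dot; msolve. Qed.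

Lemma measurable_bsource y : measurable_fun [set: R * R] (bsource y).
Proof.
apply: measurable_funM; first exact: measurable_cst.
apply: (measurableT_comp (@measurable_powR R (a - 1))); exact: measurable_bdist.
Qed.

Lemma measurable_barrier y : measurable_fun [set: R * R]
  (fun x => (\1_Omega x * barrier y x)%:E).
Proof.
apply/measurable_EFinP; apply: measurable_funM; first exact: measurable_indic.
apply: measurable_funD; last exact: measurable_bsource.
apply: measurable_funB; first exact: measurable_cst.
apply: (measurableT_comp (@measurable_powR R a)); exact: measurable_bdist.
Qed.

Lemma bdist_powR_le y x : Omega x -> Omega y -> bdist y x `^ a <= bheight / 2.
Proof.
move=> Ox Oy; apply: (le_trans (powR_le_1D (ltW (bdist_gt0 y x)))).
rewrite /bheight /bdist; have := HD Ox Oy; have := sqr_ge0 L.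
by move: (L ^+ 2) (bwidth ^+ 2) (dot _ _) => l w d; lra.
Qed.

Lemma indic_barrier_ge0 y x : Omega y -> 0 <= \1_Omega x * barrier y x.
Proof.
move=> Oy; rewrite indicE; have [|] := boolP (x \in Omega); last by rewrite mul0r.
rewrite inE mul1r => Ox; rewrite /barrier.
have := bdist_powR_le Ox Oy; have := bsource_gt0 y x.
have : 0 <= bheight.
  by rewrite /bheight; have := sqr_ge0 L; have := sqr_ge0 bwidth; lra.
lra.
Qed.

Section at_point.
Variables (x y w : R * R).
Hypotheses (Ox : Omega x) (Oy : Omega y) (w1 : S1 w).

Let r0 := dot (x - y) (x - y).
Let b := 2 * dot (x - y) w.
Let br : b ^+ 2 <= 4 * r0. Proof. exact: cauchy_S1. Qed.
Let U := line_barrier eps a bwidth r0 b bheight.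
Let dU := line_barrier_deriv eps a bwidth r0 b.

Let bheight_ge s : 0 <= s <= L -> 2 * lpow a bwidth r0 b 0 s <= bheight.
Proof.
move=> /andP[s0 sL]; rewrite /bheight ler_pM2l// /lpow subr0.
apply: (le_trans (powR_le_1D (ltW (lwsq_gt0 bwidth_gt0 br s)))).
rewrite -addrA lerD2l /lwsq lerD2r.
have rL : r0 <= L ^+ 2 by exact: HD.
have bL : b <= 2 * L.
  rewrite (le_trans (ler_norm _))// -(@ler_pXn2r _ 2) ?nnegrE ?mulr_ge0 ?(ltW L0)//.
  by rewrite real_normK ?num_real//; apply: (le_trans br); rewrite [leRHS]exprMn -natrX ler_pM2l.
have : b * s <= 2 * L * L.
  by apply: (@le_trans _ _ (2 * L * s)); rewrite ?ler_wpM2r// ler_wpM2l ?mulr_ge0 ?(ltW L0).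
have : s ^+ 2 <= L ^+ 2 by rewrite lerXn2r ?nnegrE// (le_trans s0).
rewrite /lsq; move: (L ^+ 2) (s ^+ 2) (b * s) rL (expr2 L) => LL ss bs.
lra.
Qed.

Lemma line_barrier_ge0 s : 0 <= s <= L -> 0 <= U s.
Proof.
move=> sL; apply: le_trans (line_barrier_ge eps0 a0 a1 bwidthE bwidth_gt0 br bheight s).
by rewrite subr_ge0 bheight_ge.
Qed.

(** The exact derivative of [G] below; it dominates the flight integrand of the barrier for
    [s >= 0]. *)
Let f (s : R) := eps^-1 * expR (- eps^-1 * s) * (U s - eps * dU s).
Let G (s : R) := - (expR (- eps^-1 * s) * U s).

Let derive_G (s : R) : is_derive s 1 G (f s).
Proof.
have dUs : is_derive s 1 U (dU s) := is_derive_line_barrier eps a bwidth_gt0 br bheight s.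
have dl : is_derive s 1 (fun s => - eps^-1 * s) (- eps^-1).
  by apply: is_derive_eq; rewrite /GRing.scale/=; ring.
have de := @is_derive1_comp R expR (fun s => - eps^-1 * s) s _ _ (is_derive_expR _) dl.
rewrite /G; apply: is_derive_eq; rewrite /f /GRing.scale/=.
by field; rewrite gt_eqF.
Qed.

Let derivable_dU (s : R) : derivable dU s 1.
Proof.
have d1 := is_derive_lpow a bwidth_gt0 br 1 s.
have d2 := is_derive_lpow a bwidth_gt0 br 2 s.
have d3 := is_derive_lpow a bwidth_gt0 br 3 s.
have dp : is_derive s 1 (lslope b) 2.
  rewrite /lslope; apply: is_derive_eq; rewrite /GRing.scale/=; ring.
have dr : is_derive s 1 (lsq r0 b) (lslope b s).
  rewrite /lsq; apply: is_derive_eq; rewrite /lslope /GRing.scale/=; ring.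
by rewrite /dU /line_barrier_deriv; apply: ex_derive.
Qed.

Let derivable_f (s : R) : derivable f s 1.
Proof.
have ddU : is_derive s 1 dU ('D_1 dU s) by apply: derivableP; exact: derivable_dU.
have dUs : is_derive s 1 U (dU s) := is_derive_line_barrier eps a bwidth_gt0 br bheight s.
have dl : is_derive s 1 (fun s => - eps^-1 * s) (- eps^-1).
  by apply: is_derive_eq; rewrite /GRing.scale/=; ring.
have de := @is_derive1_comp R expR (fun s => - eps^-1 * s) s _ _ (is_derive_expR _) dl.
by rewrite /f; apply: ex_derive.
Qed.

Let continuous_f : continuous f.
Proof.
by move=> s; apply: differentiable_continuous; apply/derivable1_diffP; exact: derivable_f.
Qed.

Let W (z : (R * R) * (R * R)) : \bar R := (\1_Omega z.1 * barrier y z.1)%:E.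

Let f_ge (s : R) : 0 <= s -> free_path eps s * barrier y (x + s *: w) <= f s.
Proof.
move=> s0; rewrite /free_path exponential_pdfE// /f ler_wpM2l//.
  by rewrite mulr_ge0 ?invr_ge0 ?expR_ge0// ltW.
apply: le_trans (line_barrier_ineq eps0 a0 a1 bwidthE bwidth_gt0 br bheight s).
by rewrite /barrier /bsource /bdist dot_line// /lpow subr0.
Qed.

Let f_ge0 (s : R) : 0 <= s <= L -> 0 <= f s.
Proof.
move=> sL; have /andP[s0 _] := sL; apply: le_trans (f_ge s0).
rewrite mulr_ge0 ?free_path_ge0// /barrier /bdist dot_line//.
have := bheight_ge sL; rewrite /lpow subr0.
have := bsource_gt0 y (x + s *: w).
have := powR_ge0 (lwsq bwidth r0 b s) a; rewrite /lwsq -/r0 -/b.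
lra.
Qed.

(** Flights longer than [L] have left [Omega], and up to [L] the integrand is at most [f], which is
    nonnegative there even where the indicator vanishes. The fundamental theorem leaves U 0 -
    exp(-L/eps) U L, and U L is nonnegative. *)
Lemma flight_barrier : (flight eps 1 W (x, w) <= (U 0)%:E)%E.
Proof.
have mW : measurable_fun [set: (R * R) * (R * R)] W.
  apply: (measurable_fst_comp (a := fun x => (\1_Omega x * barrier y x)%:E)).
  exact: measurable_barrier.
apply: (@le_trans _ _ (\int[lebesgue_measure]_(s in `[0%R, L]) (f s)%:E)%E).
  rewrite [leRHS]integral_mkcond; apply: ge0_le_integral => //.
  - by move=> s _; apply: mule_ge0; rewrite lee_fin ?free_path_ge0// indic_barrier_ge0.
  - exact: (measurable_flight_line eps 1 mW (x, w)).
  - apply/(measurable_restrictT _ _).1 => //.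
    apply/measurable_EFinP; apply: measurable_funTS.
    exact: (measurable_realfun.continuous_measurable_fun continuous_f).
  - move=> s _; rewrite patchE.
    have [s0|s0] := leP 0 s; last first.
      rewrite /free_path lt0_exponential_pdf// mul0e; case: ifPn => //.
      by rewrite inE/= in_itv/= leNgt s0.
    have [sL|sL] := leP s L.
      rewrite mem_set/= ?in_itv/= ?s0//= /W/= mul1r indicE.
      case: (_ \in _); first by rewrite mul1r -EFinM lee_fin f_ge.
      by rewrite mul0r mule0 lee_fin f_ge0// s0.
    have nO : ~ Omega (x + s *: w).
      move=> Os; have := HD Os Ox; rewrite addrC addKr dotZl dotC dotZl.
      rewrite ((S1P w).1 w1) mulr1 -expr2 ler_pXn2r ?nnegrE ?(ltW L0)//.
      by rewrite leNgt sL.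
    rewrite memNset/=; last by rewrite in_itv/= s0 leNgt sL.
    by rewrite /W/= mul1r indicE memNset// mul0r mule0.
rewrite (FTC2_derive L0 derive_G continuous_f) lee_fin /G mulr0 expR0 mul1r opprK.
by rewrite addrC gerDl oppr_le0 mulr_ge0 ?expR_ge0// line_barrier_ge0// lexx ltW.
Qed.

End at_point.

(** The corrected barrier at [s = 0] is quadratic in the direction and its correctors have mean
    zero, so the direction average is exactly the barrier without [bsource]. The source is thus the
    gain: [barrier] is a supersolution of the adjoint of [K]. *)
Lemma scatter_barrier (x y : R * R) : Omega x -> Omega y ->
  (scatter eps 1 (fun z => (\1_Omega z * barrier y z)%:E) x + (bsource y x)%:E <=
   (barrier y x)%:E)%E.
Proof.
move=> Ox Oy; rewrite /barrier [in leRHS]EFinD; apply: leeD => //.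
have mW := measurable_barrier y.
have mWf := measurable_fst_comp mW.
have W0 z : (0 <= (\1_Omega z * barrier y z)%:E)%E by rewrite lee_fin indic_barrier_ge0.
pose U w := line_barrier eps a bwidth (dot (x - y) (x - y)) (2 * dot (x - y) w) bheight 0.
(* Averages are of functions nonnegative on the whole plane; [U] is known to be so only on [S1],
   where the truncation changes nothing. *)
pose F w : \bar R := (Num.max 0 (U w))%:E.
set q := bdist y x; pose B := eps ^+ 2 * a * (1 - a) * q `^ (a - 2).
pose c0 := bheight - q `^ a - 2 * dot (x - y) (x - y) * B.
pose c1 := - (2 * eps * a * q `^ (a - 1) * (x - y).1).
pose c2 := - (2 * eps * a * q `^ (a - 1) * (x - y).2).
pose c3 := 4 * B * (x - y).1 ^+ 2.
pose c4 := 4 * B * (x - y).2 ^+ 2.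
pose c5 := 8 * B * ((x - y).1 * (x - y).2).
have U_E w : U w = c0 + c1 * w.1 + c2 * w.2 + c3 * w.1 ^+ 2 + c4 * w.2 ^+ 2 + c5 * (w.1 * w.2).
  rewrite /U /line_barrier /lpow /lwsq /lsq /lslope !mulr0 !addr0 subr0 expr0n/= addr0 -/(bdist y x) -/q.
  by rewrite /c0 /c1 /c2 /c3 /c4 /c5 /B /dot; ring.
have mU : measurable_fun [set: R * R] U.
  have -> : U = (fun w => c0 + c1 * w.1 + c2 * w.2 + c3 * w.1 ^+ 2 + c4 * w.2 ^+ 2 + c5 * (w.1 * w.2)).
    by apply/funext => w; exact: U_E.
  have m1 : measurable_fun [set: R * R] (fun w : R * R => w.1 ^+ 2).
    by apply: measurable_funX; exact: measurable_fst.
  have m2 : measurable_fun [set: R * R] (fun w : R * R => w.2 ^+ 2).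
    by apply: measurable_funX; exact: measurable_snd.
  by msolve.
have mF : measurable_fun [set: R * R] F.
  by apply/measurable_EFinP; apply: measurable_maxr => //; exact: measurable_cst.
have F0 w : (0 <= F w)%E by rewrite lee_fin le_max lexx.
have UF w : S1 w -> F w = (U w)%:E.
  by move=> w1; rewrite /F max_r// line_barrier_ge0// lexx ltW.
have -> : (bheight - q `^ a)%:E = avg F.
  rewrite (avg_moments mF F0 (fun w w1 => etrans (UF w w1) (congr1 EFin (U_E w)))).
  by congr EFin; rewrite /c0 /c3 /c4 /dot; field.
apply: avg_le => //.
- by apply: measurable_flight_at => // z; exact: W0.
- by move=> w; apply: flight_ge0 => // z; exact: W0.
- by move=> w w1; rewrite UF//; exact: flight_barrier.
Qed.

End barrier.

(** * The supremum of a subsolution *)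

Section double_scatter.
Variables (R : realType) (eps : R).
Hypothesis eps0 : 0 < eps.

Definition eta (x y : R * R) : R := eps ^+ 2 / (eps ^+ 2 + dot (y - x) (y - x)).

Lemma eta_den_gt0 x y : 0 < eps ^+ 2 + dot (y - x) (y - x).
Proof. by rewrite ltr_wpDr ?dot_ge0// exprn_gt0. Qed.

Lemma eta_ge0 x y : 0 <= eta x y.
Proof. by rewrite divr_ge0 ?sqr_ge0// ltW// eta_den_gt0. Qed.

Lemma measurable_eta x : measurable_fun [set: R * R] (eta x).
Proof.
apply: measurable_funM; first exact: measurable_cst.
rewrite (_ : (fun y => _) = (fun y => (eps ^+ 2 + dot (y - x) (y - x)) `^ (-1))).
  apply: (measurableT_comp (@measurable_powR R (-1))).
  by rewrite /dot; msolve.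
by apply/funext => y; rewrite powR_inv1// ltW// eta_den_gt0.
Qed.

Lemma dot_S1_le1 (w v : R * R) : S1 w -> S1 v -> dot w v <= 1.
Proof.
move=> /S1P w1 /S1P v1; have := dot_ge0 (w - v).
rewrite dotBl dotC dotBl w1 [dot v (w - v)]dotC dotBl v1 [dot v w]dotC; lra.
Qed.

Lemma det_S1_le1 (w v : R * R) : S1 w -> S1 v -> (w.1 * v.2 - w.2 * v.1) ^+ 2 <= 1.
Proof.
move=> /S1P w1 /S1P v1.
have -> : (w.1 * v.2 - w.2 * v.1) ^+ 2 = dot w w * dot v v - dot w v ^+ 2.
  by rewrite /dot; ring.
by rewrite w1 v1 mulr1 gerBl sqr_ge0.
Qed.

(** From e^t >= (1 + t/2)^2 >= (1 + t^2)/4. It trades the exponential for the rational profile of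
    [eta]. *)
Lemma expRN_le (t : R) : 0 <= t -> expR (- t) <= 4 / (1 + t ^+ 2).
Proof.
move=> t0; have t2 : 0 < 1 + t ^+ 2 by rewrite ltr_wpDr ?sqr_ge0.
rewrite ler_pdivlMr// expRN mulrC ler_pdivrMr ?expR_gt0//.
have -> : expR t = expR (t / 2) ^+ 2 by rewrite expr2 -expRD; congr expR; field.
have : (1 + t / 2) ^+ 2 <= expR (t / 2) ^+ 2.
  by rewrite ler_pXn2r ?nnegrE ?expR_ge0 ?addr_ge0 ?divr_ge0// expR_ge1Dx.
have -> : (1 + t / 2) ^+ 2 = 1 + t + t ^+ 2 / 4 by field.
have := sqr_ge0 t; lra.
Qed.

(** The product of the two densities depends only on s + t, which is at least the distance travelled
    |s w + t v|. *)
Lemma two_flights_eta (x w v : R * R) (s t : R) : S1 w -> S1 v ->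
  free_path eps s * free_path eps t <= 4 * eps ^- 2 * eta x (x - s *: w - t *: v).
Proof.
move=> w1 v1.
have e2 : 0 < eps ^- 2 by rewrite invr_gt0 exprn_gt0.
have [s0|s0] := leP 0 s; last first.
  by rewrite {1}/free_path lt0_exponential_pdf// mul0r mulr_ge0 ?eta_ge0// mulr_ge0// ltW.
have [t0|t0] := leP 0 t; last first.
  by rewrite {2}/free_path lt0_exponential_pdf// mulr0 mulr_ge0 ?eta_ge0// mulr_ge0// ltW.
rewrite /free_path !exponential_pdfE//.
have -> : eps^-1 * expR (- eps^-1 * s) * (eps^-1 * expR (- eps^-1 * t)) =
   eps ^- 2 * expR (- ((s + t) / eps)).
  rewrite mulrACA -expRD -invfM -expr2; congr (_ * expR _); field; exact: lt0r_neq0.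
rewrite [4 * _]mulrC -mulrA ler_pM2l//.
have st0 : 0 <= (s + t) / eps by rewrite divr_ge0 ?addr_ge0// ltW.
apply: (le_trans (expRN_le st0)); rewrite ler_pM2l//.
rewrite /eta -[leRHS]invrK lef_pV2 ?posrE ?invr_gt0 ?divr_gt0 ?exprn_gt0 ?eta_den_gt0//; last first.
  by rewrite ltr_wpDr ?sqr_ge0.
rewrite invf_div ler_pdivrMr ?exprn_gt0// mulrDl mul1r lerD2l.
rewrite expr_div_n divfK ?expf_neq0 ?gt_eqF//.
have -> : dot (x - s *: w - t *: v - x) (x - s *: w - t *: v - x) =
   s ^+ 2 * dot w w + t ^+ 2 * dot v v + 2 * (s * t) * dot w v.
  by rewrite /dot/= /GRing.scale/=; ring.
rewrite ((S1P w).1 w1) ((S1P v).1 v1) !mulr1.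
have : 2 * (s * t) * dot w v <= 2 * (s * t) * 1.
  by apply: ler_wpM2l; [rewrite !mulr_ge0|exact: dot_S1_le1].
rewrite sqrrD; lra.
Qed.

Section bound.
Variables (alpha : R * R -> R) (N e : R).
Hypotheses (malpha : measurable_fun [set: R * R] alpha)
  (aN : forall x, 0 <= alpha x <= N) (e0 : 0 <= e).
Local Open Scope ereal_scope.

Let A : R * R -> \bar R := EFin \o alpha.
Let mA : measurable_fun [set: R * R] A. Proof. exact/measurable_EFinP. Qed.
Let A0 x : 0 <= A x. Proof. by rewrite lee_fin; have /andP[] := aN x. Qed.
Let AN x : A x <= N%:E. Proof. by rewrite lee_fin; have /andP[] := aN x. Qed.
Let N0 : (0 <= N)%R. Proof. by have /andP[/le_trans] := aN (0, 0)%R; exact. Qed.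

Section at_point.
Variables (x w : R * R).
Hypotheses (w1 : S1 w) (xe : \int[@lam2 R]_y (eta x y * alpha y)%:E <= e%:E).

(** Two backward flights from [x] with both directions fixed, first [w], then [v]. *)
Let I (v : R * R) : \bar R := \int[lebesgue_measure]_s
  ((free_path eps s)%:E * flight eps (-1) (A \o fst) (x + (-1 * s) *: w, v)%R).

Let mfA := measurable_fst_comp mA.
Let fA0 (z : (R * R) * (R * R)) : 0 <= (A \o fst) z. Proof. exact: A0. Qed.

Let mJ : measurable_fun [set: R * (R * R)] (fun p => (free_path eps p.1)%:E *
  flight eps (-1) (A \o fst) (x + (-1 * p.1) *: w, p.2)%R).
Proof.
apply: emeasurable_funM.
  apply/measurable_EFinP; exact: (measurableT_comp (measurable_free_path eps) measurable_fst).
apply: (measurableT_comp (measurable_flight eps0 (-1) mfA fA0)).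
by msolve.
Qed.

Let J0 (p : R * (R * R)) : 0 <= (free_path eps p.1)%:E *
  flight eps (-1) (A \o fst) (x + (-1 * p.1) *: w, p.2)%R.
Proof. by rewrite mule_ge0 ?lee_fin ?free_path_ge0// flight_ge0. Qed.

Let flight_scatterE : flight eps (-1) (scatter eps (-1) A \o fst) (x, w) = avg I.
Proof.
rewrite /flight/= /scatter /avg.
transitivity (((2 * pi)^-1)%:E * \int[lebesgue_measure]_s \int[@circle_measure R]_v
   ((free_path eps s)%:E * flight eps (-1) (A \o fst) (x + (-1 * s) *: w, v)%R)).
  rewrite -ge0_integralZl_EFin//=; last 3 first.
  - by move=> s _; apply: integral_ge0 => v _; exact: (J0 (s, v)).
  - exact: (measurable_fun_fubini_tonelli_F (m2 := @circle_measure R) _ mJ J0).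
  - by rewrite invr_ge0 mulr_ge0// pi_ge0.
  apply: eq_integral => s _; rewrite muleCA ge0_integralZl_EFin//; last 3 first.
  - by move=> v _; exact: flight_ge0.
  - exact: measurable_flight_at.
  - exact: free_path_ge0.
congr (_ * _).
exact: (fubini_tonelli (m1 := @lebesgue_measure R) (m2 := @circle_measure R) _ mJ J0).
Qed.

(** With d = det(w, v), split I v = (1 - d^2) I v + d^2 I v. The first part uses [I v <= N]; in the
    second d^2 <= |d|, and |d| I v is bounded by the change of variables. *)
Let I_le (v : R * R) : S1 v ->
  I v <= ((1 - (w.1 * v.2 - w.2 * v.1) ^+ 2) * N + 4 * eps ^- 2 * e)%:E.
Proof.
move=> v1; set d := (w.1 * v.2 - w.2 * v.1)%R.
have d1 : (d ^+ 2 <= 1)%R by exact: det_S1_le1.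
have I0 : 0 <= I v by apply: integral_ge0 => s _; exact: (J0 (s, v)).
have IN : I v <= N%:E.
  rewrite -(flight_cst eps0 (-1) (x, w) N0).
  apply: ge0_le_integral => //.
  - by move=> s _; exact: (J0 (s, v)).
  - exact: (measurableT_comp mJ (pair2_measurable v)).
  - exact: (measurable_flight_line eps (-1) (measurable_cst N%:E) (x, w)).
  - move=> s _; rewrite lee_wpmul2l ?lee_fin ?free_path_ge0//.
    rewrite -(flight_cst eps0 (-1) (x + (-1 * s) *: w, v)%R N0).
    by apply: flight_le => // t _; exact: AN.
have ce : (0 <= 4 * eps ^- 2)%R by rewrite mulr_ge0// invr_ge0 sqr_ge0.
(* [det_integral_le] integrates about the origin, so the majorant is recentred at [x]; translation
   invariance undoes this afterwards. *)
pose a (p : R * R) : \bar R := (4 * eps ^- 2 * (eta x (p + x) * alpha (p + x)))%:E.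
have ma : measurable_fun [set: R * R] a.
  apply/measurable_EFinP; apply: measurable_funM => //.
  have sh : measurable_fun [set: R * R] (fun p : R * R => (p + x)%R).
    by apply/measurable_fun_pairP; split => /=; msolve.
  by apply: measurable_funM; apply: measurableT_comp sh => //; exact: measurable_eta.
have a0 p : 0 <= a p.
  by rewrite lee_fin mulr_ge0// mulr_ge0 ?eta_ge0//; have /andP[] := aN (p + x)%R.
have dI : `|d|%:E * I v <= (4 * eps ^- 2 * e)%:E.
  apply: (@le_trans _ _ (\int[@lam2 R]_p a p)); last first.
    pose b (y : R * R) : \bar R := (4 * eps ^- 2 * (eta x y * alpha y))%:E.
    have mb : measurable_fun [set: R * R] b.
      apply/measurable_EFinP; apply: measurable_funM => //.
      by apply: measurable_funM => //; exact: measurable_eta.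
    have b0 y : 0 <= b y.
      by rewrite lee_fin mulr_ge0// mulr_ge0 ?eta_ge0//; have /andP[] := aN y.
    rewrite [leLHS](lam2_shift x mb b0).
    rewrite EFinM; apply: le_trans (lee_wpmul2l _ xe); last by rewrite lee_fin.
    rewrite -ge0_integralZl_EFin//=.
    - by move=> y _; rewrite lee_fin mulr_ge0 ?eta_ge0//; have /andP[] := aN y.
    - by apply/measurable_EFinP; apply: measurable_funM => //; exact: measurable_eta.
  (* Backward flights move along -w and -v, which have the same determinant. *)
  have := det_integral_le (- w)%R (- v)%R ma a0.
  rewrite /= !mulrNN -/d; apply: le_trans; rewrite lee_wpmul2l ?lee_fin//.
  have mst : measurable_fun [set: R * R] (fun p => a (p.1 *: - w + p.2 *: - v)%R).
    by apply: (measurableT_comp ma); apply/measurable_fun_pairP; split => /=; msolve.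
  apply: ge0_le_integral => //.
  - by move=> s _; exact: (J0 (s, v)).
  - exact: (measurableT_comp mJ (pair2_measurable v)).
  - exact: (measurable_fun_fubini_tonelli_F (m2 := @lebesgue_measure R) _ mst (fun _ => a0 _)).
  move=> s _; rewrite /flight -ge0_integralZl_EFin//; last 3 first.
  - by move=> t _; exact: flight_line_ge0.
  - exact: (measurable_flight_line eps (-1) mfA (_, v)).
  - exact: free_path_ge0.
  apply: ge0_le_integral => //.
  - move=> t _; apply: mule_ge0; first by rewrite lee_fin free_path_ge0.
    by apply: mule_ge0; [rewrite lee_fin free_path_ge0|exact: A0].
  - by apply: measurable_funeM; exact: (measurable_flight_line eps (-1) mfA (_, v)).
  - exact: (measurableT_comp mst (pair1_measurable s)).
  move=> t _; rewrite /A/= muleA -!EFinM lee_fin.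
  have -> : (x + (-1 * s) *: w + (-1 * t) *: v = x - s *: w - t *: v)%R.
    by rewrite !mulN1r !scaleNr.
  have -> : (s *: - w + t *: - v + x = x - s *: w - t *: v)%R.
    by rewrite !scalerN addrC addrA.
  rewrite [leRHS]mulrA ler_wpM2r ?two_flights_eta//.
  by have /andP[] := aN (x - s *: w - t *: v)%R.
have fI : I v \is a fin_num by rewrite ge0_fin_numE// (le_lt_trans IN)// ltry.
move: I0 IN dI; rewrite -(fineK fI) -EFinM !lee_fin => I0 IN dI.
move: d1 dI; rewrite -[(d ^+ 2)%R]real_normK ?num_real//; move: (fine (I v)) (`|d|%R) (normr_ge0 d) I0 IN => i D D0 i0 iN D1 Di.
have D1' : (D <= 1)%R by rewrite -(expr_le1 (n := 2)).
have : (D ^+ 2 * i <= D * i)%R by rewrite ler_wpM2r// expr2 ler_piMr.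
have : ((1 - D ^+ 2) * i <= (1 - D ^+ 2) * N)%R by rewrite ler_wpM2l// subr_ge0.
lra.
Qed.

(** As a polynomial in [v], det(w, v)^2 has average |w|^2 / 2 = 1/2, which is where the factor 1/2
    in front of [N] comes from. *)
Lemma flight_scatter_le :
  flight eps (-1) (scatter eps (-1) A \o fst) (x, w) <= (N / 2 + 4 * eps ^- 2 * e)%:E.
Proof.
rewrite flight_scatterE.
pose c (v : R * R) := ((N + 4 * eps ^- 2 * e) + 0 * v.1 + 0 * v.2 + (- N * w.2 ^+ 2) * v.1 ^+ 2
   + (- N * w.1 ^+ 2) * v.2 ^+ 2 + (2 * N * (w.1 * w.2)) * (v.1 * v.2))%R.
have cE v : c v = ((1 - (w.1 * v.2 - w.2 * v.1) ^+ 2) * N + 4 * eps ^- 2 * e)%R.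
  by rewrite /c; ring.
have mc : measurable_fun [set: R * R] c.
  have m1 : measurable_fun [set: R * R] (fun w : R * R => (w.1 ^+ 2)%R).
    by apply: measurable_funX; exact: measurable_fst.
  have m2 : measurable_fun [set: R * R] (fun w : R * R => (w.2 ^+ 2)%R).
    by apply: measurable_funX; exact: measurable_snd.
  by rewrite /c; msolve.
pose C v : \bar R := (Num.max 0%R (c v))%:E.
have mC : measurable_fun [set: R * R] C.
  by apply/measurable_EFinP; apply: measurable_maxr => //; exact: measurable_cst.
have C0 v : 0 <= C v by rewrite lee_fin le_max lexx.
have CE v : S1 v -> C v = (c v)%:E.
  move=> v1; rewrite /C max_r// cE addr_ge0//.
    by rewrite mulr_ge0// subr_ge0 det_S1_le1.
  by rewrite mulr_ge0// mulr_ge0// invr_ge0 sqr_ge0.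
apply: (@le_trans _ _ (avg C)).
  apply: avg_le => //.
  - exact: (measurable_fun_fubini_tonelli_G (m1 := @lebesgue_measure R) _ mJ J0).
  - by move=> v; apply: integral_ge0 => s _; exact: (J0 (s, v)).
  - by move=> v v1; rewrite CE// cE I_le.
rewrite (avg_moments mC C0 CE) lee_fin.
have := (S1P w).1 w1; rewrite /dot -!expr2 => ww.
rewrite (_ : _ + _ / 2 + _ / 2 = N + 4 * eps ^- 2 * e - N / 2 * (w.1 ^+ 2 + w.2 ^+ 2))%R; last by field; exact: lt0r_neq0.
by rewrite ww; lra.
Qed.

End at_point.

(* Split 1 into [1 - det(w, v)^2] and [det(w, v)^2]: the first averages to 1/2, the
   second absorbs the Jacobian of [(s, t) |-> x - s w - t v]. *)
Lemma double_scatter_le (x : R * R) :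
  \int[@lam2 R]_y (eta x y * alpha y)%:E <= e%:E ->
  scatter eps (-1) (scatter eps (-1) A) x <= (N / 2 + 4 * eps ^- 2 * e)%:E.
Proof.
move=> xe; have c0 : (0 <= N / 2 + 4 * eps ^- 2 * e)%R.
  by rewrite addr_ge0 ?divr_ge0// mulr_ge0// mulr_ge0// invr_ge0 sqr_ge0.
have mS := measurable_scatter eps0 (-1) mA A0.
have mfS := measurable_fst_comp mS.
have fS0 (z : (R * R) * (R * R)) : 0 <= (scatter eps (-1) A \o fst) z.
  exact: (scatter_ge0 eps0).
rewrite -(avg_cst c0); apply: avg_le.
- exact: (measurable_flight_at eps0 (-1) x mfS fS0).
- exact: measurable_cst.
- by move=> w; exact: (flight_ge0 eps0 (-1) fS0).
- by move=> w; rewrite lee_fin.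
- by move=> w w1; exact: flight_scatter_le.
Qed.

End bound.
End double_scatter.

Section lam2_lemmas.
Variable R : realType.
Local Open Scope ereal_scope.
Implicit Types f g : R * R -> \bar R.

Lemma lam2_le f g : measurable_fun [set: R * R] f -> measurable_fun [set: R * R] g ->
  (forall x, 0 <= f x) -> (forall x, f x <= g x) ->
  \int[@lam2 R]_x f x <= \int[@lam2 R]_x g x.
Proof.
move=> mf mg f0 fg.
exact: (ge0_le_integral (@lam2 R) measurableT (fun z _ => f0 z) mf mg (fun z _ => fg z)).
Qed.

Lemma lam2D f g : measurable_fun [set: R * R] f -> measurable_fun [set: R * R] g ->
  (forall x, 0 <= f x) -> (forall x, 0 <= g x) ->
  \int[@lam2 R]_x (f x + g x) = \int[@lam2 R]_x f x + \int[@lam2 R]_x g x.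
Proof.
move=> mf mg f0 g0.
exact: (ge0_integralD (@lam2 R) measurableT (fun z _ => f0 z) mf (fun z _ => g0 z) mg).
Qed.

Lemma lam2Zl (c : R) f : measurable_fun [set: R * R] f -> (forall x, 0 <= f x) -> (0 <= c)%R ->
  \int[@lam2 R]_x (c%:E * f x) = c%:E * \int[@lam2 R]_x f x.
Proof.
move=> mf f0 c0.
exact: (ge0_integralZl_EFin (@lam2 R) measurableT (fun z _ => f0 z) mf c0).
Qed.

Lemma lam2_indic (c : R) (A : set (R * R)) : measurable A -> (0 <= c)%R ->
  \int[@lam2 R]_x ((c * \1_A x)%:E) = c%:E * @lam2 R A.
Proof.
move=> mA c0; transitivity (\int[@lam2 R]_x (c%:E * (\1_A x)%:E)).
  by apply: eq_integral => x _; rewrite EFinM.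
rewrite lam2Zl//; last by apply/measurable_EFinP; exact: measurable_indic.
by rewrite integral_indic// setIT.
Qed.

End lam2_lemmas.

(** * Duality with the barrier and absorption of the supremum *)

Section sup_estimate.
Variables (R : realType) (Omega : set (R * R)) (L eps a : R).
Hypotheses (mOmega : measurable Omega) (L0 : 0 < L).
Hypothesis HD : forall x y, Omega x -> Omega y -> dot (x - y) (x - y) <= L ^+ 2.
Hypothesis finOmega : (@lam2 R Omega < +oo)%E.
Hypotheses (eps0 : 0 < eps) (a0 : 0 < a) (a1 : a <= 1).

Lemma bwidth_sqr : bwidth eps a ^+ 2 = 36 / a ^+ 2 * eps ^+ 2.
Proof. by rewrite /bwidth; field; rewrite gt_eqF. Qed.

Lemma powRB1 (q : R) : 0 < q -> q `^ (a - 1) = q `^ a / q.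
Proof.
move=> q0; rewrite powRD ?powRN ?powRr1 ?ltW//.
by apply/implyP => _; rewrite gt_eqF.
Qed.

Lemma eps_le_bdist (y x : R * R) : a ^+ 2 * eps ^+ 2 <= bdist eps a y x /\
  eps ^+ 2 <= bdist eps a y x /\
  bdist eps a y x <= 36 / a ^+ 2 * (eps ^+ 2 + dot (x - y) (x - y)).
Proof.
rewrite /bdist bwidth_sqr.
have e2 : 0 < eps ^+ 2 by rewrite exprn_gt0.
have aa : 0 < a ^+ 2 by rewrite exprn_gt0.
have aa1 : a ^+ 2 <= 1 by rewrite expr_le1// ltW.
have d0 := dot_ge0 (x - y).
have c1 : 1 <= 36 / a ^+ 2 by rewrite ler_pdivlMr// mul1r (le_trans aa1)// ler1n.
have h1 : 1 * eps ^+ 2 <= 36 / a ^+ 2 * eps ^+ 2 by rewrite ler_pM2r.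
have h2 : 1 * dot (x - y) (x - y) <= 36 / a ^+ 2 * dot (x - y) (x - y) by rewrite ler_wpM2r.
have h3 : a ^+ 2 * eps ^+ 2 <= 1 * eps ^+ 2 by rewrite ler_pM2r.
by split; [|split]; lra.
Qed.

(** The source never exceeds the power subtracted, because a^2 eps^2 <= [bdist]. *)
Lemma barrier_le (y x : R * R) : barrier L eps a y x <= bheight L eps a.
Proof.
rewrite /barrier /bsource powRB1 ?bdist_gt0//.
have [h _] := eps_le_bdist y x.
have q0 := bdist_gt0 eps0 a0 y x.
suff : a ^+ 2 * eps ^+ 2 * (bdist eps a y x `^ a / bdist eps a y x) <= bdist eps a y x `^ a by lra.
rewrite mulrA ler_pdivrMr// mulrC ler_wpM2l// powR_ge0//.
Qed.

(** The factor by which [bsource] dominates [eta]: one a^2 is that of the source, the other, with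
    the 36, comes from the width 6 eps / a. For a = 1/(2m) the power is eps^(1/m). *)
Definition smoothing : R := a ^+ 4 / 36 * (eps ^+ 2) `^ a.

Lemma smoothing_gt0 : 0 < smoothing.
Proof. by rewrite !mulr_gt0 ?exprn_gt0 ?invr_gt0// powR_gt0// exprn_gt0. Qed.

Lemma eta_le_bsource (y x : R * R) : smoothing * eta eps y x <= bsource eps a y x.
Proof.
have [_ [h1 h2]] := eps_le_bdist y x.
have q0 := bdist_gt0 eps0 a0 y x.
have r0 := eta_den_gt0 eps0 y x.
rewrite /bsource /smoothing /eta powRB1// [leRHS]mulrA ler_pdivlMr//.
have e2 : 0 < eps ^+ 2 by rewrite exprn_gt0.
have p : (eps ^+ 2) `^ a <= bdist eps a y x `^ a.
  by rewrite ge0_ler_powR ?nnegrE// ?ltW.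
rewrite (_ : _ * bdist eps a y x = (a ^+ 4 / 36 * eps ^+ 2 / (eps ^+ 2 + dot (x - y) (x - y)) * bdist eps a y x) * (eps ^+ 2) `^ a); last by field; rewrite gt_eqF.
apply: ler_pM => //; rewrite ?powR_ge0//.
  by rewrite !mulr_ge0 ?invr_ge0 ?exprn_ge0 ?(ltW q0) ?(ltW r0) ?(ltW a0)// ltW.
rewrite mulrAC ler_pdivrMr//.
apply: (@le_trans _ _ (a ^+ 4 / 36 * eps ^+ 2 * (36 / a ^+ 2 * (eps ^+ 2 + dot (x - y) (x - y))))).
  by rewrite ler_wpM2l// !mulr_ge0 ?invr_ge0 ?exprn_ge0 ?(ltW a0)// ltW.
rewrite le_eqVlt; apply/orP; left; apply/eqP; field; exact: lt0r_neq0.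
Qed.

Variables (alpha G : R * R -> R) (N F g : R).
Hypotheses (malpha : measurable_fun [set: R * R] alpha) (mG : measurable_fun [set: R * R] G)
  (aN : forall x, 0 <= alpha x <= N) (GF : forall x, 0 <= G x <= F)
  (aO : forall x, ~ Omega x -> alpha x = 0).
Hypothesis sub : forall x, Omega x -> ((alpha x)%:E <= (G x)%:E + scatter eps (-1) (EFin \o alpha) x)%E.
Hypothesis Gg : (\int[@lam2 R]_x (G x)%:E <= g%:E)%E.
Local Open Scope ereal_scope.

Let A : R * R -> \bar R := EFin \o alpha.
Let mA : measurable_fun [set: R * R] A. Proof. exact/measurable_EFinP. Qed.
Let A0 x : 0 <= A x. Proof. by rewrite lee_fin; have /andP[] := aN x. Qed.
Let mGE : measurable_fun [set: R * R] (EFin \o G). Proof. exact/measurable_EFinP. Qed.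
Let G0 x : 0 <= (G x)%:E. Proof. by rewrite lee_fin; have /andP[] := GF x. Qed.
Let mS := measurable_scatter eps0 (-1) mA A0.
Let S0 y : 0 <= scatter eps (-1) A y := scatter_ge0 eps0 (-1) y A0.

Lemma bheight_gt0 : (0 < bheight L eps a)%R.
Proof.
rewrite /bheight; have := sqr_ge0 L; have := sqr_ge0 (bwidth eps a); lra.
Qed.

(** Test alpha <= G + K alpha against the truncated barrier [W]. By duality the integral of W K
    alpha is the integral [X] of alpha against the adjoint applied to [W], and [scatter_barrier]
    bounds that function by [W] minus the source. The two occurrences of [X] cancel and the source
    term remains. *)
Lemma integral_bsource_le y : Omega y ->
  \int[@lam2 R]_x (bsource eps a y x * alpha x)%:E <= (bheight L eps a * g)%:E.
Proof.
move=> Oy.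
have bh0 := ltW bheight_gt0.
pose W z : \bar R := (\1_Omega z * barrier L eps a y z)%:E.
have mW : measurable_fun [set: R * R] W := measurable_barrier _ _ _ mOmega y.
have W0 z : 0 <= W z by rewrite lee_fin indic_barrier_ge0.
have WH z : W z <= (bheight L eps a)%:E.
  rewrite lee_fin indicE; case: (z \in Omega); rewrite ?mul1r ?mul0r//.
  exact: barrier_le.
have mSW := measurable_scatter eps0 1 mW W0.
have SW0 z : 0 <= scatter eps 1 W z := scatter_ge0 eps0 1 z W0.
have ms : measurable_fun [set: R * R] (fun x => (bsource eps a y x * alpha x)%:E).
  by apply/measurable_EFinP; apply: measurable_funM => //; exact: measurable_bsource.
have s0 z : 0 <= (bsource eps a y z * alpha z)%:E.
  by rewrite lee_fin mulr_ge0 ?(ltW (bsource_gt0 _ _ _ _))//; have /andP[] := aN z.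
set S := \int[_]_x _.
pose X := \int[@lam2 R]_z (A z * scatter eps 1 W z).
have mAS : measurable_fun [set: R * R] (fun z => A z * scatter eps 1 W z).
  exact: emeasurable_funM.
have AS0 z : 0 <= A z * scatter eps 1 W z by rewrite mule_ge0.
have mWA : measurable_fun [set: R * R] (fun z => W z * A z) by exact: emeasurable_funM.
have WA0 z : 0 <= W z * A z by rewrite mule_ge0.
have mWG : measurable_fun [set: R * R] (fun z => W z * (G z)%:E) := emeasurable_funM mW mGE.
have mWS : measurable_fun [set: R * R] (fun z => W z * scatter eps (-1) A z) := emeasurable_funM mW mS.
have WG0 z : 0 <= W z * (G z)%:E by rewrite mule_ge0.
have WS0 z : 0 <= W z * scatter eps (-1) A z by rewrite mule_ge0.
have X0 : 0 <= X by exact: integral_ge0.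
have S00 : 0 <= S by exact: integral_ge0.
have le1 : X + S <= \int[@lam2 R]_z (W z * A z).
  rewrite -[leLHS](lam2D mAS ms AS0 s0); apply: (lam2_le (emeasurable_funD mAS ms) mWA).
    by move=> z; exact: adde_ge0.
  move=> z; have [Oz|nOz] := pselect (Omega z); last first.
    by rewrite /A/= aO// mulr0 mule0 mul0e adde0.
  rewrite [W z * _]muleC EFinM [(bsource _ _ _ _)%:E * _]muleC -[(alpha z)%:E]/(A z) -ge0_muleDr//.
    rewrite lee_wpmul2l// [leRHS]/W indicE mem_set// mul1r.
    exact: scatter_barrier.
  by rewrite lee_fin ltW// bsource_gt0.
have le2 : \int[@lam2 R]_z (W z * A z) <= \int[@lam2 R]_z (W z * (G z)%:E) + X.
  have -> : X = \int[@lam2 R]_z (W z * scatter eps (-1) A z).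
    by rewrite (scatter_duality eps0 (-1) mA mW A0 W0) opprK.
  rewrite -[leRHS](lam2D mWG mWS WG0 WS0).
  apply: (lam2_le mWA (emeasurable_funD mWG mWS) WA0) => z; rewrite -ge0_muleDr//.
  have [Oz|nOz] := pselect (Omega z); first by rewrite lee_wpmul2l// sub.
  by rewrite /W indicE memNset// mul0r !mul0e.
have le3 : \int[@lam2 R]_z (W z * (G z)%:E) <= (bheight L eps a * g)%:E.
  have mHG : measurable_fun [set: R * R] (fun z => (bheight L eps a)%:E * (G z)%:E).
    exact: measurable_funeM.
  apply: (@le_trans _ _ (\int[@lam2 R]_z ((bheight L eps a)%:E * (G z)%:E))).
    by apply: (lam2_le mWG mHG WG0) => z; rewrite lee_wpmul2r.
  rewrite [leLHS](lam2Zl mGE G0 bh0).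
  by rewrite [leRHS]EFinM lee_wpmul2l// lee_fin.
(* Cancelling [X] in the extended reals requires it to be finite; boundedness of alpha and the
   finite area of [Omega] give this. *)
have Xfin : X < +oo.
  apply: (@le_lt_trans _ _ (\int[@lam2 R]_z (W z * A z))).
    by rewrite (le_trans _ le1)// leeDl.
  have N0 : (0 <= N)%R by have /andP[/le_trans] := aN (0,0)%R; exact.
  have bN : (0 <= bheight L eps a * N)%R by rewrite mulr_ge0.
  apply: (@le_lt_trans _ _ ((bheight L eps a * N)%:E * @lam2 R Omega)); last first.
    by rewrite lte_mul_pinfty.
  rewrite -(lam2_indic mOmega bN); apply: (lam2_le mWA _ WA0) => [|z].
    by apply/measurable_EFinP; apply: measurable_funM => //; exact: measurable_indic.
  have [Oz|nOz] := pselect (Omega z); last first.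
    by rewrite /A/= aO// mule0 lee_fin mulr_ge0.
  rewrite indicE mem_set// mulr1 EFinM lee_pmul// lee_fin.
  by have /andP[] := aN z.
have := le_trans le1 le2; rewrite addeC leeD2rE ?ge0_fin_numE//.
by move=> /le_trans; apply.
Qed.

Lemma integral_eta_le y : Omega y ->
  \int[@lam2 R]_x (eta eps y x * alpha x)%:E <= (smoothing^-1 * (bheight L eps a * g))%:E.
Proof.
move=> Oy; have s0 := smoothing_gt0.
have ms : measurable_fun [set: R * R] (fun x => (bsource eps a y x * alpha x)%:E).
  by apply/measurable_EFinP; apply: measurable_funM => //; exact: measurable_bsource.
have bs0 x : 0 <= (bsource eps a y x * alpha x)%:E.
  by rewrite lee_fin mulr_ge0 ?(ltW (bsource_gt0 _ _ _ _))//; have /andP[] := aN x.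
have si0 : (0 <= smoothing^-1)%R by rewrite invr_ge0 ltW.
apply: (@le_trans _ _ (\int[@lam2 R]_x ((smoothing^-1)%:E * (bsource eps a y x * alpha x)%:E))).
  apply: lam2_le.
  - by apply/measurable_EFinP; apply: measurable_funM => //; exact: measurable_eta.
  - exact: measurable_funeM.
  - by move=> x; rewrite lee_fin mulr_ge0 ?eta_ge0//; have /andP[] := aN x.
  - move=> x; rewrite -EFinM lee_fin mulrA ler_wpM2r//.
      by have /andP[] := aN x.
    by rewrite ler_pdivlMl// eta_le_bsource.
rewrite [leLHS](lam2Zl ms bs0 si0) [leRHS]EFinM lee_wpmul2l ?lee_fin//.
exact: integral_bsource_le.
Qed.

(** Inserting the inequality into itself gives alpha <= 2 F + K^2 alpha, as constants are fixed by
    [K]. The two-flight bound then reads N' <= 2 F + N'/2 + 4 eps^-2 e, and absorbing N'/2 doubles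
    the constants. *)
Lemma sup_estimate x :
  (alpha x <= 4 * F + 8 * eps ^- 2 * (smoothing^-1 * (bheight L eps a * g)))%R.
Proof.
set e := (smoothing^-1 * _)%R.
have s0 := smoothing_gt0.
have g0 : (0 <= g)%R by rewrite -lee_fin (le_trans _ Gg)//; exact: integral_ge0.
have e0 : (0 <= e)%R by rewrite mulr_ge0 ?invr_ge0 ?(ltW s0)// mulr_ge0// ltW// bheight_gt0.
have F0 : (0 <= F)%R by have /andP[/le_trans] := GF (0,0)%R; exact.
have ce : (0 <= 4 * eps ^- 2 * e)%R.
  by apply: mulr_ge0 => //; apply: mulr_ge0 => //; rewrite invr_ge0 sqr_ge0.
have sr : has_sup (range alpha).
  split; first by exists (alpha (0, 0)%R); exists (0, 0)%R.
  by exists N => _ [z _ <-]; have /andP[] := aN z.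
(* The bound [N] only makes this supremum finite; absorption works for the exact supremum and not
   for a mere upper bound. *)
pose N' := sup (range alpha).
have aN' z : (0 <= alpha z <= N')%R.
  by have /andP[-> _] := aN z; apply: ub_le_sup; [exact: sr.2|exists z].
have N'0 : (0 <= N')%R by have /andP[/le_trans] := aN' (0,0)%R; exact.
suff H : (N' <= 2 * F + N' / 2 + 4 * eps ^- 2 * e)%R.
  have /andP[_ /le_trans] := aN' x; apply; lra.
apply: ge_sup; first exact: sr.1.
move=> _ [z _ <-].
have [Oz|nOz] := pselect (Omega z); last first.
  by rewrite aO//; lra.
rewrite -lee_fin; apply: (le_trans (sub Oz)).
have AG z' : A z' <= (F%:E + scatter eps (-1) A z').
  have [Oz'|nOz'] := pselect (Omega z'); last first.
    by rewrite /A/= aO// adde_ge0// lee_fin.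
  apply: (le_trans (sub Oz')); rewrite leeD2r// lee_fin.
  by have /andP[] := GF z'.
have mFS : measurable_fun [set: R * R] (fun z' => F%:E + scatter eps (-1) A z').
  exact: emeasurable_funD.
have step : scatter eps (-1) A z <= F%:E + scatter eps (-1) (scatter eps (-1) A) z.
  apply: (le_trans (scatter_le eps0 (-1) z mA mFS A0 _ AG)).
    by move=> z'; rewrite adde_ge0// lee_fin.
  rewrite (scatterD eps0 (-1) z (measurable_cst F%:E) mS)//.
  by rewrite scatter_cst.
have := double_scatter_le eps0 malpha aN' e0 (integral_eta_le Oz) => ds.
apply: (@le_trans _ _ (F%:E + (F%:E + (N' / 2 + 4 * eps ^- 2 * e)%:E))).
  apply: leeD; first by rewrite lee_fin; have /andP[] := GF z.
  by apply: (le_trans step); rewrite leeD2l.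
by rewrite -!EFinD lee_fin; lra.
Qed.

End sup_estimate.

(** * Nonnegative data *)

Section nonneg_solution.
Variables (R : realType) (Omega : set (R * R)) (L eps : R).
Hypotheses (Omega_open : open Omega) (Omega_convex : convex_set Omega).
Hypotheses (Omega_bounded : bounded_set Omega) (Omega_C3 : C3_boundary Omega).
Hypotheses (L0 : 0 < L).
Hypothesis HD : forall x y, Omega x -> Omega y -> dot (x - y) (x - y) <= L ^+ 2.
Hypothesis eps0 : 0 < eps.

Let mOmega : measurable Omega := measurable_Omega Omega_open.

Lemma chord_le x y w s : Omega x -> Omega y -> S1 w -> y = x + s *: w -> `|s| <= L.
Proof.
move=> Ox Oy /S1P w1 yE; have := HD Oy Ox; rewrite yE [x + _]addrC addrK.
rewrite dotZl dotC dotZl w1 mulr1 -expr2 -[s ^+ 2]real_normK ?num_real//.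
by rewrite ler_pXn2r ?nnegrE// ltW.
Qed.

Let D : set ((R * R) * (R * R)) := Omega `*` @S1 R.
Let mD : measurable D := measurable_phase Omega_open.

Variable h : (R * R) * (R * R) -> R.
Variable H : R.
Hypotheses (mh : measurable_fun (Gamma_minus Omega) h)
  (hH : forall z, Gamma_minus Omega z -> 0 <= h z <= H) (H0 : 0 <= H).

Definition inflow : (R * R) * (R * R) -> R :=
  (fun z => expR (- eps^-1 * exit_time Omega z.1 z.2) *
    h (z.1 - exit_time Omega z.1 z.2 *: z.2, z.2)) \_ (Omega `*` @S1 R).

Lemma inflowE x w : Omega x -> S1 w -> inflow (x, w) =
  expR (- eps^-1 * exit_time Omega x w) * h (x - exit_time Omega x w *: w, w).
Proof. by move=> Ox w1; rewrite /inflow patchE mem_set. Qed.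

Lemma measurable_inflow : measurable_fun [set: (R * R) * (R * R)] inflow.
Proof.
pose e : (R * R) * (R * R) -> R := (fun z => exit_time Omega z.1 z.2) \_ (Omega `*` @S1 R).
have me : measurable_fun [set: (R * R) * (R * R)] e.
  apply/(measurable_restrictT _ _).1 => //.
  exact: measurable_exit_time Omega_open Omega_convex Omega_bounded.
apply/(measurable_restrictT _ _).1 => //.
apply: (eq_measurable_fun (fun z => expR (- eps^-1 * e z) * h (z.1 - e z *: z.2, z.2))).
  by move=> z Dz; rewrite /e patchE Dz.
apply: measurable_funM.
  apply: measurable_funTS; apply: measurableT_comp; first exact: measurable_expR.
  by apply: measurable_funM => //; exact: measurable_cst.
apply: (@measurable_comp _ _ _ _ _ _ (Gamma_minus Omega)) => //.
- exact: measurable_Gamma_minus.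
- move=> _ [[x w] [/= Ox w1] <-]; rewrite /e patchE mem_set//=.
  exact: exit_Gamma_minus.
by apply: measurable_funTS; msolve.
Qed.

Lemma inflow_ge0 z : 0 <= inflow z.
Proof.
rewrite /inflow patchE; case: ifPn => //; case: z => x w; rewrite inE => -[/= Ox w1].
rewrite mulr_ge0 ?expR_ge0//.
by have /andP[] := hH (exit_Gamma_minus Omega_open Omega_convex Omega_bounded Omega_C3 Ox w1).
Qed.

Local Open Scope ereal_scope.

(** A backward flight either reaches the boundary before time [t], with probability exp(-t/eps), or
    ends inside; the two probabilities add up to one. Thus the constant [H] is a supersolution, and
    the inflow enters the final bound with coefficient one. *)
Lemma inflow_flight_le x w : Omega x -> S1 w ->
  (inflow (x, w))%:E + H%:E * flight eps (-1) (fun z => (\1_Omega z.1)%:E) (x, w) <= H%:E.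
Proof.
move=> Ox w1; set t := exit_time Omega x w.
have t0 : (0 < t)%R by exact: exit_time_gt0.
apply: (@le_trans _ _ ((H * expR (- eps^-1 * t))%:E + (H * (1 - expR (- eps^-1 * t)))%:E)).
  apply: leeD.
    rewrite lee_fin inflowE// mulrC ler_wpM2r ?expR_ge0//.
    by have /andP[] := hH (exit_Gamma_minus Omega_open Omega_convex Omega_bounded Omega_C3 Ox w1).
  rewrite EFinM lee_wpmul2l ?lee_fin//; apply: flight_indic_le => // s s0.
  by rewrite mulN1r scaleNr => /(exit_timeP Omega_open Omega_convex Omega_bounded Ox w1 s0)/ltW.
by rewrite -EFinD lee_fin; lra.
Qed.

Lemma inflow_le z : (inflow z <= H)%R.
Proof.
have [[Ox w1]|nD] := pselect (D z); last by rewrite /inflow patchE memNset.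
rewrite -lee_fin; apply: le_trans (inflow_flight_le Ox w1).
rewrite -surjective_pairing leeDl// mule_ge0//.
by apply: flight_ge0 => // ?; rewrite lee_fin.
Qed.

Variable f : (R * R) * (R * R) -> R.
Variables F : R.
Hypotheses (mf : measurable_fun [set: (R * R) * (R * R)] f)
  (fF : forall z, (0 <= f z <= F)%R) (fD : forall z, ~ D z -> f z = 0%R).

Let mfE : measurable_fun [set: (R * R) * (R * R)] (EFin \o f).
Proof. exact/measurable_EFinP. Qed.
Let fE0 z : 0 <= (EFin \o f) z. Proof. by rewrite lee_fin; have /andP[] := fF z. Qed.
Let F0 : (0 <= F)%R. Proof. by have /andP[/le_trans] := fF ((0, 0), (0, 0))%R; exact. Qed.
Let Tf := flight eps (-1) (EFin \o f).
Let mTf : measurable_fun [set: (R * R) * (R * R)] Tf := measurable_flight eps0 (-1) mfE fE0.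
Let Tf0 z : 0 <= Tf z := flight_ge0 eps0 (-1) fE0 z.
Let TfF z : Tf z <= F%:E.
Proof.
rewrite -(flight_cst eps0 (-1) z F0); apply: flight_le => //.
by move=> s _; rewrite lee_fin; have /andP[] := fF (z.1 + (-1 * s) *: z.2, z.2)%R.
Qed.

Let Sf : R * R -> \bar R := fun x => avg (fun w => Tf (x, w)).
Let mSf : measurable_fun [set: R * R] Sf := measurable_avg mTf Tf0.
Let Sf0 x : 0 <= Sf x. Proof. by apply: avg_ge0 => w. Qed.
Let SfF x : Sf x <= F%:E.
Proof.
rewrite -(avg_cst F0); apply: avg_le => //.
exact: (measurableT_comp mTf (pair1_measurable x)).
Qed.

Let Bf : R * R -> \bar R := fun x => avg (fun w => (inflow (x, w))%:E).
Let mBE : measurable_fun [set: (R * R) * (R * R)] (EFin \o inflow).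
Proof. by apply/measurable_EFinP; exact: measurable_inflow. Qed.
Let mBf : measurable_fun [set: R * R] Bf.
Proof. by apply: (measurable_avg mBE) => z; rewrite lee_fin inflow_ge0. Qed.
Let Bf0 x : 0 <= Bf x. Proof. by apply: avg_ge0 => w; rewrite lee_fin inflow_ge0. Qed.
Let BfH x : Bf x <= H%:E.
Proof.
rewrite -(avg_cst H0); apply: avg_le => //.
- exact: (measurableT_comp mBE (pair1_measurable x)).
- by move=> w; rewrite lee_fin inflow_ge0.
- by move=> w _; rewrite lee_fin inflow_le.
Qed.

Let finSf x : Sf x \is a fin_num.
Proof. by rewrite ge0_fin_numE// (le_lt_trans (SfF x))// ltry. Qed.
Let finBf x : Bf x \is a fin_num.
Proof. by rewrite ge0_fin_numE// (le_lt_trans (BfH x))// ltry. Qed.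

(** The whole right-hand side of eps w.grad u + u = f + v, once [v] is known. *)
Definition full_source (v : R * R -> R) (z : (R * R) * (R * R)) : R := (f z + v z.1)%R.

Let g x : R := (\1_Omega x * (fine (Bf x) + fine (Sf x)))%R.

Let mg : measurable_fun [set: R * R] g.
Proof.
apply: measurable_funM; first exact: measurable_indic.
by apply: measurable_funD; exact: measurableT_comp.
Qed.

Let gHF x : (0 <= g x <= H + F)%R.
Proof.
have b : (0 <= fine (Bf x) <= H)%R.
  by rewrite fine_ge0//= -lee_fin fineK.
have c : (0 <= fine (Sf x) <= F)%R.
  by rewrite fine_ge0//= -lee_fin fineK.
rewrite /g indicE; case: (_ \in _); rewrite ?mul1r ?mul0r; last by rewrite lexx addr_ge0.
by move: b c => /andP[? ?] /andP[? ?]; rewrite addr_ge0//= lerD.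
Qed.

Lemma exists_scalar_solution : exists v : R * R -> R,
  [/\ measurable_fun [set: R * R] v, exists K, forall x, (0 <= v x <= K)%R,
      forall x, ~ Omega x -> v x = 0%R &
      forall x, Omega x -> (v x)%:E = Bf x + Sf x + scatter eps (-1) (EFin \o v) x].
Proof.
have g0 x : ~ Omega x -> g x = 0%R by move=> nO; rewrite /g indicE memNset// mul0r.
have [v [mv vM v0 vE]] := exists_fixpoint eps0 mOmega L0 chord_le mg gHF g0.
exists v; split => //; first by eexists; exact: vM.
by move=> x Ox; rewrite vE// /g indicE mem_set// mul1r EFinD !fineK.
Qed.

Section with_v.
Variables (v : R * R -> R) (K : R).
Hypotheses (mv : measurable_fun [set: R * R] v) (vK : forall x, (0 <= v x <= K)%R)
  (v0 : forall x, ~ Omega x -> v x = 0%R)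
  (vE : forall x, Omega x -> (v x)%:E = Bf x + Sf x + scatter eps (-1) (EFin \o v) x).

Let mvE : measurable_fun [set: R * R] (EFin \o v). Proof. exact/measurable_EFinP. Qed.
Let vE0 x : 0 <= (EFin \o v) x. Proof. by rewrite lee_fin; have /andP[] := vK x. Qed.
Let mvf := measurable_fst_comp mvE.
Let vf0 (z : (R * R) * (R * R)) : 0 <= ((EFin \o v) \o fst) z. Proof. exact: vE0. Qed.
Let psi := full_source v.

Lemma measurable_full_source : measurable_fun [set: (R * R) * (R * R)] psi.
Proof. by apply: measurable_funD => //; exact: (measurableT_comp mv measurable_fst). Qed.

Lemma full_source_bound z : (0 <= psi z <= F + K)%R.
Proof.
have /andP[? ?] := fF z; have /andP[? ?] := vK z.1.
by rewrite /psi /full_source addr_ge0//= lerD.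
Qed.

Lemma full_source0 z : ~ Omega z.1 -> psi z = 0%R.
Proof. by move=> nO; rewrite /psi /full_source v0// addr0 fD// => -[]. Qed.

Let mpsi : measurable_fun [set: (R * R) * (R * R)] (EFin \o psi).
Proof. by apply/measurable_EFinP; exact: measurable_full_source. Qed.
Let psi0 z : 0 <= (EFin \o psi) z.
Proof. by rewrite lee_fin; have /andP[] := full_source_bound z. Qed.
Let Tpsi := flight eps (-1) (EFin \o psi).
Let Tpsi0 z : 0 <= Tpsi z := flight_ge0 eps0 (-1) psi0 z.
Let mTpsi : measurable_fun [set: (R * R) * (R * R)] Tpsi := measurable_flight eps0 (-1) mpsi psi0.
Let finTpsi z : Tpsi z \is a fin_num.
Proof.
have FK0 : (0 <= F + K)%R.
  by have /andP[/le_trans] := full_source_bound ((0, 0), (0, 0))%R; exact.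
rewrite ge0_fin_numE// (@le_lt_trans _ _ (F + K)%:E) ?ltry//.
rewrite -(flight_cst eps0 (-1) z FK0); apply: flight_le => //.
by move=> s _; rewrite lee_fin; have /andP[] := full_source_bound (z.1 + (-1 * s) *: z.2, z.2)%R.
Qed.

Let TpsiE z : Tpsi z = Tf z + flight eps (-1) ((EFin \o v) \o fst) z.
Proof. by rewrite /Tpsi -flightD//. Qed.

Definition solution : (R * R) * (R * R) -> R :=
  (fun z => inflow z + fine (flight eps (-1) (EFin \o full_source v) z))%R \_ (Omega `*` @S1 R).

Lemma solutionE z : D z -> (solution z)%:E = (inflow z)%:E + flight eps (-1) (EFin \o psi) z.
Proof. by move=> Dz; rewrite /solution patchE mem_set// EFinD fineK//; exact: finTpsi. Qed.

Lemma measurable_solution : measurable_fun [set: (R * R) * (R * R)] solution.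
Proof.
apply/(measurable_restrictT _ _).1 => //; apply: measurable_funTS.
apply: measurable_funD; first exact: measurable_inflow.
exact: measurableT_comp.
Qed.

Lemma solution0 z : ~ D z -> solution z = 0%R.
Proof. by move=> nD; rewrite /solution patchE memNset. Qed.

Lemma solution_ge0 z : (0 <= solution z)%R.
Proof.
have [Dz|nD] := pselect (D z); last by rewrite solution0.
rewrite -lee_fin solutionE//; apply: adde_ge0; first by rewrite lee_fin inflow_ge0.
exact: Tpsi0.
Qed.

(** Averaging the reconstructed function over directions gives the right-hand side of the scalar
    equation, so its velocity average is indeed the [v] it was built from. *)
Lemma avg_solution x : Omega x -> avg (fun w => (solution (x, w))%:E) = (v x)%:E.
Proof.
move=> Ox; rewrite vE//.
have mB1 := measurableT_comp mBE (pair1_measurable x).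
have mT1 := measurableT_comp mTf (pair1_measurable x).
have mV1 := measurable_flight_at eps0 (-1) x mvf vf0.
have B10 w : 0 <= (inflow (x, w))%:E by rewrite lee_fin inflow_ge0.
have V10 w : 0 <= flight eps (-1) ((EFin \o v) \o fst) (x, w) := flight_ge0 eps0 (-1) vf0 _.
have mBT : measurable_fun [set: R * R] (fun w => (inflow (x, w))%:E + Tf (x, w)).
  exact: emeasurable_funD.
have BT0 w : 0 <= (inflow (x, w))%:E + Tf (x, w) by rewrite adde_ge0.
have -> : Bf x + Sf x + scatter eps (-1) (EFin \o v) x = avg (fun w =>
   (inflow (x, w))%:E + Tf (x, w) + flight eps (-1) ((EFin \o v) \o fst) (x, w)).
  rewrite [RHS](avgD mBT mV1 BT0 V10); congr (_ + _).
  by rewrite [RHS](avgD mB1 mT1 B10 (fun w => Tf0 (x, w))).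
have eqS w : S1 w -> (solution (x, w))%:E =
    (inflow (x, w))%:E + Tf (x, w) + flight eps (-1) ((EFin \o v) \o fst) (x, w).
  by move=> w1; rewrite solutionE// -addeA -TpsiE.
have ms : measurable_fun [set: R * R] (fun w => (solution (x, w))%:E).
  apply/measurable_EFinP; exact: (measurableT_comp measurable_solution (pair1_measurable x)).
have s0 w : 0 <= (solution (x, w))%:E by rewrite lee_fin solution_ge0.
have mBTV : measurable_fun [set: R * R] (fun w => (inflow (x, w))%:E + Tf (x, w) +
  flight eps (-1) ((EFin \o v) \o fst) (x, w)) by exact: emeasurable_funD.
have BTV0 w : 0 <= (inflow (x, w))%:E + Tf (x, w) +
  flight eps (-1) ((EFin \o v) \o fst) (x, w) by rewrite adde_ge0.
apply/eqP; rewrite eq_le; apply/andP; split; apply: avg_le => // w w1; by rewrite eqS.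
Qed.

Variables (a fl : R).
Hypotheses (a0 : (0 < a)%R) (a1 : (a <= 1)%R).
Hypothesis ffl : \int[@phase_measure R]_z (f z)%:E <= fl%:E.
Hypothesis finOmega : @lam2 R Omega < +oo.

Let alpha x : R := Num.max 0%R (v x - H * \1_Omega x)%R.
Let G x : R := (\1_Omega x * fine (Sf x))%R.

Let malpha : measurable_fun [set: R * R] alpha.
Proof.
apply: measurable_maxr; first exact: measurable_cst.
apply: measurable_funB => //; apply: measurable_funM; first exact: measurable_cst.
exact: measurable_indic.
Qed.

Let alphaK x : (0 <= alpha x <= K)%R.
Proof.
have /andP[v0' vK'] := vK x; have K0 := le_trans v0' vK'.
have : (0 <= H * \1_Omega x)%R by rewrite mulr_ge0.
by rewrite /alpha le_max lexx/= ge_max K0/=; lra.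
Qed.

Let alpha0 x : ~ Omega x -> alpha x = 0%R.
Proof.
by move=> nO; rewrite /alpha v0// indicE memNset// mulr0 subrr maxxx.
Qed.

Let mG : measurable_fun [set: R * R] G.
Proof. by apply: measurable_funM; [exact: measurable_indic|exact: measurableT_comp]. Qed.

Let GF x : (0 <= G x <= F)%R.
Proof.
have c : (0 <= fine (Sf x) <= F)%R by rewrite fine_ge0//= -lee_fin fineK.
by rewrite /G indicE; case: (_ \in _); rewrite ?mul1r ?mul0r ?lexx.
Qed.

Let malE : measurable_fun [set: R * R] (EFin \o alpha). Proof. exact/measurable_EFinP. Qed.
Let alE0 x : 0 <= (EFin \o alpha) x. Proof. by rewrite lee_fin; have /andP[] := alphaK x. Qed.
Let mI := measurable_indic_Omega mOmega.
Let mHI : measurable_fun [set: R * R] (fun x => H%:E * (\1_Omega x : R)%:E).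
Proof. exact: measurable_funeM. Qed.
Let HI0 x : 0 <= H%:E * (\1_Omega x : R)%:E. Proof. by rewrite mule_ge0. Qed.

Let v_le x : (EFin \o v) x <= (EFin \o alpha) x + H%:E * (\1_Omega x : R)%:E.
Proof.
rewrite -EFinM -EFinD lee_fin /alpha -lerBlDr.
by rewrite le_max lexx orbT.
Qed.

Let flight_v_le z : flight eps (-1) ((EFin \o v) \o fst) z <=
  flight eps (-1) ((EFin \o alpha) \o fst) z +
  H%:E * flight eps (-1) (fun z => (\1_Omega z.1)%:E) z.
Proof.
have mfa := measurable_fst_comp malE; have mfi := measurable_fst_comp mI.
have mfh := measurable_fst_comp mHI.
have fa0 (y : (R * R) * (R * R)) : 0 <= ((EFin \o alpha) \o fst) y := alE0 _.
have fi0 (y : (R * R) * (R * R)) : 0 <= (\1_Omega y.1 : R)%:E by rewrite lee_fin.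
have fh0 (y : (R * R) * (R * R)) : 0 <= H%:E * (\1_Omega y.1 : R)%:E by rewrite mule_ge0.
rewrite -[X in _ + X](flightZ eps0 (-1) z mfi fi0 H0).
rewrite -[leRHS](flightD eps0 (-1) z mfa mfh fa0 fh0).
apply: (flight_le eps0 mvf (emeasurable_funD mfa mfh) vf0) => [y|s _]; last exact: v_le.
by apply: adde_ge0; [exact: fa0|exact: fh0].
Qed.

(** Since v <= alpha + H on [Omega] and the average of [inflow_flight_le] says that [Bf] plus [K]
    applied to H times the indicator is at most H, the boundary term cancels against the subtracted
    constant and only [Sf] remains as a source. *)
Let alpha_sub x : Omega x ->
  (alpha x)%:E <= (G x)%:E + scatter eps (-1) (EFin \o alpha) x.
Proof.
move=> Ox.
have GE : (G x)%:E = Sf x by rewrite /G indicE mem_set// mul1r fineK.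
have Sa0 := scatter_ge0 eps0 (-1) x alE0.
have SI0 : 0 <= scatter eps (-1) (fun x => (\1_Omega x : R)%:E) x.
  by apply: (scatter_ge0 eps0) => y; rewrite lee_fin.
suff : (v x - H)%:E <= (G x)%:E + scatter eps (-1) (EFin \o alpha) x.
  move=> vH; rewrite /alpha indicE mem_set// mulr1 EFin_max ge_max vH andbT.
  by apply: adde_ge0; [rewrite GE; exact: Sf0|exact: Sa0].
have BH : Bf x + H%:E * scatter eps (-1) (fun x => (\1_Omega x : R)%:E) x <= H%:E.
  have mi1 := measurable_flight_at eps0 (-1) x (measurable_fst_comp mI)
    (fun z => (_ : 0 <= ((fun x => (\1_Omega x : R)%:E) \o fst) z)).
  have I10 w : 0 <= flight eps (-1) ((fun x => (\1_Omega x : R)%:E) \o fst) (x, w).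
    by apply: flight_ge0 => // y; rewrite lee_fin.
  have {}mi1 : measurable_fun [set: R * R] (fun w => flight eps (-1) ((fun x => (\1_Omega x : R)%:E) \o fst) (x, w)).
    by apply: mi1 => y; rewrite lee_fin.
  have mB1 := measurableT_comp mBE (pair1_measurable x).
  have B10 w : 0 <= (inflow (x, w))%:E by rewrite lee_fin inflow_ge0.
  rewrite -(avgZ mi1 I10 H0) -[leLHS](avgD mB1 (measurable_funeM _ mi1) B10); last first.
    by move=> w; rewrite mule_ge0.
  rewrite -[leRHS](avg_cst H0); apply: avg_le => //.
  - by apply: emeasurable_funD => //; exact: measurable_funeM.
  - by move=> w; apply: adde_ge0; [exact: B10|apply: mule_ge0; [rewrite lee_fin|exact: I10]].
  - by move=> w w1; exact: inflow_flight_le.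
have Sv : scatter eps (-1) (EFin \o v) x <= scatter eps (-1) (EFin \o alpha) x +
    H%:E * scatter eps (-1) (fun x => (\1_Omega x : R)%:E) x.
  have I0' (y : R * R) : 0 <= (\1_Omega y : R)%:E by rewrite lee_fin.
  rewrite -(scatterZ eps0 (-1) x mI I0' H0).
  rewrite -[leRHS](scatterD eps0 (-1) x malE mHI alE0 HI0).
  apply: (scatter_le eps0 (-1) x mvE (emeasurable_funD malE mHI) vE0) => y.
    by rewrite adde_ge0.
  exact: v_le.
rewrite EFinB leeBlDr// (vE Ox) GE.
apply: (le_trans (leeD2l _ Sv)).
rewrite [Bf x + Sf x]addeC -!addeA leeD2l// addeCA leeD2l//.
Qed.

(** Flights conserve mass: the dual flight of the constant 1 is 1. The factor is that of the
    direction average. *)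
Let G_integral : \int[@lam2 R]_x (G x)%:E <= ((2 * pi)^-1 * fl)%:E.
Proof.
apply: (@le_trans _ _ (\int[@lam2 R]_x (1 * Sf x))).
  apply: lam2_le.
  - exact/measurable_EFinP.
  - exact: measurable_funeM.
  - by move=> x; rewrite lee_fin; have /andP[] := GF x.
  - move=> x; rewrite mul1e /G indicE; case: (_ \in _); rewrite ?mul1r ?mul0r ?fineK//.
have mone : measurable_fun [set: R * R] (cst (1 : \bar R)) by exact: measurable_cst.
rewrite (phase_avg mTf Tf0 mone)//= EFinM lee_wpmul2l ?avg_coef_ge0//.
apply: le_trans ffl; rewrite le_eqVlt; apply/orP; left; apply/eqP.
have mone' : measurable_fun [set: (R * R) * (R * R)] (cst (1 : \bar R)) by exact: measurable_cst.
rewrite [LHS](flight_duality eps0 (-1) mfE mone' fE0)//.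
by apply: eq_integral => z _; rewrite (flight_cst eps0)// mul1e.
Qed.

(** In u = B + T f + T v, the terms B and H times the flight of the indicator add up to at most H, T
    f contributes F, and T alpha contributes 4 F + E by [sup_estimate]; hence the 5. *)
Lemma solution_le z : (solution z <= H + (5 * F + 8 * eps ^- 2 *
  ((smoothing eps a)^-1 * (bheight L eps a * ((2 * pi)^-1 * fl)))))%R.
Proof.
have est := sup_estimate mOmega L0 HD finOmega eps0 a0 a1 malpha mG alphaK GF alpha0
  alpha_sub G_integral.
set E := (8 * _ * _)%R in est *.
have c0 : (0 <= 4 * F + E)%R.
  by have /andP[al0 _] := alphaK (0, 0)%R; exact: (le_trans al0 (est _)).
have [Dz|nD] := pselect (D z); last first.
  by rewrite solution0//; move: c0 F0 H0; clearbody E; lra.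
move: z Dz => [x w] [/= Ox w1].
rewrite -lee_fin solutionE// [flight _ _ _ _]TpsiE.
have Ta : flight eps (-1) ((EFin \o alpha) \o fst) (x, w) <= (4 * F + E)%:E.
  rewrite -(flight_cst eps0 (-1) (x, w) c0); apply: flight_le => //.
  - exact: measurable_fst_comp.
  - by move=> y; exact: alE0.
  - by move=> s _; rewrite lee_fin; exact: est.
apply: (@le_trans _ _ ((inflow (x, w))%:E + (F%:E + ((4 * F + E)%:E +
   H%:E * flight eps (-1) (fun z => (\1_Omega z.1)%:E) (x, w))))).
  rewrite leeD2l// leeD//; apply: (le_trans (flight_v_le _)).
  by rewrite leeD2r.
rewrite addeA addeCA.
apply: (@le_trans _ _ ((4 * F + E)%:E + (F%:E + H%:E))).
  rewrite leeD2l// [(inflow _)%:E + _]addeC -addeA leeD2l//.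
  exact: inflow_flight_le.
by rewrite -!EFinD lee_fin; lra.
Qed.

End with_v.
End nonneg_solution.

(** * Regularity along characteristics *)

Section flow.
Variable R : realType.
Local Open Scope ereal_scope.

Definition flow (t : R) (z : (R * R) * (R * R)) : (R * R) * (R * R) :=
  (z.1 + t *: z.2, z.2)%R.

Lemma flowD s t z : flow s (flow t z) = flow (t + s)%R z.
Proof. by rewrite /flow/= -addrA -scalerDl. Qed.

Lemma flow0 z : flow 0 z = z.
Proof. by rewrite /flow scale0r addr0 -surjective_pairing. Qed.

Lemma measurable_flow_joint : measurable_fun [set: ((R * R) * (R * R)) * R]
  (fun p => flow p.2 p.1).
Proof.
apply: measurable_fun_pair; last exact: (measurableT_comp measurable_snd measurable_fst).
by msolve.
Qed.

Lemma measurable_flow_time z : measurable_fun [set: R] (fun t => flow t z).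
Proof. exact: (measurableT_comp measurable_flow_joint (pair1_measurable z)). Qed.

Variable N : set ((R * R) * (R * R)).
Hypothesis mN : measurable N.

Let ind (z : (R * R) * (R * R)) : \bar R := (\1_N z)%:E.
Let mind : measurable_fun [set: (R * R) * (R * R)] ind.
Proof. by apply/measurable_EFinP; exact: measurable_indic. Qed.
Let ind0 z : 0 <= ind z. Proof. by rewrite lee_fin. Qed.

Lemma measurable_flow_preimage z : measurable ((fun t => flow t z) @^-1` N).
Proof. by rewrite -[X in measurable X]setTI; exact: measurable_flow_time. Qed.

Let sojourn z := \int[lebesgue_measure]_t ind (flow t z).

Let sojournE z : sojourn z = lebesgue_measure ((fun t => flow t z) @^-1` N).
Proof.
have := @integral_indic _ _ R (@lebesgue_measure R) setT measurableT _ (measurable_flow_preimage z).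
by rewrite setIT.
Qed.

Lemma flow_exchange : \int[@phase_measure R]_z sojourn z =
  phase_measure N * lebesgue_measure [set: R].
Proof.
have mj : measurable_fun [set: ((R * R) * (R * R)) * R] (fun p => ind (flow p.2 p.1)).
  exact: measurableT_comp mind measurable_flow_joint.
rewrite (fubini_tonelli (m1 := @phase_measure R) (m2 := @lebesgue_measure R)
  (fun p => ind (flow p.2 p.1)) mj)//=.
transitivity (\int[@lebesgue_measure R]_t cst (phase_measure N) t).
  apply: eq_integral => t _; rewrite /flow.
  rewrite [LHS](phase_shift t mind ind0).
  by rewrite integral_indic// setIT.
by rewrite integral_cst.
Qed.

(** By invariance, the total time spent in [N], integrated over phase space, is the measure of [N]
    times the infinite length of the time axis; if it is zero, so is the measure of [N]. *)
Lemma flow_null : (forall z, lebesgue_measure ((fun t => flow t z) @^-1` N) = 0) ->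
  phase_measure N = 0.
Proof.
move=> N0; have : \int[@phase_measure R]_z sojourn z = 0.
  by apply: integral0_eq => z _; rewrite sojournE N0.
rewrite flow_exchange => /eqP; rewrite mule_eq0 => /orP[/eqP//|].
have : 0 < @lebesgue_measure R [set: R].
  apply: (@lt_le_trans _ _ (@lebesgue_measure R `[0%R, 1%R])).
    by rewrite lebesgue_measure_itv/= lte_fin ltr01 -EFinD lte_fin subr0.
  by apply: le_measure; rewrite ?inE.
by move=> /gt_eqF ->.
Qed.

(** The same identity read the other way. It lets an equation known almost everywhere in phase space
    be used at almost every time of almost every line. *)
Lemma flow_ae : phase_measure N = 0 ->
  {ae @phase_measure R, forall z, lebesgue_measure ((fun t => flow t z) @^-1` N) = 0}.
Proof.
move=> N0; have ms : measurable_fun [set: (R * R) * (R * R)] sojourn.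
  apply: (measurable_fun_fubini_tonelli_F (m2 := @lebesgue_measure R)
    (fun p => ind (flow p.2 p.1))) => //.
  exact: measurableT_comp mind measurable_flow_joint.
have /ae_eq_integral_abs : \int[@phase_measure R]_z `|sojourn z| = 0.
  transitivity (\int[@phase_measure R]_z sojourn z).
    by apply: eq_integral => z _; rewrite gee0_abs// sojournE.
  by rewrite flow_exchange N0 mul0e.
move=> /(_ measurableT ms); apply: filterS => z /(_ I).
by rewrite sojournE.
Qed.
End flow.

Section lebesgue_points.
Variable R : realType.
Local Open Scope ereal_scope.
Implicit Types f : R -> R.

Lemma davgE f (x r : R) : (0 < r)%R -> davg f x r =
  ((r *+ 2)^-1)%:E * \int[lebesgue_measure]_(y in ball x r) `|(f y - f x)%:E|.
Proof.
by move=> r0; rewrite /davg /iavg lebesgue_measure_ball ?ltW// inver mulrn_eq0/= gt_eqF.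
Qed.

Lemma davg_le_double f (x r s : R) : measurable_fun [set: R] f ->
  (0 < r)%R -> (r <= s)%R -> (s <= r *+ 2)%R -> davg f x r <= 2%:E * davg f x s.
Proof.
move=> mf r0 rs s2r; have s0 := lt_le_trans r0 rs.
have mb (t : R) : measurable (ball x t) by exact: measurable_ball.
have mg (A : set R) : measurable_fun A (fun y => `|(f y - f x)%:E|).
  apply: measurable_funTS; apply: measurableT_comp => //.
  by apply/measurable_EFinP; apply: measurable_funB => //; exact: measurable_cst.
rewrite !davgE// muleA -EFinM.
apply: (@le_trans _ _ (((r *+ 2)^-1)%:E *
  \int[lebesgue_measure]_(y in ball x s) `|(f y - f x)%:E|)).
  apply: lee_wpmul2l; first by rewrite lee_fin invr_ge0 mulrn_wge0// ltW.
  apply: ge0_subset_integral => //; [exact: mb|exact: mb|exact: mg|].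
  by move=> y; rewrite /ball/= => /lt_le_trans; exact.
apply: lee_wpmul2r; first by apply: integral_ge0.
rewrite lee_fin -[X in (_ <= X * _)%R]invrK -invfM lef_pV2 ?posrE.
- by move: s2r; lra.
- by rewrite mulrn_wgt0.
- by rewrite mulr_gt0 ?invr_gt0// mulrn_wgt0.
Qed.

(* Countably many radii suffice, which makes the Lebesgue points of a measurable
   family of functions a measurable condition on the parameter. *)
Lemma lebesgue_pt_discrete f (x : R) : measurable_fun [set: R] f ->
  davg f x n.+1%:R^-1 @[n --> \oo] --> 0 -> lebesgue_pt f x.
Proof.
move=> mf f0; rewrite /lebesgue_pt.
(* For r < 1 the radius 1/(k r + 1) lies between r and 2 r, so the average at radius r is at most
   twice the one at this discrete radius. *)
pose k (r : R) := (Num.truncn r^-1).-1.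
have kr (r : R) : (0 < r)%R -> (r < 1)%R -> (k r).+1 = Num.truncn r^-1.
  move=> r0 r1; rewrite /k prednK// truncn_gt0 invf_ge1//; exact: ltW.
apply: (@squeeze_cvge _ _ _ _ (cst 0) _ (fun r => 2%:E * davg f x (k r).+1%:R^-1)).
- near=> r.
  have r0 : (0 < r)%R by near: r; exact: nbhs_right_gt.
  have r1 : (r < 1)%R by near: r; exact: nbhs_right_lt.
  rewrite /= davg_ge0/= kr//.
  have ri0 : (0 <= r^-1)%R by rewrite invr_ge0 ltW.
  have /andP[t1 t2] := truncn_itv ri0.
  have tp : (1 <= Num.truncn r^-1)%N by rewrite -kr.
  have tp' : (1 <= (Num.truncn r^-1)%:R :> R)%R by rewrite ler1n.
  have tp0 := lt_le_trans ltr01 tp'.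
  apply: davg_le_double => //.
    by rewrite -[leLHS]invrK lef_pV2// ?posrE ?invr_gt0.
  rewrite -[leRHS]invrK lef_pV2 ?posrE ?invr_gt0 ?mulrn_wgt0//.
  rewrite -[(r *+ 2)%R]mulr_natr invfM ler_pdivrMr//.
  by apply: (le_trans (ltW t2)); rewrite -natr1; lra.
- exact: cvg_cst.
- rewrite -[X in _ --> X](mule0 2%:E); apply: cvgeZl => //.
  apply: (@cvg_comp _ _ _ k (fun n => davg f x n.+1%:R^-1) _ \oo _ _ f0).
  apply/cvgnyPge => A; near=> r.
  have r0 : (0 < r)%R by near: r; exact: nbhs_right_gt.
  have rA : (r < A.+1%:R^-1)%R by near: r; apply: nbhs_right_lt; rewrite invr_gt0.
  have r1 : (r < 1)%R by apply: (lt_le_trans rA); rewrite invf_le1 ?ltr0n// ler1n.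
  rewrite -ltnS (kr r r0 r1).
  rewrite truncn_ge_nat ?invr_ge0 ?(ltW r0)//.
  by rewrite -[leLHS]invrK lef_pV2 ?posrE ?invr_gt0// ltW.
Unshelve. all: by end_near. Qed.

Lemma measurable_davg d (T : measurableType d) (F : T * R -> R) (r : R) :
  measurable_fun [set: T * R] F ->
  measurable_fun [set: T] (fun z => davg (fun y => F (z, y)) 0%R r).
Proof.
move=> mF; have [r0|r0] := leP r 0%R.
  apply: (eq_measurable_fun (cst 0)) => [z _|]; first by rewrite davg0.
  exact: measurable_cst.
apply: (eq_measurable_fun (fun z => ((r *+ 2)^-1)%:E * \int[lebesgue_measure]_y
    (\1_(ball (0 : R) r) y * `|F (z, y) - F (z, 0%R)|)%R%:E)).
  move=> z _; rewrite davgE//; congr (_ * _).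
  rewrite [RHS]integral_mkcond; apply: eq_integral => y _.
  by rewrite patchE indicE; case: ifPn; rewrite ?mul1r ?mul0r.
apply: measurable_funeM.
have mG : measurable_fun [set: T * R] (fun p => (\1_(ball (0 : R) r) p.2 *
    `|F (p.1, p.2) - F (p.1, 0%R)|)%:E)%R.
  apply/measurable_EFinP; apply: measurable_funM.
    apply: (measurableT_comp _ measurable_snd).
    by apply: measurable_indic; exact: measurable_ball.
  apply: measurableT_comp => //; apply: measurable_funB.
    by apply: (eq_measurable_fun F) => // p _; rewrite -surjective_pairing.
  by apply: (measurableT_comp mF); msolve.
apply: (measurable_fun_fubini_tonelli_F (m2 := @lebesgue_measure R) _ mG).
by move=> p; rewrite lee_fin mulr_ge0.
Qed.

End lebesgue_points.

Lemma lipschitz_absolutely_continuous (R : realType) (a b k : R) (g : R -> R) :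
  (forall s t, a <= s -> s <= t -> t <= b -> `|g t - g s| <= k * (t - s)) ->
  absolutely_continuous_on a b g.
Proof.
move=> gk e e0; have k1 : 0 < `|k| + 1 by rewrite ltr_wpDl.
exists (e / (`|k| + 1)); first exact: divr_gt0.
move=> n l r lr _ sd.
apply: (@le_lt_trans _ _ (\sum_(i < n) (`|k| + 1) * (r i - l i))).
  apply: ler_sum => i _; have [al [lri rb]] := lr i.
  apply: (le_trans (gk _ _ al lri rb)); rewrite ler_wpM2r ?subr_ge0//.
  by apply: (le_trans (ler_norm k)); rewrite lerDl.
by rewrite -mulr_sumr mulrC -ltr_pdivlMr.
Qed.

(** * The explicit formula along a line: Lipschitz bound and derivative *)

Section along_lines.
Variables (R : realType) (eps K : R) (psi : (R * R) * (R * R) -> R).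
Hypothesis eps0 : 0 < eps.
Hypotheses (mpsi : measurable_fun [set: (R * R) * (R * R)] psi)
  (psiK : forall z, 0 <= psi z <= K).
Implicit Types (z : (R * R) * (R * R)) (s t B : R).

Let K0 : 0 <= K.
Proof. by have /andP[/le_trans] := psiK ((0, 0), (0, 0)); exact. Qed.
Let mpsiE : measurable_fun [set: (R * R) * (R * R)] (EFin \o psi).
Proof. exact/measurable_EFinP. Qed.
Let psi0 z : (0 <= (EFin \o psi) z)%E.
Proof. by rewrite lee_fin; have /andP[] := psiK z. Qed.
Let Tpsi := flight eps (-1) (EFin \o psi).
Let Tpsi0 z : (0 <= Tpsi z)%E := flight_ge0 eps0 (-1) psi0 z.
Let TpsiK z : (Tpsi z <= K%:E)%E.
Proof.
rewrite -(flight_cst eps0 (-1) z K0); apply: flight_le => //.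
by move=> s _; rewrite lee_fin; have /andP[] := psiK (z.1 + (-1 * s) *: z.2, z.2).
Qed.
Let finTpsi z : Tpsi z \is a fin_num.
Proof. by rewrite ge0_fin_numE// (le_lt_trans (TpsiK z))// ltry. Qed.

(** The source times exp(r/eps), the integrating factor of eps y' + y = psi along the line through
    [z]. *)
Definition weighted_source z (r : R) : R := expR (eps^-1 * r) * psi (flow r z).

Let theta := weighted_source.

Lemma measurable_weighted_source :
  measurable_fun [set: ((R * R) * (R * R)) * R] (fun p => theta p.1 p.2).
Proof.
apply: measurable_funM; last exact: (measurableT_comp mpsi (@measurable_flow_joint R)).
by apply: measurableT_comp => //; msolve.
Qed.

Let mtheta z : measurable_fun [set: R] (theta z).
Proof. exact: (measurableT_comp measurable_weighted_source (pair1_measurable z)). Qed.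

Let theta_ge0 z r : 0 <= theta z r.
Proof. by rewrite mulr_ge0 ?expR_ge0//; have /andP[] := psiK (flow r z). Qed.

Let theta_le z r : theta z r <= expR (eps^-1 * r) * K.
Proof. by rewrite ler_wpM2l ?expR_ge0//; have /andP[] := psiK (flow r z). Qed.

(** Changing the base point on a line translates the weighted source and multiplies it by a
    constant. So 0 is a Lebesgue point for [flow t z] when t is one for [z]. *)
Let thetaD z t r : theta (flow t z) r = expR (- eps^-1 * t) * theta z (t + r).
Proof. by rewrite /theta /weighted_source flowD mulrA -expRD; congr (expR _ * _); ring. Qed.

(** The substitution r = t - s splits the exponential and takes t out of the integrand: on a line a
    flight is an exponential times a primitive. *)
Lemma flight_flow z t : Tpsi (flow t z) =
  ((eps^-1 * expR (- eps^-1 * t))%:E *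
   \int[lebesgue_measure]_(r in `]-oo, t]) (theta z r)%:E)%E.
Proof.
pose Hf (r : R) : \bar R := ((free_path eps (t - r))%:E * (psi (flow r z))%:E)%E.
have mHf : measurable_fun [set: R] Hf.
  apply: emeasurable_funM; apply/measurable_EFinP.
    apply: (measurableT_comp (measurable_free_path eps)).
    by apply: measurable_funB => //; exact: measurable_cst.
  exact: (measurableT_comp mpsi (measurable_flow_time z)).
have Hf0 r : (0 <= Hf r)%E.
  by rewrite mule_ge0// ?lee_fin ?free_path_ge0//; have /andP[] := psiK (flow r z).
transitivity (\int[lebesgue_measure]_r Hf r)%E.
  rewrite -[RHS](integral_reflect t mHf Hf0).
  apply: eq_integral => s _; rewrite /Hf subKr; congr (_ * _%:E)%E.
  by rewrite /flow/= mulN1r -addrA -scalerDl.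
transitivity (\int[lebesgue_measure]_r ((eps^-1 * expR (- eps^-1 * t))%:E *
   ((EFin \o theta z) \_ `]-oo, t]) r))%E.
  apply: eq_integral => r _; have [rt|rt] := leP r t.
    rewrite patchE mem_set/= ?in_itv//; rewrite /Hf /free_path exponential_pdfE ?subr_ge0//.
    rewrite -!EFinM; congr EFin.
    have -> : - eps^-1 * (t - r) = - eps^-1 * t + eps^-1 * r by ring.
    by rewrite expRD /theta /weighted_source !mulrA.
  rewrite patchE memNset/= ?in_itv/=; last by rewrite leNgt rt.
  by rewrite mule0 /Hf /free_path lt0_exponential_pdf ?mul0e// subr_lt0.
rewrite ge0_integralZl_EFin//.
- by rewrite [in RHS]integral_mkcond.
- by move=> r _; rewrite patchE; case: ifPn => // _; rewrite lee_fin.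
- apply/(measurable_restrictT _ _).1 => //.
  by apply: measurable_funTS; apply/measurable_EFinP; exact: mtheta.
- by rewrite mulr_ge0 ?expR_ge0// invr_ge0 ltW.
Qed.

Let coef_gt0 t : 0 < eps^-1 * expR (- eps^-1 * t).
Proof. by rewrite mulr_gt0 ?expR_gt0 ?invr_gt0. Qed.

Lemma integrable_weighted_source z t :
  (@lebesgue_measure R).-integrable `]-oo, t] (EFin \o theta z).
Proof.
apply/integrableP; split; first by apply: measurable_funTS; apply/measurable_EFinP; exact: mtheta.
apply: (@le_lt_trans _ _ ((eps^-1 * expR (- eps^-1 * t))^-1%:E * Tpsi (flow t z))%E).
  rewrite flight_flow muleA -EFinM mulVf ?gt_eqF// mul1e.
  by rewrite le_eqVlt; apply/orP; left; apply/eqP; apply: eq_integral => r _;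
    rewrite /= ger0_norm.
by rewrite -(fineK (finTpsi _)) -EFinM ltry.
Qed.

Definition primitive z t : R := \int[lebesgue_measure]_(r in `]-oo, t]) theta z r.

Lemma fine_flight_flow z t :
  fine (Tpsi (flow t z)) = eps^-1 * expR (- eps^-1 * t) * primitive z t.
Proof.
rewrite flight_flow fineM//.
exact: integrable_fin_num (integrable_weighted_source z t).
Qed.

Lemma primitive_lip z s t : s <= t ->
  0 <= primitive z t - primitive z s <= expR (eps^-1 * t) * K * (t - s).
Proof.
move=> st; rewrite /primitive Rintegral_itvB ?bnd_simp//; last first.
  exact: integrable_weighted_source.
have sub : `]s, t] `<=` `]-oo, t]%classic by move=> r /=; rewrite !in_itv/= => /andP[].
have it : (@lebesgue_measure R).-integrable `]s, t] (EFin \o theta z).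
  exact: integrableS (integrable_weighted_source z t).
apply/andP; split; first by apply: Rintegral_ge0 => r _; exact: theta_ge0.
have mst : (@lebesgue_measure R) `]s, t] = (t - s)%:E.
  rewrite lebesgue_measure_itv/= lte_fin; case: ltP => // ts.
  by rewrite (_ : s = t) ?subrr//; apply/eqP; rewrite eq_le st ts.
have -> : expR (eps^-1 * t) * K * (t - s) =
    \int[@lebesgue_measure R]_(r in `]s, t]) (cst (expR (eps^-1 * t) * K) r).
  by rewrite Rintegral_cst//= [X in fine X]mst.
apply: le_Rintegral => //.
  apply: (@measurable_bounded_integrable _ _ _ (@lebesgue_measure R)) => //.
  - by rewrite [ltLHS]mst ltry.
  - exact: bounded_cst.
move=> r; rewrite /= in_itv/= => /andP[_ rt].
apply: (le_trans (theta_le z r)); rewrite ler_wpM2r// ler_expR ler_pM2l ?invr_gt0//.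
Qed.

Definition line_value B z t : R := expR (- eps^-1 * t) * B + fine (Tpsi (flow t z)).

Lemma line_valueE B z t :
  line_value B z t = expR (- eps^-1 * t) * (B + eps^-1 * primitive z t).
Proof. by rewrite /line_value fine_flight_flow; ring. Qed.

(** The increment consists of the exponential decay of the value at [s] and of the source collected
    on []s, t]]. The constant depends on the lower end [a] because the inflow part grows backward in
    time. *)
Lemma line_value_lip B z a s t : 0 <= B -> a <= s -> s <= t ->
  `|line_value B z t - line_value B z s| <=
  eps^-1 * (expR (- eps^-1 * a) * B + K + K) * (t - s).
Proof.
move=> B0 sa st.
have e0 : 0 < eps^-1 by rewrite invr_gt0.
have /andP[p1 p2] := primitive_lip z st.
have Ys0 : 0 <= line_value B z s.
  by rewrite addr_ge0 ?fine_ge0// mulr_ge0 ?expR_ge0.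
have YsM : line_value B z s <= expR (- eps^-1 * a) * B + K.
  apply: lerD; last by rewrite -lee_fin fineK// TpsiK.
  by rewrite ler_wpM2r// ler_expR !mulNr lerN2 ler_pM2l.
have E : line_value B z t - line_value B z s =
    - ((1 - expR (- eps^-1 * (t - s))) * line_value B z s) +
    eps^-1 * (expR (- eps^-1 * t) * (primitive z t - primitive z s)).
  rewrite !line_valueE.
  have -> : expR (- eps^-1 * t) = expR (- eps^-1 * (t - s)) * expR (- eps^-1 * s).
    by rewrite -expRD; congr expR; ring.
  by ring.
have q1 : 0 <= 1 - expR (- eps^-1 * (t - s)) <= eps^-1 * (t - s).
  rewrite subr_ge0 -expR0 ler_expR mulNr oppr_le0 mulr_ge0 ?subr_ge0 ?(ltW e0)//= expR0.
  by rewrite lerBlDl -lerBlDr; exact: expR_ge1Dx.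
have q2 : 0 <= expR (- eps^-1 * t) * (primitive z t - primitive z s) <= K * (t - s).
  rewrite mulr_ge0 ?expR_ge0//=.
  apply: (le_trans (ler_wpM2l (expR_ge0 _) p2)).
  by rewrite !mulrA -expRD mulNr addNr expR0 mul1r.
rewrite E; apply: (le_trans (ler_normD _ _)); rewrite normrN !normrM.
rewrite [`|eps^-1|]gtr0_norm// (ger0_norm Ys0).
move: q1 q2 => /andP[q10 q1] /andP[q20 q2].
rewrite (ger0_norm q10) -normrM (ger0_norm q20).
have -> : eps^-1 * (expR (- eps^-1 * a) * B + K + K) * (t - s) =
  eps^-1 * (t - s) * (expR (- eps^-1 * a) * B + K) + eps^-1 * (K * (t - s)) by ring.
apply: lerD; last by rewrite ler_pM2l.
by apply: ler_pM.
Qed.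

Lemma line_value_derive B z : lebesgue_pt (theta z) 0 ->
  is_derive (0 : R) 1 (line_value B z) (eps^-1 * (psi z - line_value B z 0)).
Proof.
move=> lp.
have [dP P'] := FTC1_lebesgue_pt (@ltr01 R) (integrable_weighted_source z 1)
  (ltNyr _) lp.
have {dP P'} dP : is_derive (0 : R) 1 (primitive z) (psi z).
  apply: DeriveDef => //; move: P'; rewrite derive1E => ->.
  by rewrite /theta /weighted_source mulr0 expR0 mul1r flow0.
have -> : line_value B z = fun t => expR (- eps^-1 * t) * (B + eps^-1 * primitive z t).
  by apply/funext => t; exact: line_valueE.
apply: is_derive_eq.
rewrite /GRing.scale/= !mulr0 expR0; ring.
Qed.

(** Lebesgue's differentiation theorem leaves a null set of times on each line; [flow_null] turns
    this into a null set of phase space, once the exceptional set is known to be measurable. *)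
Lemma ae_lebesgue_pt : {ae @phase_measure R, forall z, lebesgue_pt (theta z) 0}.
Proof.
pose Dn n z := davg (theta z) 0 (n.+1%:R^-1).
(* An upper limit of countably many measurable averages, hence measurable; by [lebesgue_pt_discrete]
   it contains all points where the Lebesgue property fails. *)
pose N := [set z | limn_esup (Dn ^~ z) != 0%E].
have mDn n : measurable_fun [set: (R * R) * (R * R)] (Dn n).
  exact: (measurable_davg _ measurable_weighted_source).
have mN : measurable N.
  rewrite -[N]setTI; apply: emeasurable_neq => //.
  exact: measurable_fun_limn_esup.
exists N; split => //; last first.
  move=> z /= nl; apply/negP => /eqP Dn0; apply: nl.
  apply: lebesgue_pt_discrete => //; apply: limn_esup_le_cvg; first by rewrite Dn0.
  by move=> n; exact: davg_ge0.
apply: flow_null => // z; apply/negligibleP.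
  exact: measurable_flow_preimage.
have : locally_integrable setT (theta z).
  split => //; first exact: openT.
  move=> A _ cA; have [M [_ /(_ (M + 1)) AM]] := compact_bounded cA.
  have mA : measurable A by exact: compact_measurable.
  have /integrableP[_] := integrable_weighted_source z (M + 1).
  apply: le_lt_trans; apply: ge0_subset_integral => //.
    apply: measurable_funTS; apply/measurable_EFinP.
    by apply: measurableT_comp => //; exact: mtheta.
  move=> r Ar; rewrite /= in_itv/=; apply: (le_trans (ler_norm r)).
  by apply: AM => //; rewrite ltrDl.
move=> /lebesgue_differentiation; apply: negligibleS => t /= Nt lt.
have DnE n : Dn n (flow t z) =
    ((expR (- eps^-1 * t))%:E * davg (theta z) t n.+1%:R^-1)%E.
  have n0 : 0 < n.+1%:R^-1 :> R by rewrite invr_gt0.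
  set c := expR _; set r := n.+1%:R^-1 in n0 *.
  rewrite /Dn !davgE// muleCA; congr (_ * _)%E.
  pose G : R -> \bar R := (fun y => `|(theta z y - theta z t)%:E|%E) \_ (ball t r).
  have G0 y : (0 <= G y)%E by rewrite /G patchE; case: ifPn.
  have mG : measurable_fun [set: R] G.
    apply/(measurable_restrictT _ _).1; first exact: measurable_ball.
    apply: measurable_funTS; apply: measurableT_comp => //.
    apply/measurable_EFinP; apply: measurable_funB => //; exact: measurable_cst.
  have mGt : measurable_fun [set: R] (fun y => G (y + t)).
    by apply: (measurableT_comp mG); apply: measurable_funD => //; exact: measurable_cst.
  transitivity (c%:E * \int[lebesgue_measure]_y G (y + t)%R)%E; last first.
    by rewrite (integral_shift t mG G0) [in RHS]integral_mkcond.
  rewrite -ge0_integralZl_EFin ?expR_ge0// [in LHS]integral_mkcond.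
  apply: eq_integral => y _; rewrite patchE /G patchE.
  have yt : ball t r (y + t)%R = ball (0 : R) r y.
    by rewrite /ball/= opprD addrCA subrr addr0 sub0r normrN.
  have [yb|yb] := pselect (ball (0 : R) r y); last first.
    by rewrite !memNset ?mule0//= yt.
  rewrite !mem_set//= ?yt// !thetaD addr0 -mulrBr -/c normrM (gtr0_norm (expR_gt0 _)).
  by rewrite [t + y]addrC.
move/negP : Nt; apply; apply/eqP.
suff : Dn ^~ (flow t z) @ \oo --> 0%E by move=> /cvg_limn_einf_sup[].
rewrite (_ : Dn ^~ _ = fun n => ((expR (- eps^-1 * t))%:E * davg (theta z) t n.+1%:R^-1)%E);
  last by apply/funext => n; exact: DnE.
rewrite -[X in _ --> X](mule0 (expR (- eps^-1 * t))%:E); apply: cvgeZl => //.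
apply: (@cvg_comp _ _ _ (fun n => n.+1%:R^-1) (davg (theta z) t) _ _ _ _ lt).
move=> P /= [e /= e0 eP].
have [k _ kP] : \forall n \near \oo, `|0 - n.+1%:R^-1| < e.
  by move: e e0 {eP}; apply/cvgrPdist_lt; exact: cvg_harmonic.
exists k => // n /kP ke; apply: eP => //=; rewrite /ball/= sub0r normrN.
Qed.

End along_lines.

Lemma phase_aeS (R : realType) (P Q : (R * R) * (R * R) -> Prop) :
  (forall z, P z -> Q z) -> {ae @phase_measure R, forall z, P z} ->
  {ae @phase_measure R, forall z, Q z}.
Proof. by move=> PQ; apply: negligibleS => z nQ /PQ. Qed.

Lemma phase_aeI (R : realType) (P Q : (R * R) * (R * R) -> Prop) :
  {ae @phase_measure R, forall z, P z} -> {ae @phase_measure R, forall z, Q z} ->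
  {ae @phase_measure R, forall z, P z /\ Q z}.
Proof.
move=> aP aQ; apply: negligibleS (negligibleU aP aQ) => z /= nPQ.
by apply/not_andP => PQ; apply: nPQ.
Qed.

Lemma is_derive_line (R : realType) (g : R * R -> R) (x w : R * R) (l : R) :
  is_derive (0 : R) 1 (fun t => g (x + t *: w)) l -> is_derive x w g l.
Proof.
move=> [dg gl].
have E : (fun h : R => h^-1 *: ((g \o shift x) (h *: w) - g x)) =
    (fun h : R => h^-1 *: (((fun t => g (x + t *: w)) \o shift 0) (h *: 1) -
      (fun t => g (x + t *: w)) 0)).
  by apply/funext => h /=; rewrite scale0r !addr0 [_ + x]addrC /GRing.scale/= mulr1.
by apply: DeriveDef; rewrite /derivable /derive E.
Qed.

Section solution_lines.
Variables (R : realType) (Omega : set (R * R)) (eps : R).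
Hypotheses (Omega_open : open Omega) (Omega_convex : convex_set Omega).
Hypotheses (Omega_bounded : bounded_set Omega) (Omega_C3 : C3_boundary Omega).
Hypothesis eps0 : 0 < eps.

(** More than [transport_solution] asks for: boundedness, zero extension, a Lipschitz bound on every
    line and the inflow limit at every incoming point. This form is stable under differences, which
    reduces signed data to nonnegative ones. *)
Record strong_solution (f h u : (R * R) * (R * R) -> R) (v : R * R -> R) : Prop :=
  StrongSolution {
  strong_measurable : measurable_fun [set: (R * R) * (R * R)] u;
  strong_bounded : exists M, forall z, `|u z| <= M;
  strong_support : forall z, ~ (Omega `*` @S1 R) z -> u z = 0;
  strong_lipschitz : forall x w a b, Omega x -> S1 w ->
    (forall t, a <= t <= b -> Omega (x + t *: w)) ->
    exists k, forall s t, a <= s -> s <= t -> t <= b ->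
      `|u (x + t *: w, w) - u (x + s *: w, w)| <= k * (t - s);
  strong_derive : {ae @phase_measure R, forall z, (Omega `*` @S1 R) z ->
    is_derive z.1 z.2 (fun y => u (y, z.2)) (eps^-1 * (f z + v z.1 - u z))};
  strong_inflow : forall x w t, Omega x -> S1 w -> Gamma_minus Omega (x + t *: w, w) ->
    u (x + s *: w, w) @[s --> t^'+] --> h (x + t *: w, w);
  strong_average : forall x, Omega x -> velocity_average u x = v x }.

Variables (h f : (R * R) * (R * R) -> R) (H F : R).
Hypotheses (mh : measurable_fun (Gamma_minus Omega) h)
  (hH : forall z, Gamma_minus Omega z -> 0 <= h z <= H).
Hypotheses (mf : measurable_fun [set: (R * R) * (R * R)] f)
  (fF : forall z, (0 <= f z <= F)%R)
  (fD : forall z, ~ (Omega `*` @S1 R) z -> f z = 0%R).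
Variables (v : R * R -> R) (K M : R).
Hypotheses (mv : measurable_fun [set: R * R] v) (vK : forall x, (0 <= v x <= K)%R)
  (v0 : forall x, ~ Omega x -> v x = 0%R)
  (vE : forall x, Omega x -> (v x)%:E = (avg (fun w => (inflow Omega eps h (x, w))%:E) +
    avg (fun w => flight eps (-1) (EFin \o f) (x, w)) + scatter eps (-1) (EFin \o v) x)%E).

Let u := solution Omega eps h f v.
Hypothesis uM : forall z, u z <= M.
Let psi := full_source f v.
Let mpsi : measurable_fun [set: (R * R) * (R * R)] psi := measurable_full_source mf mv.
Let psiK := full_source_bound fF vK.
Let B z := inflow Omega eps h z.
Let B0 z : 0 <= B z := inflow_ge0 eps Omega_open Omega_convex Omega_bounded Omega_C3 hH z.
Let Y z := line_value eps psi (B z) z.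

Lemma inflow_line x w t : Omega x -> S1 w -> Omega (x + t *: w) ->
  B (x + t *: w, w) = expR (- eps^-1 * t) * B (x, w).
Proof.
move=> Ox w1 Ot; rewrite /B !inflowE// exit_timeD//.
by rewrite mulrA -expRD -mulrDr scalerDl opprD addrA addrK.
Qed.

Lemma solution_line x w t : Omega x -> S1 w -> Omega (x + t *: w) ->
  u (x + t *: w, w) = Y (x, w) t.
Proof.
move=> Ox w1 Ot; rewrite /Y /line_value -inflow_line//.
by rewrite /u /solution patchE mem_set.
Qed.

(** At the backward exit point the flight integral vanishes, since that point and all earlier ones
    lie outside [Omega], where the source is zero; the attenuation factor of the inflow has become
    1. *)
Lemma line_value_exit x w t : Omega x -> S1 w -> Gamma_minus Omega (x + t *: w, w) ->
  Y (x, w) t = h (x + t *: w, w).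
Proof.
move=> Ox w1 Gt.
have tE := Gamma_minus_exit Omega_open Omega_convex Omega_bounded Omega_C3 Ox Gt.
rewrite /Y /line_value /B inflowE// mulrA -expRD {1}tE mulrNN mulNr addrN expR0 mul1r.
rewrite -scaleNr -tE [X in fine X](_ : _ = 0%E) ?addr0//.
apply: integral0_eq => s _.
have [s0|s0] := ltP s 0; first by rewrite /free_path lt0_exponential_pdf// mul0e.
rewrite /= /psi (full_source0 fD v0) ?mule0// /flow/= mulN1r -addrA -scalerDl.
have tau0 := exit_time_gt0 Omega_open Omega_convex Omega_bounded Ox w1.
have ts : 0 <= s - t by rewrite tE; lra.
rewrite -opprB scaleNr => /(exit_timeP Omega_open Omega_convex Omega_bounded Ox w1 ts).
by rewrite tE; lra.
Qed.

Let Y_lip z a s t : a <= s -> s <= t -> `|Y z t - Y z s| <=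
  eps^-1 * (expR (- eps^-1 * a) * B z + (F + K) + (F + K)) * (t - s).
Proof. exact: (line_value_lip eps0 mpsi psiK z (B0 z)). Qed.

Lemma solution_lipschitz x w a b : Omega x -> S1 w ->
    (forall t, a <= t <= b -> Omega (x + t *: w)) ->
    exists k, forall s t, a <= s -> s <= t -> t <= b ->
      `|u (x + t *: w, w) - u (x + s *: w, w)| <= k * (t - s).
Proof.
move=> Ox w1 Oab; eexists => s t as_ st tb.
rewrite !solution_line//; last 2 first.
- by apply: Oab; rewrite as_ (le_trans st).
- by apply: Oab; rewrite (le_trans as_).
exact: (Y_lip (x, w) as_ st).
Qed.

Lemma solution_derive : {ae @phase_measure R, forall z, (Omega `*` @S1 R) z ->
    is_derive z.1 z.2 (fun y => u (y, z.2)) (eps^-1 * (f z + v z.1 - u z))}.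
Proof.
apply: phase_aeS (ae_lebesgue_pt eps0 mpsi psiK) => -[x w] lp [/= Ox w1].
apply: is_derive_line; apply: (@near_eq_is_derive _ _ _ (Y (x, w))).
  have : \forall t \near (0 : R), Omega (x + t *: w).
    have OO : nbhs (x + 0 *: w) Omega.
      by rewrite scale0r addr0; exact: open_nbhs_nbhs.
    exact: (@line_continuous R x w 0 _ OO).
  by apply: filterS => t Ot; rewrite solution_line.
apply: is_derive_eq; first exact: (line_value_derive eps0 mpsi psiK (B (x, w)) lp).
rewrite -/(Y (x, w) 0) -solution_line// ?scale0r ?addr0//.
Qed.

Lemma solution_inflow x w t : Omega x -> S1 w -> Gamma_minus Omega (x + t *: w, w) ->
    u (x + s *: w, w) @[s --> t^'+] --> h (x + t *: w, w).
Proof.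
move=> Ox w1 Gt.
have tE := Gamma_minus_exit Omega_open Omega_convex Omega_bounded Omega_C3 Ox Gt.
have tau0 := exit_time_gt0 Omega_open Omega_convex Omega_bounded Ox w1.
rewrite -(line_value_exit Ox w1 Gt).
have YC : Y (x, w) s @[s --> t^'+] --> Y (x, w) t.
  set k := eps^-1 * (expR (- eps^-1 * t) * B (x, w) + (F + K) + (F + K)).
  apply/cvgrPdist_lt => e e0.
  have k0 : 0 < `|k| + 1 by rewrite ltr_wpDl.
  near=> s.
  have ts : t < s by near: s; exact: nbhs_right_gt.
  have sd : s < t + e / (`|k| + 1) by near: s; apply: nbhs_right_lt; rewrite ltrDl divr_gt0.
  rewrite distrC; apply: (le_lt_trans (Y_lip _ (lexx t) (ltW ts))); rewrite -/k.
  apply: (@le_lt_trans _ _ ((`|k| + 1) * (s - t))).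
    rewrite ler_wpM2r ?subr_ge0 1?ltW//.
    by apply: (le_lt_trans (ler_norm k)); rewrite ltrDl.
  by rewrite mulrC -ltr_pdivlMr// ltrBlDl.
apply: cvg_trans YC; apply: near_eq_cvg; near=> s.
have ts : t < s by near: s; exact: nbhs_right_gt.
have s0 : s < 0 by near: s; apply: nbhs_right_lt; rewrite tE oppr_lt0.
rewrite solution_line//.
have s0' : 0 <= - s by rewrite oppr_ge0 ltW.
rewrite -[s]opprK scaleNr.
apply/(exit_timeP Omega_open Omega_convex Omega_bounded Ox w1 s0').
by rewrite ltrNl -tE.
Unshelve. all: by end_near. Qed.

Let u0 z : 0 <= u z.
Proof. exact: (solution_ge0 Omega_open Omega_convex Omega_bounded Omega_C3 eps0 hH mf fF mv vK). Qed.

Lemma solution_average x : Omega x -> velocity_average u x = v x.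
Proof.
move=> Ox; apply: EFin_inj.
rewrite -(avg_solution Omega_open Omega_convex Omega_bounded Omega_C3 eps0 mh hH mf fF mv vK vE Ox).
rewrite /velocity_average /avg EFinM; congr (_ * _)%E.
rewrite /Rintegral.
have -> : (\int[@circle_measure R]_(w in @S1 R) (u (x, w))%:E =
    \int[@circle_measure R]_w (u (x, w))%:E)%E.
  rewrite integral_mkcond; apply: eq_integral => w _; rewrite patchE.
  case: ifPn => //; rewrite notin_setE => nw.
  by rewrite /u solution0// => -[].
rewrite fineK// ge0_fin_numE; last by apply: integral_ge0 => w _; rewrite lee_fin.
apply: (@le_lt_trans _ _ (\int[@circle_measure R]_w (cst M%:E w))%E).
  apply: ge0_le_integral => //.
  - by move=> w _; rewrite lee_fin.
  - apply/measurable_EFinP; apply: (measurableT_comp _ (pair1_measurable x)).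
    exact: (measurable_solution Omega_open Omega_convex Omega_bounded Omega_C3 eps0 mh mf fF mv vK).
  - by move=> w _; rewrite lee_fin.
rewrite integral_cst//= lte_mul_pinfty//.
- by rewrite lee_fin (le_trans (u0 (0, 0))).
- by rewrite -ge0_fin_numE//; exact: circle_measure_fin.
Qed.

Lemma strong_solution_exists : strong_solution f h u v.
Proof.
split.
- exact: (measurable_solution Omega_open Omega_convex Omega_bounded Omega_C3 eps0 mh mf fF mv vK).
- by exists M => z; rewrite ger0_norm.
- exact: solution0.
- exact: solution_lipschitz.
- exact: solution_derive.
- exact: solution_inflow.
- exact: solution_average.
Qed.

End solution_lines.

Section strong_to_transport.
Variables (R : realType) (Omega : set (R * R)) (eps : R).

Lemma bounded_circle_integrable (g : R * R -> R) (M : R) :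
  measurable_fun [set: R * R] g -> (forall w, `|g w| <= M) ->
  (@circle_measure R).-integrable (@S1 R) (EFin \o g).
Proof.
move=> mg gM; apply: (@measurable_bounded_integrable _ _ _ (@circle_measure R)).
- exact: measurable_S1.
- by rewrite -ge0_fin_numE//; apply: circle_measure_fin; exact: measurable_S1.
- exact: measurable_funTS.
- by exists M; split; [exact: num_real|move=> x Mx w _; exact: le_trans (gM w) (ltW Mx)].
Qed.

Lemma velocity_averageB (u1 u2 : (R * R) * (R * R) -> R) (M1 M2 : R) x :
  measurable_fun [set: (R * R) * (R * R)] u1 -> (forall z, `|u1 z| <= M1) ->
  measurable_fun [set: (R * R) * (R * R)] u2 -> (forall z, `|u2 z| <= M2) ->
  velocity_average (fun z => u1 z - u2 z) x = velocity_average u1 x - velocity_average u2 x.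
Proof.
move=> mu1 b1 mu2 b2; rewrite /velocity_average -mulrBr; congr (_ * _).
rewrite -RintegralB//.
- exact: measurable_S1.
- exact: (bounded_circle_integrable (measurableT_comp mu1 (pair1_measurable x))
    (fun w => b1 (x, w))).
- exact: (bounded_circle_integrable (measurableT_comp mu2 (pair1_measurable x))
    (fun w => b2 (x, w))).
Qed.

Lemma strong_solutionB f1 h1 u1 v1 f2 h2 u2 v2 :
  strong_solution Omega eps f1 h1 u1 v1 -> strong_solution Omega eps f2 h2 u2 v2 ->
  strong_solution Omega eps (fun z => f1 z - f2 z) (fun z => h1 z - h2 z)
    (fun z => u1 z - u2 z) (fun x => v1 x - v2 x).
Proof.
move=> [m1 [M1 b1] s1 l1 d1 i1 a1] [m2 [M2 b2] s2 l2 d2 i2 a2]; split.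
- exact: measurable_funB.
- by exists (M1 + M2) => z; rewrite (le_trans (ler_normB _ _))// lerD.
- by move=> z nD; rewrite (s1 z nD) (s2 z nD) subrr.
- move=> x w a b Ox w1 Oab.
  have [k1 lk1] := l1 x w a b Ox w1 Oab; have [k2 lk2] := l2 x w a b Ox w1 Oab.
  exists (k1 + k2) => s t as_ st tb.
  have := lk2 s t as_ st tb; have := lk1 s t as_ st tb.
  set p1 := u1 _; set q1 := u1 _; set p2 := u2 _; set q2 := u2 _ => l1' l2'.
  rewrite (_ : p1 - p2 - (q1 - q2) = (p1 - q1) - (p2 - q2)); last by ring.
  by rewrite mulrDl; apply: (le_trans (ler_normB _ _)); exact: lerD.
- apply: phase_aeS (phase_aeI d1 d2) => z [dz1 dz2] Dz.
  have {}dz1 := dz1 Dz; have {}dz2 := dz2 Dz.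
  by apply: is_derive_eq; ring.
- by move=> x w t Ox w1 Gt; apply: cvgB; [exact: i1|exact: i2].
- by move=> x Ox; rewrite (velocity_averageB x m1 b1 m2 b2) a1// a2.
Qed.

Hypothesis Omega_open : open Omega.
Hypothesis finOmega : (@lam2 R Omega < +oo)%E.

Lemma finite_phase : (@phase_measure R (Omega `*` @S1 R) < +oo)%E.
Proof.
rewrite /phase_measure product_measure1E.
- apply: lte_mul_pinfty => //; first by rewrite ge0_fin_numE.
  by rewrite -ge0_fin_numE//; apply: circle_measure_fin; exact: measurable_S1.
- exact: measurable_Omega Omega_open.
- exact: measurable_S1.
Qed.

Lemma bounded_phase_norm (u : (R * R) * (R * R) -> R) (M p : R) : 0 < p ->
  measurable_fun [set: (R * R) * (R * R)] u -> (forall z, `|u z| <= M) ->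
  (phase_norm Omega p%:E u < +oo)%E.
Proof.
move=> p0 mu uM; have mD := measurable_phase Omega_open.
have M0 : 0 <= M by exact: le_trans (uM ((0, 0), (0, 0))).
rewrite /phase_norm unlock/= ; apply: poweR_lty.
apply: (@le_lt_trans _ _ (\int[@phase_measure R]_(z in Omega `*` @S1 R) (cst (M `^ p)%:E z))%E).
  rewrite [leRHS]integral_mkcond; apply: ge0_le_integral => //.
  - by move=> z _; exact: poweR_ge0.
  - apply: (measurableT_comp (measurable_poweR p)); apply: measurableT_comp => //.
    apply/(measurable_restrictT _ _).1 => //; apply: measurable_funTS.
    exact/measurable_EFinP.
  - apply/(measurable_restrictT _ _).1 => //; exact: measurable_cst.
  - move=> z _; rewrite !patchE; case: ifPn => _; last first.
      by rewrite abse0 poweR0r// gt_eqF.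
    by rewrite /= lee_fin ge0_ler_powR// ?ltW// nnegrE.
rewrite integral_cst//= lte_mul_pinfty ?finite_phase ?lee_fin ?powR_ge0//.
Qed.

Lemma strong_transport f h u v f0 h0 : strong_solution Omega eps f0 h0 u v -> 0 < eps ->
  {ae @phase_measure R, forall z, (Omega `*` @S1 R) z -> f0 z = f z} ->
  (forall z, Gamma_minus Omega z -> h0 z = h z) ->
  transport_solution Omega eps f h u.
Proof.
move=> [mu [M b] s l d i a] eps0 ff hh; split.
- exact: measurable_funTS.
- exact: bounded_phase_norm mu b.
- apply/aeW => -[x w] [/= Ox w1] c e Oce.
  have [k lk] := l x w c e Ox w1 Oce.
  exact: (lipschitz_absolutely_continuous lk).
- apply: phase_aeS (phase_aeI d ff) => -[x w] [dz fz] Dz.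
  have [/= Ox w1] := Dz; have [/= dx ->] := dz Dz.
  split=> //; rewrite mulrA divff ?gt_eqF// mul1r a//= fz//; ring.
- by apply/aeW => -[x w] [/= Ox w1] t Gt; rewrite -hh//; exact: i.
Qed.
End strong_to_transport.

(** * Uniqueness *)

Section absolute_continuity.
Variable R : realType.
Local Notation leb := (@lebesgue_measure R).

Lemma derive_approx (f : R -> R) (t l e : R) : 0 < e -> is_derive t 1 f l ->
  exists2 d, 0 < d & forall s, `|s - t| < d -> `|f s - f t - l * (s - t)| <= e * `|s - t|.
Proof.
move=> e0 [df fl].
have /cvgrPdist_le/(_ e e0) [d /= d0 dP] :
    h^-1 *: ((f \o shift t) (h *: 1) - f t) @[h --> (0 : R)^'] --> l by rewrite -fl.
exists d => // s sd; have [->|st] := eqVneq s t.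
  by rewrite !subrr mulr0 subr0 normr0 mulr0.
have st0 : s - t != 0 by rewrite subr_eq0.
have := dP (s - t); rewrite /ball/= sub0r normrN => /(_ sd st0).
rewrite /GRing.scale/= mulr1 subrK => le.
rewrite -ler_pdivrMr ?normr_gt0// -normfV -normrM.
rewrite distrC in le; apply: le_trans le; rewrite le_eqVlt; apply/orP; left; apply/eqP.
by congr `|_|; field.
Qed.

Section mean_value.
Variables (Phi F : R -> R) (a b : R).
Hypothesis F_nd : forall s t, a <= s -> s <= t -> t <= b -> F s <= F t.

Section budget.
Variables (U : set R) (e : R).
Hypothesis mU : measurable U.
Hypothesis e0 : 0 < e.

(* The increments over the intervals of a finite disjoint family inside [U] are
   charged to absolute continuity, all others to [F]. *)
Definition charged (t : R) : Prop :=
  exists n (l r : 'I_n -> R),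
    [/\ forall i, a <= l i /\ l i <= r i /\ r i <= t,
        forall i j, i != j -> r i <= l j \/ r j <= l i,
        ((\sum_(i < n) (r i - l i))%:E <= leb (U `&` `]a, t]))%E &
        `|Phi t - Phi a| <= F t - F a + e * (t - a) +
          \sum_(i < n) `|Phi (r i) - Phi (l i)|].

Lemma charged_start : charged a.
Proof.
exists 0, (fun=> 0), (fun=> 0); split; [by case|by case| |].
  by rewrite big_ord0 measure_ge0.
by rewrite big_ord0 !subrr normr0 mulr0 !addr0.
Qed.

Let mUt t : measurable (U `&` `]a, t]).
Proof. exact: measurableI. Qed.

Lemma charged_good s t : charged s -> s <= t ->
  `|Phi t - Phi s| <= F t - F s + e * (t - s) -> charged t.
Proof.
move=> [n [l [r [lr dis sm bd]]]] st good; exists n, l, r; split => //.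
- by move=> i; have [? [? ?]] := lr i; split => //; split => //; exact: le_trans st.
- apply: (le_trans sm); apply: le_measure; rewrite ?inE; [exact: mUt|exact: mUt|].
  by move=> x [Ux]; rewrite /= !in_itv/= => /andP[ax xs]; rewrite ax (le_trans xs).
- rewrite (_ : Phi t - Phi a = (Phi t - Phi s) + (Phi s - Phi a)); last by ring.
  apply: (le_trans (ler_normD _ _)); apply: (le_trans (lerD good bd)).
  by rewrite le_eqVlt; apply/orP; left; apply/eqP; ring.
Qed.

(** The interval from [s] to [t] joins the family: it lies in [U] and to the right of all others, so
    disjointness and the length budget persist. Monotonicity of [F] lets the rest of the bound
    grow. *)
Lemma charged_in s t : charged s -> a <= s -> s <= t -> t <= b ->
  `]s, t] `<=` U -> charged t.
Proof.
move=> [n [l [r [lr dis sm bd]]]] as_ st tb sU.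
(* The old family sits at the indices below [ord_max], the new interval at [ord_max]. *)
pose ext (f : 'I_n -> R) x (i : 'I_n.+1) :=
  if unlift ord_max i is Some j then f j else x.
have extE f x j : ext f x (widen_ord (leqnSn n) j) = f j.
  rewrite /ext (_ : widen_ord _ j = lift ord_max j) ?liftK//.
  by apply/val_inj; rewrite /= /bump leqNgt ltn_ord add0n.
have extM f x : ext f x ord_max = x by rewrite /ext unlift_none.
exists n.+1, (ext l s), (ext r t); split.
- move=> i; rewrite /ext; case: unliftP => [j _|_] //.
  by have [? [? ?]] := lr j; split => //; split => //; exact: le_trans st.
- move=> i j; rewrite /ext; case: unliftP => [i' ->|->]; case: unliftP => [j' ->|->].
  + by rewrite (inj_eq lift_inj); exact: dis.
  + by move=> _; left; have [? [? ?]] := lr i'.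
  + by move=> _; right; have [? [? ?]] := lr j'.
  + by rewrite eqxx.
- rewrite big_ord_recr/= !extM; under eq_bigr do rewrite !extE.
  have -> : U `&` `]a, t] = (U `&` `]a, s]) `|` `]s, t].
    apply/seteqP; split => x /=; rewrite !in_itv/=.
      move=> [Ux /andP[ax xt]]; have [xs|sx] := leP x s; first by left; rewrite ax.
      by right; rewrite xt.
    move=> [[Ux /andP[ax xs]]|/andP[sx xt]]; first by rewrite ax (le_trans xs).
    by split; [apply: sU; rewrite /= in_itv/= sx|rewrite xt (le_lt_trans as_)].
  have mI : measurable (`]s, t] : set (measurableTypeR R)) by exact: measurable_itv.
  rewrite (measureU leb (mUt s) mI); last first.
    apply/seteqP; split => x //=; rewrite !in_itv/= => -[[_ /andP[_ xs]] /andP[sx _]].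
    by move: (lt_le_trans sx xs); rewrite ltxx.
  rewrite EFinD; apply: leeD => //.
  have lst : ((t - s)%:E <= lebesgue_measure (`]s, t] : set R))%E.
    rewrite lebesgue_measure_itv/= lte_fin; case: ltP => // ts.
    by rewrite lee_fin subr_le0.
  exact: lst.
- rewrite big_ord_recr/= !extM; under eq_bigr do rewrite !extE.
  rewrite (_ : Phi t - Phi a = (Phi s - Phi a) + (Phi t - Phi s)); last by ring.
  apply: (le_trans (ler_normD _ _)); rewrite addrA lerD2r; apply: (le_trans bd).
  by rewrite lerD2r lerD// ?lerD2r ?F_nd// ler_pM2l// lerD2r.
Qed.

End budget.

(** The null set is covered by an open [U] shorter than the modulus of absolute continuity for [e].
    Off [N] a short step obeys the derivative bound up to [e]; near a point of [N] it lies in [U]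
    and is charged to absolute continuity. A continuous induction reaches [b], and [e] tends to
    zero. *)
Lemma ac_derive_le (N : set R) : a <= b -> absolutely_continuous_on a b Phi ->
  measurable N -> leb N = 0%E ->
  (forall t, a <= t <= b -> ~ N t ->
    exists l m, [/\ is_derive t 1 Phi l, is_derive t 1 F m & `|l| <= m]) ->
  `|Phi b - Phi a| <= F b - F a.
Proof.
move=> ab ac mN N0 dPhi.
suff main e : 0 < e -> `|Phi b - Phi a| <= F b - F a + e * (b - a) + e.
  apply/ler_addgt0Pr => e e0.
  have c0 : 0 < b - a + 1 by rewrite ltr_wpDl ?subr_ge0.
  apply: (le_trans (main (e / (b - a + 1)) (divr_gt0 e0 c0))).
  rewrite -addrA lerD2l -{2}[e / _]mulr1 -mulrDr divfK ?gt_eqF//.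
move=> e0; have [d d0 dP] := ac e e0.
have [U [oU NU Ud]] : exists U : set R, [/\ open U, N `<=` U & (leb U < d%:E)%E].
  have Noo : (leb N < +oo)%E by rewrite N0.
  have [U [oU NU Ud]] := lebesgue_regularity_outer mN Noo d0.
  exists U; split=> //.
  have mU : measurable (U : set (measurableTypeR R)) by exact: open_measurable.
  have mUN := measurableD mU mN.
  apply: (@le_lt_trans _ _ (leb (U `\` N) + leb N)%E).
    apply: le_trans (measureU2 leb mUN mN); apply: le_measure; rewrite ?inE//.
      exact: measurableU.
    by move=> x Ux; have [?|?] := pselect (N x); [right|left].
  by rewrite N0 adde0.
have mU : measurable U by exact: open_measurable.
pose good s t := `|Phi t - Phi s| <= F t - F s + e * (t - s).
have loc t : a <= t <= b -> exists2 h, 0 < h &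
    (forall s, a <= s -> s <= t -> t - h < s -> good s t \/ `]s, t] `<=` U) /\
    (forall s, s <= b -> t <= s -> s < t + h -> good t s \/ `]t, s] `<=` U).
  move=> tab; have [Nt|nN] := pselect (N t).
    have [h /= h0 hU] : nbhs t U by apply: open_nbhs_nbhs; split => //; exact: NU.
    exists h => //; split => s _ st ts; right => x /=; rewrite in_itv/= => /andP[x1 x2];
      apply: hU => /=.
      by rewrite ger0_norm ?subr_ge0//; lra.
    by rewrite ltr0_norm ?subr_lt0//; lra.
  have [l [m [dl dm lm]]] := dPhi t tab nN.
  have e2 : 0 < e / 2 by rewrite divr_gt0.
  have [h1 h10 H1] := derive_approx e2 dl; have [h2 h20 H2] := derive_approx e2 dm.
  exists (Num.min h1 h2); first by rewrite lt_min h10.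
  split => s _ st; rewrite -?ltrBlDl => ts; left.
    have ts' : `|s - t| < Num.min h1 h2 by rewrite ler0_norm ?subr_le0//; lra.
    move: ts'; rewrite lt_min => /andP[/H1 k1 /H2 k2].
    rewrite /good distrC.
    have : `|Phi s - Phi t| <= `|Phi s - Phi t - l * (s - t)| + `|l * (s - t)|.
      by apply: le_trans (ler_normD _ _); rewrite subrK.
    move: k1 k2; rewrite normrM !(distrC s t) (ger0_norm (_ : 0 <= t - s)) ?subr_ge0//.
    move=> k1; rewrite ler_norml => /andP[k2 k2'] k3.
    have : `|l| * (t - s) <= m * (t - s) by rewrite ler_wpM2r ?subr_ge0.
    move: k1 k2 k2' k3; set A := `|_ - l * _|; set P := `|Phi s - _|; set Q := `|l| * _.
    clearbody A P Q; move=> *; nra.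
  have ts' : `|s - t| < Num.min h1 h2 by rewrite ger0_norm ?subr_ge0.
  move: ts'; rewrite lt_min => /andP[/H1 k1 /H2 k2].
  rewrite /good.
  have : `|Phi s - Phi t| <= `|Phi s - Phi t - l * (s - t)| + `|l * (s - t)|.
    by apply: le_trans (ler_normD _ _); rewrite subrK.
  move: k1 k2; rewrite normrM (ger0_norm (_ : 0 <= s - t)) ?subr_ge0//.
  move=> k1; rewrite ler_norml => /andP[k2 k2'] k3.
  have : `|l| * (s - t) <= m * (s - t) by rewrite ler_wpM2r ?subr_ge0.
  move: k1 k2 k2' k3; set A := `|_ - l * _|; set P := `|Phi s - _|; set Q := `|l| * _.
  clearbody A P Q; move=> *; nra.
have step s t : a <= s -> s <= t -> t <= b -> charged U e s ->
    good s t \/ `]s, t] `<=` U -> charged U e t.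
  by move=> as_ st tb cs [g|sU]; [exact: charged_good g|exact: charged_in sU].
(* Continuous induction: the supremum of the charged times is charged by the left half of [loc], and
   if it were below [b] the right half would lead beyond it. *)
have cb : charged U e b.
  pose S := [set t | a <= t <= b /\ charged U e t].
  have Sa : S a by split; [rewrite lexx|exact: charged_start].
  have hS : has_sup S by split; [exists a|exists b => t [/andP[]]].
  set T := sup S.
  have aT : a <= T by apply: sup_upper_bound.
  have Tb : T <= b by apply: ge_sup => [|t [/andP[]]]//; exists a.
  have [h h0 [hl hr]] : exists2 h, 0 < h &
    (forall s, a <= s -> s <= T -> T - h < s -> good s T \/ `]s, T] `<=` U) /\
    (forall s, s <= b -> T <= s -> s < T + h -> good T s \/ `]T, s] `<=` U).
    by apply: loc; rewrite aT.
  have [s [/andP[as_ sb] cs] Ths] := sup_adherent h0 hS.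
  have sT : s <= T by apply: sup_upper_bound => //; split => //; rewrite as_.
  have cT : charged U e T by apply: step cs _ => //; exact: hl.
  have [Tb'|] := ltP T b; last first.
    by move=> bT; rewrite (_ : b = T)//; apply/eqP; rewrite eq_le Tb bT.
  pose t := Num.min (T + h / 2) b.
  have h2 : 0 < h / 2 by rewrite divr_gt0.
  have Tt : T < t by rewrite lt_min Tb' ltrDl h2.
  have tb : t <= b by rewrite ge_min lexx orbT.
  have tT : t < T + h.
    by apply: (@le_lt_trans _ _ (T + h / 2)); [rewrite ge_min lexx|rewrite ltrD2l; lra].
  have ct : charged U e t by apply: (step T) => //; [exact: ltW|apply: hr => //; exact: ltW].
  have : t <= T.
    by apply: sup_upper_bound => //; split => //; rewrite tb (le_trans aT (ltW Tt)).
  by rewrite leNgt Tt.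
have [n [l [r [lr dis sm bd]]]] := cb.
apply: (le_trans bd); rewrite lerD2l ltW//; apply: dP => //.
rewrite -lte_fin; apply: (le_lt_trans sm); apply: le_lt_trans Ud.
by apply: le_measure; rewrite ?inE//; exact: measurableI.
Qed.

End mean_value.
End absolute_continuity.

Section ac_integral.
Variable R : realType.
Local Notation leb := (@lebesgue_measure R).

(** If the integral of the majorant is finite, let [F] be the primitive of its finite part: it is
    nondecreasing and differentiable at the Lebesgue points, so the mean value inequality applies
    off a null set. *)
Lemma ac_integral_le (Phi : R -> R) (g : R -> \bar R) (a b : R) (N0 : set R) :
  a <= b -> absolutely_continuous_on a b Phi ->
  measurable_fun [set: R] g -> (forall t, 0 <= g t)%E -> leb.-negligible N0 ->
  (forall t, a < t < b -> ~ N0 t -> exists2 l, is_derive t 1 Phi l & (`|l|%:E <= g t)%E) ->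
  (`|Phi b - Phi a|%:E <= \int[leb]_(t in `[a, b]) g t)%E.
Proof.
move=> ab ac mg g0 nN0 dPhi.
have [->|goo] := eqVneq (\int[leb]_(t in `[a, b]) g t)%E +oo%E; first by rewrite leey.
have iab0 : (0 <= \int[leb]_(t in `[a, b]) g t)%E by exact: integral_ge0.
pose gr := g \_ `[a, b].
have mgr : measurable_fun [set: R] gr.
  by apply/(measurable_restrictT _ _).1 => //; exact: measurable_funTS.
have gr0 t : (0 <= gr t)%E by rewrite /gr patchE; case: ifPn.
have igr : leb.-integrable [set: R] gr.
  apply/integrableP; split => //.
  rewrite (_ : (fun x => `|gr x|)%E = gr); last by apply/funext => t; rewrite gee0_abs.
  by move: goo iab0; rewrite integral_mkcond -ltey.
pose G := fine \o gr.
have mG : measurable_fun [set: R] G by exact: measurableT_comp.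
have G0 t : 0 <= G t by exact: fine_ge0.
have fin_ae : {ae leb, forall t, [set: R] t -> gr t \is a fin_num} by exact: integrable_ae.
have Gle t : ((G t)%:E <= gr t)%E.
  by rewrite /G /=; case: (gr t) (gr0 t) => //= _; rewrite leey.
have iG : leb.-integrable [set: R] (EFin \o G).
  apply: le_integrable igr => //; first exact/measurable_EFinP.
  by move=> t _; rewrite /= ger0_norm ?G0// gee0_abs.
have iGs (A : set R) : measurable A -> leb.-integrable A (EFin \o G).
  by move=> mA; apply: integrableS iG.
pose F t := \int[leb]_(r in `]-oo, t]) G r.
have FB s t : s <= t -> F t - F s = \int[leb]_(r in `]s, t]) G r.
  by move=> st; rewrite /F Rintegral_itvB ?bnd_simp//; exact: iGs.
have lG : locally_integrable [set: R] G.
  by apply: open_integrable_locally => //; exact: openT.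
(* The exceptional set also collects the points where the majorant is infinite, the non-Lebesgue
   points, and the two endpoints, at which the derivative hypothesis says nothing. *)
have : leb.-negligible (N0 `|` ([set t | ~ ([set: R] t -> gr t \is a fin_num)] `|`
    ([set t | ~ lebesgue_pt G t] `|` ([set a] `|` [set b])))).
  apply: negligibleU => //; apply: negligibleU; first exact: fin_ae.
  apply: negligibleU; first exact: lebesgue_differentiation.
  by apply: negligibleU; apply/negligibleP => //; exact: lebesgue_measure_set1.
move=> [N [mN N_0 NS]].
have le : `|Phi b - Phi a| <= F b - F a.
  apply: (@ac_derive_le _ _ _ _ _ _ N) => //.
    by move=> s t _ st _; rewrite -subr_ge0 FB//; exact: Rintegral_ge0.
  move=> t /andP[at_ tb] nNt.
  have /not_orP[nN0t /not_orP[/contrapT fint /not_orP[/contrapT lp /not_orP[ta tb']]]] :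
    ~ (N0 `|` ([set t | ~ ([set: R] t -> gr t \is a fin_num)] `|`
    ([set t | ~ lebesgue_pt G t] `|` ([set a] `|` [set b])))) t by move=> /NS.
  have {}at_ : a < t by rewrite lt_neqAle at_ andbT eq_sym; apply/eqP.
  have {}tb : t < b by rewrite lt_neqAle tb andbT; apply/eqP.
  have [l dl lg] : exists2 l, is_derive t 1 Phi l & (`|l|%:E <= g t)%E.
    by apply: dPhi => //; rewrite at_.
  exists l, (G t); split => //.
    have [dF F'] := FTC1_lebesgue_pt (u := t + 1) (f := G) (a := -oo%O) (x := t)
      ltac:(by rewrite ltrDl) (iGs _ (measurable_itv _)) (ltNyr _) lp.
    by apply: DeriveDef; [exact: dF|rewrite -F' derive1E].
  rewrite -lee_fin /G/= fineK; last exact: fint.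
  by rewrite /gr patchE mem_set//= in_itv/= !ltW.
apply: (@le_trans _ _ (F b - F a)%:E); first by rewrite lee_fin.
rewrite FB// /Rintegral fineK; last first.
  apply: (integrable_fin_num (mu := leb)) => //; apply: iGs; exact: measurable_itv.
rewrite [leRHS]integral_mkcond -/gr.
rewrite [leLHS]integral_mkcond; apply: ge0_le_integral => //.
- by move=> t _; rewrite patchE; case: ifPn => // _; rewrite lee_fin.
- apply/(measurable_restrictT _ _).1 => //; apply: measurable_funTS.
  exact/measurable_EFinP.
- move=> t _; rewrite patchE; case: ifPn => // _; exact: Gle.
Qed.

End ac_integral.

Lemma is_derive_along (R : realType) (g : R * R -> R) (x w : R * R) (t l : R) :
  is_derive (x + t *: w) w g l -> is_derive t 1 (fun s => g (x + s *: w)) l.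
Proof.
move=> [dg gl].
have E : (fun h : R => h^-1 *: (((fun s => g (x + s *: w)) \o shift t) (h *: 1) -
      g (x + t *: w))) =
    (fun h : R => h^-1 *: ((g \o shift (x + t *: w)) (h *: w) - g (x + t *: w))).
  apply/funext => h /=; congr (_ *: (g _ - _)).
  have -> : h *: (1 : R) = h by rewrite /GRing.scale/= mulr1.
  by rewrite scalerDl addrCA.
by apply: DeriveDef; rewrite /derivable /derive E.
Qed.

Section ac_operations.
Variables (R : realType) (a b : R).
Implicit Types g k : R -> R.

Lemma acB g k : absolutely_continuous_on a b g -> absolutely_continuous_on a b k ->
  absolutely_continuous_on a b (fun t => g t - k t).
Proof.
move=> ag ak e e0; have e2 : 0 < e / 2 by rewrite divr_gt0.
have [d1 d10 D1] := ag _ e2; have [d2 d20 D2] := ak _ e2.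
exists (Num.min d1 d2); first by rewrite lt_min d10.
move=> n l r lr dis; rewrite lt_min => /andP[/(D1 n l r lr dis) s1 /(D2 n l r lr dis) s2].
rewrite [e]splitr; apply: le_lt_trans (ltrD s1 s2).
rewrite -big_split/=; apply: ler_sum => i _.
rewrite (_ : _ - _ = (g (r i) - g (l i)) - (k (r i) - k (l i))); last by ring.
exact: ler_normB.
Qed.

Lemma ac_bounded g : a <= b -> absolutely_continuous_on a b g ->
  exists M, forall t, a <= t <= b -> `|g t| <= M.
Proof.
(* Clamping to the interval gives a function continuous on the whole line, to which the extreme
   value theorem applies. *)
move=> ab ag; pose cl (t : R) := Num.max a (Num.min t b).
have clP t : a <= cl t <= b by rewrite /cl le_max lexx/= ge_max ab ge_min lexx orbT.
have clE t : a <= t <= b -> cl t = t.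
  by move=> /andP[at_ tb]; rewrite /cl (min_idPl tb) (max_idPr at_).
have cl_le p q : p <= q -> (cl p <= cl q) && (cl q - cl p <= q - p).
  move=> pq; apply/andP; rewrite /cl; split; move: pq ab;
  case: (leP p b); case: (leP q b); case: (leP a p); case: (leP a q); case: (leP a b); lra.
have cg : continuous (fun t => `|g (cl t)|).
  move=> t; apply: cvg_norm; apply/cvgrPdist_lt => e e0.
  have [d d0 dP] := ag e e0; exists d => // s; rewrite /= => ts.
  have key p q : p <= q -> q - p < d -> `|g (cl q) - g (cl p)| < e.
    move=> pq qp; have := dP 1 (fun=> cl p) (fun=> cl q).
    rewrite !big_ord1; apply.
    - move=> _; have /andP[? _] := clP p; have /andP[_ ?] := clP q; split=> //; split=> //.
      by have /andP[] := cl_le p q pq.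
    - by move=> i j; rewrite !ord1 eqxx.
    - by apply: le_lt_trans qp; have /andP[] := cl_le p q pq.
  have [st|st] := leP s t.
    by apply: key => //; move: ts; rewrite ger0_norm ?subr_ge0.
  by rewrite distrC; apply: key (ltW st) _; move: ts; rewrite ltr0_norm ?subr_lt0// opprB.
have [c _ cM] := EVT_max ab (continuous_subspaceT cg).
exists `|g (cl c)| => t tab; have := cM t; rewrite clE//; apply.
by rewrite in_itv.
Qed.

Lemma ac_mul_lipschitz g k (M : R) : a <= b -> absolutely_continuous_on a b g ->
  (forall t, a <= t <= b -> `|k t| <= M) ->
  (forall s t, a <= s -> s <= t -> t <= b -> `|k t - k s| <= M * (t - s)) ->
  absolutely_continuous_on a b (fun t => k t * g t).
Proof.
move=> ab ag kM kL e e0; have [B gB] := ac_bounded ab ag.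
have M0 : 0 <= M by apply: le_trans (kM a _); rewrite ?lexx.
have B0 : 0 <= B by apply: le_trans (gB a _); rewrite ?lexx.
have M1 : 0 < M + 1 by rewrite ltr_wpDl.
have e1 : 0 < e / 2 / (M + 1) by rewrite !divr_gt0.
have [d d0 dP] := ag _ e1.
have c0 : 0 < M * B + 1 by rewrite ltr_wpDl ?mulr_ge0.
exists (Num.min d (e / 2 / (M * B + 1))); first by rewrite lt_min d0 !divr_gt0.
move=> n l r lr dis; rewrite lt_min => /andP[/(dP n l r lr dis) s1 s2].
apply: (@le_lt_trans _ _ (M * \sum_(i < n) `|g (r i) - g (l i)| +
    M * B * \sum_(i < n) (r i - l i))).
  rewrite !mulr_sumr -big_split/=; apply: ler_sum => i _.
  have [al [lri rb]] := lr i.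
  rewrite (_ : _ - _ = k (r i) * (g (r i) - g (l i)) + (k (r i) - k (l i)) * g (l i));
    last by ring.
  apply: (le_trans (ler_normD _ _)); rewrite !normrM; apply: lerD.
    by rewrite ler_wpM2r// kM// rb (le_trans al).
  rewrite mulrAC; apply: ler_pM => //; first exact: kL.
  by rewrite gB// al (le_trans lri).
have S0 : 0 <= \sum_(i < n) (r i - l i).
  by apply: sumr_ge0 => i _; have [_ [? _]] := lr i; rewrite subr_ge0.
rewrite [e]splitr; apply: ltrD.
  apply: (@le_lt_trans _ _ ((M + 1) * \sum_(i < n) `|g (r i) - g (l i)|)).
    by rewrite ler_wpM2r ?lerDl// sumr_ge0.
  by rewrite mulrC -ltr_pdivlMr.
apply: (@le_lt_trans _ _ ((M * B + 1) * \sum_(i < n) (r i - l i))).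
  by rewrite ler_wpM2r ?lerDl.
by rewrite mulrC -ltr_pdivlMr.
Qed.

End ac_operations.

Section uniqueness.
Variables (R : realType) (Omega : set (R * R)) (L eps : R).
Hypotheses (Omega_open : open Omega) (Omega_convex : convex_set Omega).
Hypotheses (Omega_bounded : bounded_set Omega) (Omega_C3 : C3_boundary Omega).
Hypotheses (L0 : 0 < L).
Hypothesis HD : forall x y, Omega x -> Omega y -> dot (x - y) (x - y) <= L ^+ 2.
Hypothesis eps0 : 0 < eps.
Hypothesis finOmega : (@lam2 R Omega < +oo)%E.
Variables (f h u v : (R * R) * (R * R) -> R) (M : R).
Hypotheses (mu : measurable_fun [set: (R * R) * (R * R)] u) (uM : forall z, `|u z| <= M).
Hypotheses (tu : transport_solution Omega eps f h u)
  (tv : transport_solution Omega eps f h v).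

Let D : set ((R * R) * (R * R)) := Omega `*` @S1 R.
Let mD : measurable D := measurable_phase Omega_open.
Let mOmega : measurable Omega := measurable_Omega Omega_open.
Let M0 : 0 <= M. Proof. exact: le_trans (normr_ge0 _) (uM ((0, 0), (0, 0))). Qed.

Let vD := v \_ D.
Let mvD : measurable_fun [set: (R * R) * (R * R)] vD.
Proof. by apply/(measurable_restrictT _ _).1 => //; have [] := tv. Qed.

Let gap := (fun z => v z - u z) \_ D.
Let mgap : measurable_fun [set: (R * R) * (R * R)] gap.
Proof.
apply/(measurable_restrictT _ _).1 => //; apply: measurable_funB.
  by have [] := tv.
exact: measurable_funTS.
Qed.
Let gapE z : D z -> gap z = v z - u z. Proof. by move=> Dz; rewrite /gap patchE mem_set. Qed.

Let Delta z : \bar R := `|gap z|%:E.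
Let mDelta : measurable_fun [set: (R * R) * (R * R)] Delta.
Proof. by apply/measurable_EFinP; exact: measurableT_comp. Qed.
Let Delta0 z : (0 <= Delta z)%E. Proof. by rewrite lee_fin. Qed.

Let A (x : R * R) : \bar R := avg (fun w => Delta (x, w)).
Let mA : measurable_fun [set: R * R] A := measurable_avg mDelta Delta0.
Let A0 x : (0 <= A x)%E. Proof. exact: avg_ge0. Qed.

Let A_out x : ~ Omega x -> A x = 0%E.
Proof.
move=> nO; rewrite /A (_ : (fun w => Delta (x, w)) = fun=> 0%:E) ?avg_cst//.
by apply/funext => w; rewrite /Delta /gap patchE memNset ?normr0// => -[].
Qed.

(* Where [v x] is not integrable, [A x] is infinite because [u] is bounded. *)
Lemma velocity_average_gap x : Omega x ->
  (`|velocity_average v x - velocity_average u x|%:E <= A x)%E.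
Proof.
move=> Ox; have [->|Aoo] := eqVneq (A x) +oo%E; first by rewrite leey.
have mgx : measurable_fun [set: R * R] (fun w => gap (x, w)).
  exact: measurableT_comp mgap (pair1_measurable x).
have pi0 : 0 < (2 * pi)^-1 :> R by rewrite invr_gt0 mulr_gt0// pi_gt0.
have ig : (@circle_measure R).-integrable [set: R * R] (EFin \o (fun w => gap (x, w))).
  apply/integrableP; split; first exact/measurable_EFinP.
  rewrite ltey; apply: contra_neq Aoo => ioo.
  by rewrite /A /avg [X in (_ * X)%E]ioo gt0_muley// lte_fin.
have mS := @measurable_S1 R.
have igS : (@circle_measure R).-integrable (@S1 R) (EFin \o (fun w => gap (x, w))).
  exact: integrableS ig.
have iuS : (@circle_measure R).-integrable (@S1 R) (EFin \o (fun w => u (x, w))).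
  exact: (bounded_circle_integrable (measurableT_comp mu (pair1_measurable x))
    (fun w => uM (x, w))).
have -> : velocity_average v x - velocity_average u x =
    (2 * pi)^-1 * \int[@circle_measure R]_(w in @S1 R) gap (x, w).
  rewrite /velocity_average -mulrBr; congr (_ * _).
  rewrite [X in X - _](_ : _ = \int[@circle_measure R]_(w in @S1 R) (gap (x, w) + u (x, w))).
    by rewrite RintegralD// addrK.
  by apply: eq_Rintegral => w; rewrite inE => w1; rewrite gapE// subrK.
rewrite normrM (gtr0_norm pi0) EFinM /A /avg lee_wpmul2l ?lee_fin ?(ltW pi0)//.
rewrite EFin_normr_Rintegral//; apply: le_trans (le_abse_integral _ _ _) _ => //.
  by apply: measurable_funTS; exact/measurable_EFinP.
apply: ge0_subset_integral => //.
by apply: measurableT_comp => //; exact/measurable_EFinP.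
Qed.

Definition solves z : Prop := forall g, (g = u \/ g = v) -> D z ->
  derivable (fun y => g (y, z.2)) z.1 z.2 /\
  eps * 'D_z.2 (fun y => g (y, z.2)) z.1 + g z - velocity_average g z.1 = f z.

Lemma ae_solves : {ae @phase_measure R, forall z, solves z}.
Proof.
have [_ _ _ du _] := tu; have [_ _ _ dv _] := tv.
by apply: phase_aeS (phase_aeI du dv) => -[x w] [pu pv] g [->|->] Dz;
  [exact: pu|exact: pv].
Qed.

Let mAf := measurable_fst_comp mA.
Let Af0 (z : (R * R) * (R * R)) : (0 <= (A \o fst) z)%E := A0 _.

(** On almost every line exp(t/eps) (v - u) is absolutely continuous; [f] cancels and the derivative
    is exp(t/eps) times the difference of the averages over eps. Integrating from the entry point,
    where both functions have the limit [h], produces the density of a backward flight. *)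
Lemma gap_le_flight : {ae @phase_measure R, forall z, D z ->
  (Delta z <= flight eps (-1) (A \o fst) z)%E}.
Proof.
have [N [mN N0 NS]] := ae_solves.
have [_ _ au _ lu] := tu; have [_ _ av _ lv] := tv.
apply: phase_aeS (phase_aeI (phase_aeI au av) (phase_aeI (phase_aeI lu lv) (flow_ae mN N0))).
move=> -[x w] [[acu acv] [[limu limv] Nline]] Dz; have [/= Ox w1] := Dz.
have {}acu := acu Dz; have {}acv := acv Dz; have {}limu := limu Dz; have {}limv := limv Dz.
pose phi t := v (x + t *: w, w) - u (x + t *: w, w).
pose k t := expR (eps^-1 * t).
have e0 : 0 < eps^-1 by rewrite invr_gt0.
have tau0 := exit_time_gt0 Omega_open Omega_convex Omega_bounded Ox w1.
set tau := exit_time Omega x w in tau0.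
have OP t : t <= 0 -> - tau < t -> Omega (x + t *: w).
  move=> t0 tt; have t0' : 0 <= - t by rewrite oppr_ge0.
  rewrite -[t]opprK scaleNr.
  by apply/(exit_timeP Omega_open Omega_convex Omega_bounded Ox w1 t0'); rewrite ltrNl.
(* Absolute continuity is granted on closed intervals inside [Omega] only, so the integration starts
   at [c], which is sent to the entry time afterwards. *)
have bound c : - tau < c -> c < 0 ->
    (Delta (x, w) <= `|phi c|%:E + flight eps (-1) (A \o fst) (x, w))%E.
  move=> tc c0.
  pose g t := ((eps^-1 * k t)%:E * A (x + t *: w)%R)%E.
  have g0 t : (0 <= g t)%E by rewrite mule_ge0// lee_fin mulr_ge0 ?expR_ge0// ltW.
  have mline : measurable_fun [set: R] (fun t : R => (x + t *: w : R * R)).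
    exact: (measurableT_comp measurable_fst (measurable_flow_time (x, w))).
  have mk : measurable_fun [set: R] k.
    by apply: measurableT_comp => //; apply: measurable_funM => //; exact: measurable_cst.
  have mg : measurable_fun [set: R] g.
    apply: emeasurable_funM; last exact: (measurableT_comp mA mline).
    by apply/measurable_EFinP; apply: measurable_funM => //; exact: measurable_cst.
  have Oc t : c <= t <= 0 -> Omega (x + t *: w).
    by move=> /andP[ct t0]; apply: OP => //; exact: lt_le_trans ct.
  have acphi : absolutely_continuous_on c 0 phi.
    by apply: acB; [exact: acv|exact: acu].
  have ackphi : absolutely_continuous_on c 0 (fun t => k t * phi t).
    (* One constant serves twice: for t <= 0 the factor [k] is at most 1 and has Lipschitz constant
       1/eps. *)
    apply: (@ac_mul_lipschitz _ _ _ _ _ (1 + eps^-1)) => //; first exact: ltW.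
    - move=> t /andP[_ t0]; rewrite ger0_norm ?expR_ge0// ler_wpDr ?(ltW e0)//.
      by rewrite -expR0 ler_expR pmulr_rle0.
    - move=> s t _ st t0.
      rewrite /k ger0_norm; last by rewrite subr_ge0 ler_expR ler_pM2l.
      have -> : expR (eps^-1 * t) - expR (eps^-1 * s) =
          expR (eps^-1 * t) * (1 - expR (- (eps^-1 * (t - s)))).
        rewrite mulrBr mulr1 -expRD; congr (_ - expR _); ring.
      have q1 : 1 - expR (- (eps^-1 * (t - s))) <= eps^-1 * (t - s).
        by rewrite lerBlDl -lerBlDr; exact: expR_ge1Dx.
      have q2 : 0 <= 1 - expR (- (eps^-1 * (t - s))).
        by rewrite subr_ge0 -expR0 ler_expR oppr_le0 mulr_ge0 ?subr_ge0// ltW.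
      have q3 : expR (eps^-1 * t) <= 1 by rewrite -expR0 ler_expR pmulr_rle0.
      apply: (le_trans (ler_wpM2r q2 q3)); rewrite mul1r; apply: (le_trans q1).
      by rewrite mulrDl mul1r lerDr subr_ge0.
  have negN : (@lebesgue_measure R).-negligible ((fun t => flow t (x, w)) @^-1` N).
    by apply/negligibleP => //; exact: measurable_flow_preimage.
  have est := ac_integral_le (ltW c0) ackphi mg g0 negN.
  have {est} est : (`|k 0 * phi 0 - k c * phi c|%:E <=
      \int[@lebesgue_measure R]_(t in `[c, 0%R]) g t)%E.
    apply: est => t /andP[ct t0] nNt.
    have Ot : Omega (x + t *: w) by apply: Oc; rewrite !ltW.
    have sol : solves (flow t (x, w)) by apply: contrapT => ns; apply: nNt; exact: NS.
    have Dt : D (flow t (x, w)) by [].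
    have [dv ev] := sol v (or_intror erefl) Dt.
    have [du eu] := sol u (or_introl erefl) Dt.
    have iv := is_derive_along (DeriveDef dv erefl).
    have iu := is_derive_along (DeriveDef du erefl).
    rewrite /= in iv iu ev eu.
    exists (eps^-1 * k t * (velocity_average v (x + t *: w) - velocity_average u (x + t *: w))).
      apply: is_derive_eq.
      rewrite /GRing.scale/= /phi /k.
      move: ev eu; rewrite /flow/=.
      set dV := 'D_w _ _; set dU := 'D_w _ _ => ev eu.
      have -> : velocity_average v (x + t *: w) - velocity_average u (x + t *: w) =
         eps * (dV - dU) + (v (x + t *: w, w) - u (x + t *: w, w)) by lra.
      by field; rewrite gt_eqF.
    rewrite normrM ger0_norm; last by rewrite mulr_ge0 ?expR_ge0// ltW.
    rewrite EFinM; apply: lee_wpmul2l; last exact: velocity_average_gap.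
    by rewrite lee_fin mulr_ge0 ?expR_ge0// ltW.
  have k0 : k 0 = 1 by rewrite /k mulr0 expR0.
  have kc : `|k c| <= 1.
    by rewrite ger0_norm ?expR_ge0// -expR0 ler_expR pmulr_rle0// ltW.
  have fl : (\int[@lebesgue_measure R]_(t in `[c, 0%R]) g t <=
      flight eps (-1) (A \o fst) (x, w))%E.
    pose G t := ((free_path eps (- t))%:E * A (x + t *: w)%R)%E.
    have mG : measurable_fun [set: R] G.
      apply: emeasurable_funM; last exact: (measurableT_comp mA mline).
      by apply/measurable_EFinP; apply: (measurableT_comp (measurable_free_path eps)).
    have G0 t : (0 <= G t)%E by rewrite mule_ge0// lee_fin free_path_ge0.
    have -> : flight eps (-1) (A \o fst) (x, w) = (\int[@lebesgue_measure R]_t G t)%E.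
      rewrite -[RHS](integral_reflect 0 mG G0); apply: eq_integral => s _.
      by rewrite /G sub0r opprK /= mulN1r.
    rewrite integral_mkcond; apply: ge0_le_integral => //.
    - by move=> t _; rewrite patchE; case: ifPn.
    - by apply/(measurable_restrictT _ _).1 => //; exact: measurable_funTS.
    - move=> t _; rewrite patchE; case: ifPn => //; rewrite inE/= in_itv/= => /andP[_ t0].
      rewrite /g /G /free_path exponential_pdfE ?oppr_ge0//.
      by rewrite /k mulrN mulNr opprK.
  rewrite /Delta gapE//.
  have -> : v (x, w) - u (x, w) = (k 0 * phi 0 - k c * phi c) + k c * phi c.
    by rewrite subrK k0 mul1r /phi scale0r addr0.
  apply: (@le_trans _ _ (`|k 0 * phi 0 - k c * phi c|%:E + `|k c * phi c|%:E)%E).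
    by rewrite -EFinD lee_fin ler_normD.
  rewrite addeC; apply: leeD; last exact: le_trans est fl.
  by rewrite lee_fin normrM ler_piMl.
have Gt := exit_Gamma_minus Omega_open Omega_convex Omega_bounded Omega_C3 Ox w1.
rewrite -scaleNr -/tau in Gt.
have lim0 : phi s @[s --> (- tau)^'+] --> 0.
  by rewrite -(subrr (h (x + (- tau) *: w, w))); apply: cvgB; [exact: limv|exact: limu].
apply/lee_addgt0Pr => e e1.
have [c [tc c0 ce]] : exists c, [/\ - tau < c, c < 0 & `|phi c| < e].
  have /cvgr0Pnorm_lt/(_ e e1) near0 := lim0.
  near (- tau)^'+ => c; exists c; split; near: c => //.
    exact: nbhs_right_gt.
  by apply: nbhs_right_lt; rewrite oppr_lt0.
apply: (le_trans (bound c tc c0)); rewrite addeC leeD2l// lee_fin ltW//.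
Unshelve. all: by end_near. Qed.

Let pi0 : 0 < (2 * pi)^-1 :> R. Proof. by rewrite invr_gt0 mulr_gt0// pi_gt0. Qed.

Let mone : measurable_fun [set: R * R] (fun=> 1%E : \bar R).
Proof. exact: measurable_cst. Qed.

Let integral_A : (\int[@lam2 R]_x A x =
  ((2 * pi)^-1)%:E * \int[@phase_measure R]_z Delta z)%E.
Proof.
transitivity (\int[@lam2 R]_x (1 * A x))%E; first by apply: eq_integral => x _; rewrite mul1e.
rewrite (phase_avg mDelta Delta0 mone)//; congr (_ * _)%E.
by apply: eq_integral => z _; rewrite mul1e.
Qed.

(** [u] is bounded and [v] square integrable; on a set of finite measure |v| <= v^2 + 1 makes the
    gap integrable. Only a finite r with r <= q r and q < 1 has to be zero. *)
Let integral_Delta_fin : (\int[@phase_measure R]_z Delta z < +oo)%E.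
Proof.
have [_ v2 _ _ _] := tv.
have finD := finite_phase Omega_open finOmega.
pose vs z : \bar R := (`|vD z| ^+ 2)%:E.
have mvs : measurable_fun [set: (R * R) * (R * R)] vs.
  apply/measurable_EFinP; apply: measurable_funX; exact: measurableT_comp.
have Iv : (\int[@phase_measure R]_z vs z < +oo)%E.
  have n2 : (2 : R) != 0 by [].
  have := poweR_lty 2 v2; rewrite /phase_norm poweR_Lnorm//; apply: le_lt_trans.
  rewrite le_eqVlt; apply/orP; left; apply/eqP; apply: eq_integral => z _.
  rewrite /vs /vD !patchE; case: ifPn => _ /=; first by rewrite powR_mulrn.
  by rewrite normr0 expr0n/= powR0.
pose cD z : \bar R := ((1 + M) * \1_D z)%:E.
have mcD : measurable_fun [set: (R * R) * (R * R)] cD.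
  apply/measurable_EFinP; apply: measurable_funM; first exact: measurable_cst.
  exact: measurable_indic.
have cD0 z : (0 <= cD z)%E by rewrite lee_fin mulr_ge0 ?addr_ge0.
have vs0 z : (0 <= vs z)%E by rewrite lee_fin.
apply: (@le_lt_trans _ _ (\int[@phase_measure R]_z (vs z + cD z))%E).
  apply: ge0_le_integral => //; first exact: emeasurable_funD.
  move=> z _; rewrite /Delta /vs /cD -EFinD lee_fin /gap /vD !patchE indicE.
  case: ifPn => _; last by rewrite !normr0 mulr0 addr0 sqr_ge0.
  rewrite mulr1; apply: (le_trans (ler_normB _ _)); rewrite addrA lerD//.
  by have := normr_ge0 (v z); set n := `|v z|; clearbody n => n0; nra.
rewrite ge0_integralD// lte_add_pinfty//.
have mi : measurable_fun [set: (R * R) * (R * R)] (fun z => (\1_D z : R)%:E).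
  by apply/measurable_EFinP; exact: measurable_indic.
have M1 : 0 <= 1 + M by rewrite addr_ge0.
have i0 z (_ : [set: (R * R) * (R * R)] z) : (0 <= (\1_D z : R)%:E)%E by rewrite lee_fin.
have := ge0_integralZl_EFin (@phase_measure R) measurableT i0 mi M1.
rewrite integral_indic// setIT => cDE.
apply: (@le_lt_trans _ _ ((1 + M)%:E * phase_measure D)%E).
  by rewrite le_eqVlt; apply/orP; left; apply/eqP; exact: cDE.
by apply: lte_mul_pinfty; rewrite ?lee_fin.
Qed.

Lemma transport_solution_unique : {ae @phase_measure R, forall z, D z -> v z = u z}.
Proof.
have mI := measurable_indic_Omega mOmega.
pose I1 (x : R * R) : \bar R := (\1_Omega x)%:E.
have I10 x : (0 <= I1 x)%E by rewrite lee_fin.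
pose T := flight eps (-1) (A \o fst).
have mT : measurable_fun [set: (R * R) * (R * R)] T := measurable_flight eps0 (-1) mAf Af0.
have T0 z : (0 <= T z)%E := flight_ge0 eps0 (-1) Af0 z.
pose q := 1 - escape eps L.
have step1 : (\int[@phase_measure R]_z Delta z <=
    \int[@phase_measure R]_z (I1 z.1 * T z))%E.
  apply: ae_ge0_le_integral => //.
  - by move=> z _; apply: mule_ge0.
  - by apply: emeasurable_funM => //; exact: (measurable_fst_comp mI).
  apply: phase_aeS gap_le_flight => z zP _.
  have [Dz|nD] := pselect (D z); last first.
    by rewrite /Delta /gap patchE memNset// normr0 mule_ge0.
  by rewrite /I1 indicE mem_set ?mul1e; [exact: zP|have [] := Dz].
have step2 : (\int[@lam2 R]_x A x <= \int[@lam2 R]_x (A x * scatter eps 1 I1 x))%E.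
  rewrite -[X in scatter _ X](opprK 1) -(scatter_duality eps0 (-1) mA mI A0 I10).
  rewrite integral_A /scatter (phase_avg mT T0 mI I10).
  by apply: lee_wpmul2l => //; rewrite lee_fin ltW.
have q0 : 0 <= q by rewrite subr_ge0 -expR0 ler_expR mulNr oppr_le0 mulr_ge0 ?invr_ge0 ?ltW.
have step3 : (\int[@lam2 R]_x (A x * scatter eps 1 I1 x) <= q%:E * \int[@lam2 R]_x A x)%E.
  have mS : measurable_fun [set: R * R] (scatter eps 1 I1).
    exact: measurable_avg (measurable_flight eps0 1 (measurable_fst_comp mI)
      (fun z => I10 z.1)) (fun z => flight_ge0 eps0 1 (fun z => I10 z.1) z).
  have S0 x : (0 <= scatter eps 1 I1 x)%E by exact: (scatter_ge0 eps0 1 x I10).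
  rewrite -(lam2Zl mA A0 q0); apply: lam2_le.
  - exact: emeasurable_funM.
  - exact: measurable_funeM.
  - by move=> x; exact: mule_ge0.
  move=> x; have [Ox|nO] := pselect (Omega x); last by rewrite A_out// mul0e mule0.
  rewrite muleC; apply: lee_wpmul2r => //.
  have I1le y : (I1 y <= (1 * \1_Omega y)%:E)%E by rewrite mul1r.
  have := scatter_contract eps0 mOmega L0 (chord_le L0 HD) (normr1 R) mI I10 ler01 I1le Ox.
  by rewrite mul1r.
have IA : (\int[@lam2 R]_x A x < +oo)%E.
  rewrite integral_A lte_mul_pinfty ?lee_fin ?(ltW pi0)//; exact: integral_Delta_fin.
have IA0 : (0 <= \int[@lam2 R]_x A x)%E by apply: integral_ge0 => x _; exact: A0.
have {IA IA0} IAz : (\int[@lam2 R]_x A x = 0)%E.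
  have := le_trans step2 step3.
  have q1 : q < 1 by rewrite /q gtrBl escape_gt0.
  case: (\int[@lam2 R]_x A x)%E IA IA0 => // r _; rewrite lee_fin => r0.
  rewrite -EFinM lee_fin => rq; congr EFin; apply/eqP; rewrite eq_le r0 andbT.
  have : (1 - q) * r <= 0 by rewrite mulrBl mul1r subr_le0.
  by rewrite pmulr_rle0// subr_gt0.
have ID : (\int[@phase_measure R]_z `|Delta z| = 0)%E.
  transitivity (\int[@phase_measure R]_z Delta z)%E.
    by apply: eq_integral => z _; rewrite gee0_abs.
  move: IAz; rewrite integral_A => /eqP; rewrite mule_eq0 => /orP[|/eqP//].
  by rewrite eqe gt_eqF.
have := (ae_eq_integral_abs (@phase_measure R) measurableT mDelta).1 ID.
apply: phase_aeS => z /(_ I) [/eqP]; rewrite normr_eq0 => /eqP gz Dz.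
by apply/eqP; rewrite -subr_eq0 -gapE// gz.
Qed.
End uniqueness.

(** * General data *)

Section bounded_domain.
Variables (R : realType) (Omega : set (R * R)).
Hypotheses (Omega_open : open Omega) (Omega_bounded : bounded_set Omega).

Lemma bounded_diameter : exists2 L : R, 0 < L &
  forall x y, Omega x -> Omega y -> dot (x - y) (x - y) <= L ^+ 2.
Proof.
have [M M0 HM] := Omega_bound Omega_bounded.
exists (3 * M); first by rewrite mulr_gt0.
move=> x y /HM[x1 x2] /HM[y1 y2]; rewrite /dot/=.
move: x1 x2 y1 y2; rewrite !ler_norml.
move=> /andP[? ?] /andP[? ?] /andP[? ?] /andP[? ?].
have sq (s t : R) : - M <= s -> s <= M -> - M <= t -> t <= M ->
    (s - t) * (s - t) <= 4 * M ^+ 2.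
  move=> *; have : 0 <= (2 * M - (s - t)) * (2 * M + (s - t)) by rewrite mulr_ge0//; lra.
  by rewrite (_ : _ * _ = 4 * M ^+ 2 - (s - t) * (s - t)) ?subr_ge0//; ring.
apply: (@le_trans _ _ (4 * M ^+ 2 + 4 * M ^+ 2)); first by rewrite lerD// sq.
have := sqr_ge0 M; rewrite (_ : (3 * M) ^+ 2 = 9 * M ^+ 2); last by ring.
by set q := M ^+ 2; clearbody q; lra.
Qed.

Lemma bounded_area : (@lam2 R Omega < +oo)%E.
Proof.
have [M M0 HM] := Omega_bound Omega_bounded.
have mI : measurable (`[- M, M] : set (measurableTypeR R)) by exact: measurable_itv.
apply: (@le_lt_trans _ _ (@lam2 R (`[- M, M] `*` `[- M, M]))).
  apply: le_measure; rewrite ?inE.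
  - exact: measurable_Omega Omega_open.
  - exact: measurableX.
  - move=> x /HM[]; rewrite !ler_norml => x1 x2.
    by split; rewrite /= in_itv.
rewrite /lam2 product_measure1E//.
have fin : (lebesgue_measure (`[(- M)%R, M] : set R) < +oo)%E.
  by rewrite lebesgue_measure_itv/=; case: ifP => _; rewrite ?ltry// -EFinD ltry.
by apply: lte_mul_pinfty => //; rewrite ge0_fin_numE.
Qed.

End bounded_domain.

Section nonneg_problem.
Variables (R : realType) (Omega : set (R * R)) (L eps : R).
Hypotheses (Omega_open : open Omega) (Omega_convex : convex_set Omega).
Hypotheses (Omega_bounded : bounded_set Omega) (Omega_C3 : C3_boundary Omega).
Hypotheses (L0 : 0 < L).
Hypothesis HD : forall x y, Omega x -> Omega y -> dot (x - y) (x - y) <= L ^+ 2.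
Hypothesis eps0 : 0 < eps.

Lemma nonneg_problem (h f : (R * R) * (R * R) -> R) (H F a fl : R) :
  measurable_fun (Gamma_minus Omega) h ->
  (forall z, Gamma_minus Omega z -> 0 <= h z <= H) -> 0 <= H ->
  measurable_fun [set: (R * R) * (R * R)] f -> (forall z, 0 <= f z <= F) ->
  (forall z, ~ (Omega `*` @S1 R) z -> f z = 0) ->
  0 < a -> a <= 1 -> (\int[@phase_measure R]_z (f z)%:E <= fl%:E)%E ->
  exists u v, strong_solution Omega eps f h u v /\
    forall z, 0 <= u z <= H + (5 * F + 8 * eps ^- 2 *
      ((smoothing eps a)^-1 * (bheight L eps a * ((2 * pi)^-1 * fl)))).
Proof.
move=> mh hH H0 mf fF fD a0 a1 ffl.
have [v [mv [K vK] v0 vE]] := exists_scalar_solution Omega_open Omega_convex Omega_bounded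
  Omega_C3 L0 HD eps0 mh hH H0 mf fF.
have finO := bounded_area Omega_open Omega_bounded.
have uM := solution_le Omega_open Omega_convex Omega_bounded Omega_C3 L0 HD eps0
  mh hH H0 mf fF mv vK v0 vE a0 a1 ffl finO.
exists (solution Omega eps h f v), v; split.
  exact: (strong_solution_exists Omega_open Omega_convex Omega_bounded Omega_C3 eps0
    mh hH mf fF fD mv vK v0 vE uM).
move=> z; rewrite uM andbT.
exact: (solution_ge0 Omega_open Omega_convex Omega_bounded Omega_C3 eps0 hH mf fF mv vK).
Qed.
End nonneg_problem.

(** * Lebesgue norms on the phase space and the final constant *)

Section norms.
Variables (R : realType) (Omega : set (R * R)).
Hypotheses (Omega_open : open Omega) (Omega_bounded : bounded_set Omega).
Implicit Types f : (R * R) * (R * R) -> R.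

Let D : set ((R * R) * (R * R)) := Omega `*` @S1 R.
Let mD : measurable D := measurable_phase Omega_open.

Lemma phase_norm_ge0 p f : (0 <= phase_norm Omega p f)%E.
Proof. exact: Lnorm_ge0. Qed.

Lemma phase_norm_sup f : {ae @phase_measure R, forall z, D z ->
  (`|f z|%:E <= phase_norm Omega +oo f)%E}.
Proof.
(* The supremum norm is defined by cases on the total mass; with mass zero any property holds almost
   everywhere. *)
rewrite /phase_norm unlock/=; case: ifPn => [_|mu0].
  apply: phase_aeS (ess_sup_ge (@phase_measure R) (abse \o (EFin \o f) \_ D)) => z zP Dz.
  by apply: le_trans zP; rewrite /= patchE mem_set.
have N : (@phase_measure R).-negligible [set: (R * R) * (R * R)].
  apply/negligibleP => //; apply/eqP; rewrite eq_le measure_ge0 andbT.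
  by rewrite leNgt.
exact: negligibleS N.
Qed.

Lemma phase_norm_sup_le f (M : R) : 0 <= M -> (forall z, D z -> `|f z| <= M) ->
  (phase_norm Omega +oo f <= M%:E)%E.
Proof.
move=> M0 fM; rewrite /phase_norm unlock/=; case: ifPn => [_|_]; last by rewrite lee_fin.
apply/ess_supP; apply: aeW => z /=; rewrite patchE; case: ifPn => [|_].
  by rewrite inE => Dz; rewrite /= lee_fin fM.
by rewrite abse0 lee_fin.
Qed.

Definition area_factor (q : R) : R := fine ((@phase_measure R D) `^ q^-1)%E.

Lemma area_factor_ge0 q : 0 <= area_factor q.
Proof. by apply: fine_ge0; exact: poweR_ge0. Qed.

Lemma phase_norm1_le f (p q : R) : measurable_fun D f -> 0 < p -> 0 < q ->
  p^-1 + q^-1 = 1 ->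
  (\int[@phase_measure R]_z `|((f \_ D) z)%:E| <=
   phase_norm Omega p%:E f * (area_factor q)%:E)%E.
Proof.
move=> mf p0 q0 pq.
have mfD : measurable_fun [set: (R * R) * (R * R)] (f \_ D).
  by apply/(measurable_restrictT _ _).1.
have mI : measurable_fun [set: (R * R) * (R * R)] (\1_D : (R * R) * (R * R) -> R).
  exact: measurable_indic.
have := hoelder (@phase_measure R) mfD mI p0 q0 pq; rewrite Lnorm1.
have -> : (EFin \o (f \_ D)) = (EFin \o f) \_ D by rewrite restrict_EFin.
have -> : ('N[@phase_measure R]_q%:E[EFin \o (\1_D : _ -> R)] = (area_factor q)%:E)%E.
  rewrite /area_factor fineK; last first.
    rewrite ge0_fin_numE ?poweR_ge0//; apply: poweR_lty.
    exact: finite_phase Omega_open (bounded_area Omega_open Omega_bounded).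
  rewrite unlock; congr (_ `^ _)%E.
  transitivity (\int[@phase_measure R]_z (\1_D z)%:E)%E; last by rewrite integral_indic// setIT.
  apply: eq_integral => z _ /=; rewrite indicE; case: (_ \in _) => /=.
    by rewrite normr1 powR1.
  by rewrite normr0 powR0// gt_eqF.
apply: le_trans; rewrite le_eqVlt; apply/orP; left; apply/eqP; apply: eq_integral => z _.
rewrite /= patchE indicE; case: ifPn => _; first by rewrite mulr1.
by rewrite mulr0.
Qed.

End norms.

Section constants.
Variables (R : realType) (Omega : set (R * R)) (L : R) (m : nat).
Hypothesis m0 : (0 < m)%N.

(** The exponent a = 1/(2m): the loss (eps^2)^a is then eps^(1/m). Its inverse 2m is also the
    conjugate exponent of 2m/(2m-1), used in Hoelder's inequality. *)
Definition sup_exponent : R := (2 * m)%:R^-1.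
(** A bound on [bheight] uniform in [eps < 1]. *)
Definition sup_height : R := 2 * (1 + 4 * L ^+ 2 + 36 / sup_exponent ^+ 2).
(** The 5 and the 8 are those of [solution_le], 36/a^4 inverts the numerical factor of [smoothing],
    1/(2 pi) is the direction average and the area factor comes from Hoelder's inequality. *)
Definition sup_constant : R := 5 + 8 * (36 / sup_exponent ^+ 4) *
  (sup_height * ((2 * pi)^-1 * area_factor Omega (2 * m)%:R)).

Let m20 : (0 < 2 * m)%N. Proof. by rewrite muln_gt0. Qed.

Lemma sup_exponent_gt0 : 0 < sup_exponent.
Proof. by rewrite invr_gt0 ltr0n. Qed.

Lemma sup_exponent_le1 : sup_exponent <= 1.
Proof. by rewrite invf_le1 ?ltr0n// ler1n. Qed.

Lemma sup_height_gt0 : 0 < sup_height.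
Proof.
have a0 := sup_exponent_gt0.
by rewrite mulr_gt0// ltr_pwDl ?divr_ge0 ?exprn_ge0 ?(ltW a0)// ltr_pwDl// mulr_ge0// sqr_ge0.
Qed.

Let pi0 : 0 <= (2 * pi)^-1 :> R. Proof. by rewrite invr_ge0 mulr_ge0// pi_ge0. Qed.

Let tail_ge0 : 0 <= 8 * (36 / sup_exponent ^+ 4) *
  (sup_height * ((2 * pi)^-1 * area_factor Omega (2 * m)%:R)).
Proof.
have a0 := sup_exponent_gt0.
apply: mulr_ge0; first by rewrite mulr_ge0// divr_ge0// exprn_ge0// ltW.
apply: mulr_ge0; first exact/ltW/sup_height_gt0.
by apply: mulr_ge0 => //; exact: area_factor_ge0.
Qed.

Lemma sup_constant_gt0 : 0 < sup_constant.
Proof. by rewrite ltr_pwDl. Qed.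

(** The power 2 + 1/m of 1/eps is the eps^-2 of the two-flight bound times the eps^(-1/m) of
    [smoothing]. *)
Lemma sup_bound_le (eps F H np : R) : 0 < eps -> eps < 1 -> 0 <= F -> 0 <= H -> 0 <= np ->
  H + (5 * F + 8 * eps ^- 2 * ((smoothing eps sup_exponent)^-1 *
    (bheight L eps sup_exponent * ((2 * pi)^-1 * (np * area_factor Omega (2 * m)%:R))))) <=
  sup_constant * ((eps `^ (2 + m%:R^-1))^-1 * np + F + H).
Proof.
move=> e0 e1 F0 H0 np0; have a0 := sup_exponent_gt0.
have mR : (m%:R : R) != 0 by rewrite pnatr_eq0 -lt0n.
set s := eps `^ m%:R^-1; have s0 : 0 < s by exact: powR_gt0.
have sE : (eps ^+ 2) `^ sup_exponent = s.
  rewrite -(@powR_mulrn R eps 2) ?ltW// -powRrM /s; congr (_ `^ _).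
  by rewrite /sup_exponent natrM; field.
have cE : eps `^ (2 + m%:R^-1) = eps ^+ 2 * s.
  by rewrite powRD; [rewrite powR_mulrn ?ltW|apply/implyP; rewrite gt_eqF].
have hle : bheight L eps sup_exponent <= sup_height.
  rewrite /bheight /sup_height ler_pM2l// lerD2l bwidth_sqr//.
  by rewrite ler_piMr ?divr_ge0 ?exprn_ge0 ?(ltW a0)// expr_le1 ?ltW.
rewrite /smoothing sE cE.
set a4 := sup_exponent ^+ 4; have a40 : 0 < a4 by rewrite exprn_gt0.
set cq := area_factor _ _; have cq0 : 0 <= cq by exact: area_factor_ge0.
have e20 : 0 < eps ^+ 2 by rewrite exprn_gt0.
set X := (eps ^+ 2 * s)^-1 * np.
have X0 : 0 <= X by rewrite mulr_ge0// invr_ge0 mulr_ge0// ltW.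
have -> : 8 * eps ^- 2 * ((a4 / 36 * s)^-1 * (bheight L eps sup_exponent *
    ((2 * pi)^-1 * (np * cq)))) =
    8 * (36 / a4) * (bheight L eps sup_exponent * ((2 * pi)^-1 * cq)) * X.
  rewrite /X; move: (pi_gt0 R); move: (@pi R) => p p0.
  by field; rewrite !gt_eqF.
have le1 : 8 * (36 / a4) * (bheight L eps sup_exponent * ((2 * pi)^-1 * cq)) * X <=
    8 * (36 / a4) * (sup_height * ((2 * pi)^-1 * cq)) * X.
  apply: ler_wpM2r => //; apply: ler_wpM2l.
    by rewrite mulr_ge0// divr_ge0// ltW.
  by apply: ler_wpM2r => //; rewrite mulr_ge0.
have T0 := tail_ge0.
rewrite /sup_constant -/a4 -/cq.
move: le1 T0; rewrite -/a4 -/cq.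
set T := 8 * (36 / a4) * (sup_height * _); set B := 8 * _ * _ * X => le1 T0.
have TF : 0 <= T * F by exact: mulr_ge0.
have TH : 0 <= T * H by exact: mulr_ge0.
rewrite (_ : (5 + T) * (X + F + H) = 5 * X + 5 * F + 5 * H + T * X + T * F + T * H);
  last by ring.
move: le1 TF TH X0 F0 H0; clearbody B X; set TX := T * X; set TFF := T * F; set THH := T * H.
by clearbody TX TFF THH; lra.
Qed.

End constants.

Theorem theorem3p5 (R : realType) (Omega : set (R * R)) (m : nat)
    (Omega0 : Omega !=set0) (Omega_open : open Omega)
    (Omega_bounded : bounded_set Omega) (Omega_convex : convex_set Omega)
    (Omega_C3 : C3_boundary Omega) (m2 : (2 < m)%N) :
  exists C eps0 : R, [/\ 0 < C, 0 < eps0 &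
    forall eps : R, 0 < eps -> eps < eps0 ->
    forall f h : (R * R) * (R * R) -> R,
      measurable_fun (Omega `*` @S1 R) f ->
      measurable_fun (Gamma_minus Omega) h ->
      (phase_norm Omega 2%:E f < +oo)%E ->
      (phase_norm Omega ((2 * m)%:R / (2 * m - 1)%:R)%:E f < +oo)%E ->
      (phase_norm Omega +oo f < +oo)%E ->
      (inflow_norm Omega 2 h < +oo)%E ->
      (inflow_norm Omega m%:R h < +oo)%E ->
      (inflow_sup_norm Omega h < +oo)%E ->
    exists u : (R * R) * (R * R) -> R,
      [/\ transport_solution Omega eps f h u,
          forall v, transport_solution Omega eps f h v ->
            {ae @phase_measure R, forall z, (Omega `*` @S1 R) z -> v z = u z} &
          (phase_norm Omega +oo u <=
            C%:E *
            ((eps `^ (1 + m%:R^-1))^-1%:E * phase_norm Omega 2%:E f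
             + (eps `^ (2 + m%:R^-1))^-1%:E
               * phase_norm Omega ((2 * m)%:R / (2 * m - 1)%:R)%:E f
             + phase_norm Omega +oo f
             + (eps `^ (2^-1 + m%:R^-1))^-1%:E * inflow_norm Omega 2 h
             + (eps `^ m%:R^-1)^-1%:E * inflow_norm Omega m%:R h
             + inflow_sup_norm Omega h))%E]].
Proof.
have m0 : (0 < m)%N by exact: ltn_trans m2.
have [L L0 HD] := bounded_diameter Omega_bounded.
have finO := bounded_area Omega_open Omega_bounded.
(* Smallness of [eps] enters through the bound 36/a^2 on the squared barrier width, for which
   [eps < 1] suffices. *)
exists (sup_constant Omega L m), 1; split => //; first exact: sup_constant_gt0.
move=> eps eps0 eps1 f h mf mh f2 fp foo h2 hm hoo.
pose D : set ((R * R) * (R * R)) := Omega `*` @S1 R.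
have mD : measurable D := measurable_phase Omega_open.
pose fD : (R * R) * (R * R) -> R := f \_ D.
have mfD : measurable_fun [set: (R * R) * (R * R)] fD.
  by apply/(measurable_restrictT _ _).1.
pose F := fine (phase_norm Omega +oo f).
have F0 : 0 <= F by apply: fine_ge0; exact: phase_norm_ge0.
have FE : phase_norm Omega +oo f = F%:E.
  by rewrite /F fineK// ge0_fin_numE ?phase_norm_ge0.
pose H := fine (inflow_sup_norm Omega h).
have hsup z : Gamma_minus Omega z -> (`|h z|%:E <= inflow_sup_norm Omega h)%E.
  by move=> Gz; apply: ereal_sup_ubound; exists z.
(* A nonempty [Omega] has an incoming boundary point, so the supremum is not taken over the empty
   set, where it would be -oo. *)
have [HE H0] : inflow_sup_norm Omega h = H%:E /\ 0 <= H.
  have [x Ox] := Omega0.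
  have w1 : @S1 R (1, 0) by apply/S1P; rewrite /dot/= mulr0 addr0 mulr1.
  have := hsup _ (exit_Gamma_minus Omega_open Omega_convex Omega_bounded Omega_C3 Ox w1).
  move=> /(le_trans (_ : 0 <= _)%E) sup0.
  have {}sup0 : (0 <= inflow_sup_norm Omega h)%E by apply: sup0; rewrite lee_fin.
  by rewrite /H fineK ?ge0_fin_numE// fine_ge0.
have hH z : Gamma_minus Omega z -> `|h z| <= H.
  by move=> /hsup; rewrite HE lee_fin.
(* The construction needs a bound at every point, the norm gives one almost everywhere; [f] is
   replaced by zero where it exceeds its norm, which changes it on a null set. *)
pose f0 z : R := if `|fD z| <= F then fD z else 0.
have f0F z : `|f0 z| <= F by rewrite /f0; case: ifPn => // _; rewrite normr0.
have f0fD z : `|f0 z| <= `|fD z| by rewrite /f0; case: ifPn => // _; rewrite normr0.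
have f0D z : ~ D z -> f0 z = 0.
  by move=> nD; rewrite /f0 /fD patchE memNset// if_same.
have mf0 : measurable_fun [set: (R * R) * (R * R)] f0.
  apply: measurable_fun_ifT => //.
  apply: measurable_fun_ler; last exact: measurable_cst.
  exact: measurableT_comp.
have f0f : {ae @phase_measure R, forall z, D z -> f0 z = f z}.
  apply: phase_aeS (phase_norm_sup Omega f) => z zP Dz.
  have := zP Dz; rewrite FE lee_fin => fF.
  by rewrite /f0 /fD patchE mem_set// fF.
pose f1 z : R := Num.max (f0 z) 0; pose f2' z : R := Num.max (- f0 z) 0.
pose h1 z : R := Num.max (h z) 0; pose h2' z : R := Num.max (- h z) 0.
have maxN (t : R) : Num.max t 0 - Num.max (- t) 0 = t.
  by case: (leP t 0) => ?; case: (leP (- t) 0) => ?; lra.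
have max_le (t k : R) : `|t| <= k -> 0 <= Num.max t 0 <= k.
  by rewrite ler_norml le_max lexx orbT ge_max /= => /andP[k1 k2]; rewrite k2/=; lra.
pose np := fine (phase_norm Omega ((2 * m)%:R / (2 * m - 1)%:R)%:E f).
have npE : phase_norm Omega ((2 * m)%:R / (2 * m - 1)%:R)%:E f = np%:E.
  by rewrite /np fineK// ge0_fin_numE ?phase_norm_ge0.
have np0 : 0 <= np by apply: fine_ge0; exact: phase_norm_ge0.
pose fl := np * area_factor Omega (2 * m)%:R.
have Il : (\int[@phase_measure R]_z `|(fD z)%:E| <= fl%:E)%E.
  rewrite /fl EFinM -npE; apply: phase_norm1_le => //.
  - by rewrite divr_gt0 ?ltr0n ?subn_gt0 ?muln_gt0// (leq_trans _ (leq_pmulr 2 m0)).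
  - by rewrite ltr0n muln_gt0.
  - rewrite invf_div natrB; last by rewrite muln_gt0.
    by rewrite mulrBl div1r divff ?subrK// pnatr_eq0 -lt0n muln_gt0.
have int_le (g : (R * R) * (R * R) -> R) : measurable_fun [set: (R * R) * (R * R)] g ->
    (forall z, 0 <= g z <= `|f0 z|) -> (\int[@phase_measure R]_z (g z)%:E <= fl%:E)%E.
  move=> mg gf; apply: le_trans Il; apply: ge0_le_integral => //.
  - by move=> z _; rewrite lee_fin; have /andP[] := gf z.
  - exact/measurable_EFinP.
  - by apply: measurableT_comp => //; exact/measurable_EFinP.
  - by move=> z _; rewrite lee_fin; have /andP[_] := gf z; move/le_trans; exact.
have mf1 : measurable_fun [set: (R * R) * (R * R)] f1.
  by apply: measurable_maxr => //; exact: measurable_cst.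
have mf2 : measurable_fun [set: (R * R) * (R * R)] f2'.
  by apply: measurable_maxr; [exact: measurable_funN|exact: measurable_cst].
have mh1 : measurable_fun (Gamma_minus Omega) h1.
  by apply: measurable_maxr => //; exact: measurable_cst.
have mh2 : measurable_fun (Gamma_minus Omega) h2'.
  by apply: measurable_maxr; [exact: measurable_funN|exact: measurable_cst].
have a0 := sup_exponent_gt0 R m0; have a1 := sup_exponent_le1 R m0.
have h1H z : Gamma_minus Omega z -> 0 <= h1 z <= H by move=> /hH; exact: max_le.
have h2H z : Gamma_minus Omega z -> 0 <= h2' z <= H.
  by move=> /hH hz; apply: max_le; rewrite normrN.
have f1f0 z : 0 <= f1 z <= `|f0 z| by exact: max_le.
have f2f0 z : 0 <= f2' z <= `|f0 z| by apply: max_le; rewrite normrN.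
have f1F z : 0 <= f1 z <= F.
  by have /andP[-> /le_trans] := f1f0 z; apply.
have f2F z : 0 <= f2' z <= F.
  by have /andP[-> /le_trans] := f2f0 z; apply.
have f1D z : ~ D z -> f1 z = 0 by move=> /f0D f00; rewrite /f1 f00 maxxx.
have f2D z : ~ D z -> f2' z = 0 by move=> /f0D f00; rewrite /f2' f00 oppr0 maxxx.
have [u1 [v1 [s1 b1]]] := nonneg_problem Omega_open Omega_convex Omega_bounded Omega_C3
  L0 HD eps0 mh1 h1H H0 mf1 f1F f1D a0 a1 (int_le f1 mf1 f1f0).
have [u2 [v2 [s2 b2]]] := nonneg_problem Omega_open Omega_convex Omega_bounded Omega_C3
  L0 HD eps0 mh2 h2H H0 mf2 f2F f2D a0 a1 (int_le f2' mf2 f2f0).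
have s12 := strong_solutionB s1 s2.
pose u z := u1 z - u2 z.
have tu : transport_solution Omega eps f h u.
  apply: (strong_transport Omega_open finO s12 eps0).
    by apply: phase_aeS f0f => z zP Dz; rewrite /f1 /f2' maxN zP.
  by move=> z _; rewrite /h1 /h2' maxN.
have bE := sup_bound_le Omega L m0 eps0 eps1 F0 H0 np0.
set bnd := (X in X <= _) in bE.
(* Both parts lie between 0 and the same bound, so taking the difference costs no factor 2. *)
have ub z : `|u z| <= bnd.
  have := b1 z; have := b2 z; rewrite -/bnd /u ler_norml.
  by move: bnd {bE b1 b2} => bnd; lra.
exists u; split => //.
  move=> v tv; have [mu _ _ _ _ _ _] := s12.
  exact: (transport_solution_unique Omega_open Omega_convex Omega_bounded Omega_C3 L0 HD
    eps0 finO mu ub tu tv).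
have bnd0 : 0 <= bnd by exact: le_trans (normr_ge0 _) (ub ((0, 0), (0, 0))).
apply: (le_trans (phase_norm_sup_le bnd0 (fun z _ => ub z))).
apply: (@le_trans _ _ ((sup_constant Omega L m)%:E *
  ((eps `^ (2 + m%:R^-1))^-1 * np + F + H)%:E)%E); first by rewrite -EFinM lee_fin.
apply: lee_wpmul2l; first by rewrite lee_fin ltW// sup_constant_gt0.
rewrite npE FE HE !EFinD EFinM; apply: leeD => //.
have N0 (c : R) (x : \bar R) : 0 <= c -> (0 <= x)%E -> (0 <= c%:E * x)%E.
  by move=> c0 x0; rewrite mule_ge0.
have pw (r : R) : 0 <= (eps `^ r)^-1 by rewrite invr_ge0 powR_ge0.
rewrite -[leLHS]adde0; apply: leeD; last by apply: N0 => //; exact: poweR_ge0.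
rewrite -[leLHS]adde0; apply: leeD; last by apply: N0 => //; exact: poweR_ge0.
apply: leeD => //; rewrite leeDr//; apply: N0 => //; exact: phase_norm_ge0.
Qed.
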